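(* Let $\mu_1,\dots,\mu_6\in\mathbb{C}$ be such that $g_2=\frac1{12}(4\mu_2+\mu_1^2)^2-2(\mu_1\mu_3+2\mu_4)$ and $g_3=\frac16(\mu_1\mu_3+2\mu_4)(4\mu_2+\mu_1^2)-\frac1{216}(4\mu_2+\mu_1^2)^3-4\mu_6-\mu_3^2$ satisfy $g_2^3-27g_3^2\ne0$, and let $\wp,\sigma,\zeta$ be the Weierstrass functions with these invariants. Choose $v,w$ with $\wp(v)=\frac1{12}(4\mu_2+\mu_1^2)$, $\wp'(w)=-\mu_3$, assume $\wp'(v)\ne0$ and put $\alpha=\wp'(w)/\wp'(v)$. Let $f$ be the exponential of the elliptic formal group law $F_\mu$, and let $\Psi$ be the solution near $u=0$ of $\Psi'+\frac{1}{f(u)}\Psi=0$ with $\lim_{u\to0}(\Psi(u)-\frac1u)$ finite. Then, near $u=0$, \[ \frac{1}{\Psi(u)}=\Phi(u;v)^{-1}\exp\Big(\frac{\mu_1}{2}u\Big)\Big(\frac{\Phi(u;v)}{\Phi(u;-v)}\Big)^{\frac12(1-\alpha)}, \] where $\Phi(u;v)=\frac{\sigma(v-u)}{\sigma(u)\sigma(v)}\exp(\zeta(v)u)$ and the power is the branch equal to $1$ at $u=0$.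
   Context: The elliptic formal group law $F_\mu$: on the cubic $Y^2Z+\mu_1XYZ+\mu_3YZ^2=X^3+\mu_2X^2Z+\mu_4XZ^2+\mu_6Z^3$ with chord-tangent group law (neutral element $O=(0:1:0)$, three collinear points sum to zero), Tate coordinates $t=-X/Y$, $s=-Z/Y$ give $s=t^3+\mu_1ts+\mu_2t^2s+\mu_3s^2+\mu_4ts^2+\mu_6s^3$ with $s(t)$ the power series solution with $s(0)=0$; $F_\mu(t_1,t_2)$ gives the $t$-coordinate of $P_1+P_2$ for $P_i=(t_i,s(t_i))$. Its exponential is the series $f$ with $f(0)=0$, $f'(0)=1$, $f(u+v)=F_\mu(f(u),f(v))$. $\wp'^2=4\wp^3-g_2\wp-g_3$, $\sigma$ is the Weierstrass sigma function (entire, odd, $\sigma(u)=u+O(u^5)$), $\zeta=\sigma'/\sigma$. The Hirzebruch genus with exponential $1/\Psi$ is called the general Krichever genus. *)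

(* Defs.v *)
(* Complex numbers are R[i] for R : realType
   (mathcomp-real-closed `complex`); complex differentiability is `derivable f z 1`
   and the complex derivative is `derive1` (both valid over any numFieldType). *)
From HB Require Import structures.
From mathcomp Require Import all_boot all_order all_algebra.
From mathcomp Require Import all_classical all_reals all_analysis.
From mathcomp Require Import complex.
Set Implicit Arguments.
Unset Strict Implicit.
Unset Printing Implicit Defensive.
Import Order.TTheory GRing.Theory Num.Theory.
Import numFieldNormedType.Exports.
Local Open Scope classical_set_scope.
Local Open Scope ring_scope.

(* Canonical topological / normed-module structure of R[i] over itself
   (the library provides these only for abstract numFieldTypes). *)
HB.instance Definition _ (R : realType) := PseudoPointedMetric.copy R[i] R[i]^o.
HB.instance Definition _ (R : realType) := GRing.ComAlgebra.copy R[i] R[i]^o.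
HB.instance Definition _ (R : realType) := Vector.copy R[i] R[i]^o.
HB.instance Definition _ (R : realType) := NormedModule.copy R[i] R[i]^o.

Section Defs.
Variable R : realType.
Local Notation C := (R[i]).
Implicit Types (z u t : C) (sig f s Psi L : C -> C).

Definition expC (z : C) : C := limn (series (fun n => z ^+ n / n`!%:R)).

Definition wzeta sig (u : C) : C := derive1 sig u / sig u.
Definition wp sig (u : C) : C := - derive1 (wzeta sig) u.
Definition wp' sig (u : C) : C := derive1 (wp sig) u.

(* sig is the Weierstrass sigma function with invariants g2, g3:
   entire, odd, sig(u) = u + O(u^5) at 0, and wp = -(sig'/sig)' satisfies
   wp'^2 = 4 wp^3 - g2 wp - g3 (away from the zeros of sig, i.e. the poles of wp).
   For g2^3 - 27 g3^2 <> 0 these properties characterize the Weierstrass sigma. *)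
Definition is_weierstrass_sigma (g2 g3 : C) sig : Prop :=
  [/\ (forall z, derivable sig z 1),
      (forall z, sig (- z) = - sig z),
      (exists K r : C, 0 < r /\ forall u, `|u| < r -> `|sig u - u| <= K * `|u| ^+ 5) &
      (forall u, sig u != 0 ->
         (wp' sig u) ^+ 2 = 4 * (wp sig u) ^+ 3 - g2 * wp sig u - g3)].

(* Right-hand side of the cubic in Tate coordinates t = -X/Y, s = -Z/Y *)
Definition tate_rhs (mu1 mu2 mu3 mu4 mu6 t s : C) : C :=
  t ^+ 3 + mu1 * t * s + mu2 * t ^+ 2 * s + mu3 * s ^+ 2 + mu4 * t * s ^+ 2
  + mu6 * s ^+ 3.

Definition is_tate_s (mu1 mu2 mu3 mu4 mu6 : C) s : Prop :=
  s 0 = 0 /\ exists r : C, 0 < r /\ forall t, `|t| < r ->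
    derivable s t 1 /\ s t = tate_rhs mu1 mu2 mu3 mu4 mu6 t (s t).

(* Chord-tangent law in Tate coordinates, for points P_i = (t_i, s(t_i)) near O=(0,0).
   lam, nu: the line s = lam t + nu through P1, P2 (tangent line if t1 = t2).
   Substituting it in the cubic gives A t^3 + B t^2 + ... = 0, so the third
   intersection point is P3 = (t3, lam t3 + nu) with t3 = -B/A - t1 - t2.
   Then P1 + P2 = -P3, and the negation is (t, s) |-> t / (mu1 t + mu3 s - 1)
   (i.e. (x, y) |-> (x, -y - mu1 x - mu3) in affine Weierstrass coordinates). *)
Definition fgl_mu (mu1 mu2 mu3 mu4 mu6 : C) s (t1 t2 : C) : C :=
  let lam := if t1 == t2 then derive1 s t1 else (s t2 - s t1) / (t2 - t1) in
  let nu := s t1 - lam * t1 in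
  let A := 1 + mu2 * lam + mu4 * lam ^+ 2 + mu6 * lam ^+ 3 in
  let B := mu1 * lam + mu2 * nu + mu3 * lam ^+ 2 + 2 * mu4 * lam * nu
           + 3 * mu6 * lam ^+ 2 * nu in
  let t3 := - (B / A) - t1 - t2 in
  let s3 := lam * t3 + nu in
  t3 / (mu1 * t3 + mu3 * s3 - 1).

Definition is_fgl_exp (mu1 mu2 mu3 mu4 mu6 : C) s f : Prop :=
  [/\ f 0 = 0, derive1 f 0 = 1 &
    exists r : C, 0 < r /\ (forall u, `|u| < r -> derivable f u 1) /\
      forall u v, `|u| < r -> `|v| < r ->
        f (u + v) = fgl_mu mu1 mu2 mu3 mu4 mu6 s (f u) (f v)].

Definition is_Psi_solution f Psi : Prop :=
  exists r : C, 0 < r /\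
    (forall u, 0 < `|u| < r -> derivable Psi u 1 /\ derive1 Psi u + Psi u / f u = 0)
    /\ exists c : C, (fun u => Psi u - u^-1) @ (0 : C)^' --> c.

(* L is the branch of log g near 0 with L(0) = 0: continuous on a disc around 0,
   L(0) = 0 and exp(L u) = g u for u <> 0 in the disc.  The power g^a with
   value 1 at 0 is then expC (a * L u). *)
Definition is_branch_log (g L : C -> C) : Prop :=
  L 0 = 0 /\ exists r : C, 0 < r /\ forall u, `|u| < r ->
    {for u, continuous L} /\ (u != 0 -> expC (L u) = g u).

Definition PhiW sig (u v : C) : C :=
  sig (v - u) / (sig u * sig v) * expC (wzeta sig v * u).

End Defs.

(* Main.v *)
(** Write p for the Weierstrass function, e = p(v) and c = p'(v).  Differentiating the addition
    law f(u + h) = F(f(u), f(h)) at h = 0 shows that t = f(u) and s = s(f(u)) solve a polynomial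
    system with quadratic right-hand sides; the Tate coordinates of the curve parametrised by p
    and p' solve the same system with the same initial value, so by uniqueness
      1 / f(u) = mu1 / 2 - (p'(u) - mu3) / (2 (p(u) - e)).
    The addition formula zeta(u - v) - zeta(u) + zeta(v) = (p'(u) + c) / (2 (p(u) - e)) and its
    analogue for -v give the logarithmic derivatives of Phi(u; v) and Phi(u; -v), and then Psi
    times the claimed expression for 1 / Psi has derivative 0 and tends to 1 at 0.  The addition
    formula itself is a uniqueness statement for y'' = 6 y^2 - g2 / 2: the function
    ((p' + c) / (2 (p - e)))^2 - p - e extends to u = 0 with the Cauchy data of p(u - v).

    The hypotheses give sigma only as a complex differentiable function, so its higher
    derivatives come from Goursat's lemma and Cauchy's formula on a square; the integral of a
    continuous curve is the increment of a primitive. *)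
Require Import Defs.
From HB Require Import structures.
From mathcomp Require Import all_boot all_order all_algebra.
From mathcomp Require Import all_classical all_reals all_analysis.
From mathcomp Require Import complex.
From mathcomp Require Import ring lra.
Import Order.TTheory GRing.Theory Num.Theory.
Import numFieldNormedType.Exports.
Import Normc.
Local Open Scope classical_set_scope.
Local Open Scope ring_scope.
Local Open Scope complex_scope.
Set Implicit Arguments.
Unset Strict Implicit.
Unset Printing Implicit Defensive.

(** The exponent in the theorem comes from partial fractions. With alpha = - mu3 / c one has p' -
    mu3 = (1 + alpha)/2 * (p' + c) + (1 - alpha)/2 * (p' - c), so Psi'/Psi = - 1/f is - mu1/2 plus
    these multiples of the logarithmic derivatives of Phi(u; v) and Phi(u; -v). The formula for 1/f
    is t = - x/y for the uniformisation x = p - e, 2 y = p' - mu1 x - mu3 of the cubic. The obstacle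
    is that everything happens at u = 0, where zeta, p and p' have poles. Arguments at 0 therefore
    use two expressions for the same function: one in p and p', which can be differentiated off 0,
    and one with the poles cancelled, which is continuous at 0. Accordingly the uniqueness and mean
    value lemmas ask for derivatives only off 0 and for continuity at 0. The second derivative of p
    is obtained from the Weierstrass equation by dividing by p', so it is used only where p' is
    nonzero: near 0 because of the pole, near - v because c is nonzero. *)

Section ComplexNorm.
Variable R : realType.
Local Notation C := (R[i]).
Local Notation N := (@normc R).
Local Notation Re := (@complex.Re R).
Local Notation Im := (@complex.Im R).
Implicit Types (z w : C) (a b : R).

(** * The real-valued modulus and neighbourhoods in the complex plane *)

Lemma normc_ge0 z : 0 <= N z.
Proof. by case: z => a b; exact: sqrtr_ge0. Qed.

Lemma normcD z w : N (z + w) <= N z + N w.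
Proof. exact: le_normcD. Qed.

Lemma normc_opp z : N (- z) = N z.
Proof. exact: normcN. Qed.

Lemma normc_sub z w : N (z - w) <= N z + N w.
Proof. by rewrite -[N w]normc_opp; exact: normcD. Qed.

Lemma normc_distC z w : N (z - w) = N (w - z).
Proof. by rewrite -normc_opp opprB. Qed.

Lemma normcB_ge z w : N z - N w <= N (z - w).
Proof. by have := normcD (z - w) w; rewrite subrK; lra. Qed.

Lemma normc_gt0 z : (0 < N z) = (z != 0).
Proof.
rewrite lt_def normc_ge0 andbT; apply/idP/idP; apply: contra => /eqP.
  by move=> ->; rewrite normc0.
by move/eq0_normc => ->.
Qed.

Lemma normc_real a : N a%:C = `|a|.
Proof. by rewrite /= expr0n/= addr0 sqrtr_sqr. Qed.

Lemma normc_i : N 'i = 1.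
Proof. by rewrite /= expr0n/= expr1n add0r sqrtr1. Qed.

Lemma normc_Re z : `|Re z| <= N z.
Proof.
case: z => a b /=; rewrite -sqrtr_sqr; apply: ler_wsqrtr.
by rewrite lerDl sqr_ge0.
Qed.

Lemma normc_Im z : `|Im z| <= N z.
Proof.
case: z => a b /=; rewrite -sqrtr_sqr; apply: ler_wsqrtr.
by rewrite lerDr sqr_ge0.
Qed.

Lemma normc_ReIm z : N z <= `|Re z| + `|Im z|.
Proof.
rewrite {1}(complexE z) (le_trans (normcD _ _))// normcM normc_i mul1r.
by rewrite !normc_real.
Qed.

Lemma normcX z n : N (z ^+ n) = N z ^+ n.
Proof.
by elim: n => [|n IH]; [rewrite !expr0 normc1 | rewrite !exprS normcM IH].
Qed.

Lemma normcE_norm z : `|z| = (N z)%:C.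
Proof. by []. Qed.

(** The order of [R[i]] is partial and a positive element has imaginary part 0, so the complex radii
    in the hypotheses become real ones. *)
Lemma pos_complexE (r : C) : 0 < r -> exists2 k : R, 0 < k & r = k%:C.
Proof.
case: r => a b; rewrite ltcE/= => /andP[/eqP bE a0]; exists a => //.
by rewrite bE.
Qed.

Lemma normr_ltc z a : (`|z| < a%:C) = (N z < a).
Proof. by rewrite normcE_norm ltcR. Qed.

Lemma normr_lec z a : (`|z| <= a%:C) = (N z <= a).
Proof. by rewrite normcE_norm lecR. Qed.

Lemma nbhs_normcP z (P : C -> Prop) :
  (\forall x \near z, P x) <-> exists2 k : R, 0 < k & forall x, N (x - z) < k -> P x.
Proof.
split.
  case/nbhs_ballP => e /= /pos_complexE[k k0 ->] h; exists k => // x xz.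
  by apply: h; rewrite -ball_normE /= normr_ltc normc_distC.
move=> [k k0 h]; apply/nbhs_ballP; exists k%:C => /=; first by rewrite ltcR.
by move=> x; rewrite -ball_normE /= normr_ltc normc_distC; exact: h.
Qed.

Lemma dnbhs_normcP z (P : C -> Prop) :
  (\forall x \near z^', P x) <->
  exists2 k : R, 0 < k & forall x, x != z -> N (x - z) < k -> P x.
Proof.
split.
  by case/nbhs_normcP => k k0 h; exists k => // x xz xk; exact: h.
move=> [k k0 h]; rewrite /dnbhs near_withinE.
by apply/nbhs_normcP; exists k => // x xk xz; exact: h.
Qed.

Lemma cvg_normcP (T : Type) (F : set_system T) (FF : Filter F) (g : T -> C) l :
  g x @[x --> F] --> l <-> forall e : R, 0 < e -> \forall x \near F, N (g x - l) <= e.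
Proof.
rewrite cvgrPdist_le; split.
  move=> h e e0; have := h e%:C; rewrite ltcR => /(_ e0).
  by apply: filterS => x; rewrite normr_lec normc_distC.
move=> h _ /pos_complexE[e e0 ->]; apply: filterS (h e e0) => x.
by rewrite normr_lec normc_distC.
Qed.

Lemma realnbhsP (x : R) (P : R -> Prop) :
  (\forall y \near x, P y) <-> exists2 k : R, 0 < k & forall y : R, `|y - x| < k -> P y.
Proof.
split.
  case/nbhs_ballP => e /= e0 h; exists e => // y xz.
  by apply: h; rewrite -ball_normE /= distrC.
move=> [k k0 h]; apply/nbhs_ballP; exists k => //=.
by move=> y; rewrite -ball_normE /= distrC; exact: h.
Qed.

End ComplexNorm.

(** * Calculus rules for complex derivatives and continuity *)

Section ComplexDerivative.
Variable R : realType.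
Local Notation C := (R[i]).
Local Notation N := (@normc R).
Local Notation Re := (@complex.Re R).
Local Notation Im := (@complex.Im R).
Implicit Types (f g : C -> C) (z w d : C).

(* epsilon-delta forms with the real-valued modulus, which avoid the partial order on R[i] *)
Definition hasd g z d := forall e : R, 0 < e ->
  exists2 k : R, 0 < k & forall w, N (w - z) < k ->
    N (g w - g z - d * (w - z)) <= e * N (w - z).

Definition cts g z := forall e : R, 0 < e ->
  exists2 k : R, 0 < k & forall w, N (w - z) < k -> N (g w - g z) <= e.

Lemma hasdP g z d : hasd g z d <-> derivable g z 1 /\ derive1 g z = d.
Proof.
pose q := (fun h : C => h^-1 *: ((g \o shift z) (h *: 1) - g z)).
suff qP : hasd g z d <-> q x @[x --> 0^'] --> d.
  rewrite qP derive1E; split.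
    by move=> h; split; [apply/cvg_ex; exists d | exact/cvg_lim].
  by move=> [h <-].
rewrite (@cvg_normcP _ _ 0^' _ q d).
have qE x : x != 0 -> g (x + z) - g z - d * x = x * (q x - d).
  move=> x0; rewrite /q /= /shift /= [x *: 1]mulr1 mulrBr [x * d]mulrC; congr (_ - _).
  by rewrite [X in x * X]/GRing.scale /= mulVKf.
split=> h e e0.
  have [k k0 hk] := h e e0.
  apply/dnbhs_normcP; exists k => // x x0; rewrite subr0 => xk.
  have Nx : 0 < N x by rewrite normc_gt0.
  have := hk (x + z); rewrite addrK => /(_ xk).
  rewrite qE//.
  by rewrite normcM mulrC ler_pM2r.
have /dnbhs_normcP[k k0 hk] := h e e0.
exists k => // w wk; have [->|wz] := eqVneq w z.
  by rewrite !subrr mulr0 subrr normc0 mulr0.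
have x0 : w - z != 0 by rewrite subr_eq0.
have Nx : 0 < N (w - z) by rewrite normc_gt0.
have := hk (w - z) x0; rewrite subr0 => /(_ wk).
by rewrite -(ler_pM2r Nx) mulrC -normcM -qE// subrK.
Qed.

Lemma hasd_derive1 g z d : hasd g z d -> derive1 g z = d.
Proof. by move=> /hasdP[]. Qed.

Lemma hasd_derivable g z d : hasd g z d -> derivable g z 1.
Proof. by move=> /hasdP[]. Qed.

Lemma derivable_hasd g z : derivable g z 1 -> hasd g z (derive1 g z).
Proof. by move=> h; apply/hasdP. Qed.

Lemma hasd_unique g z d d' : hasd g z d -> hasd g z d' -> d = d'.
Proof. by move=> /hasd_derive1 <- /hasd_derive1 <-. Qed.

Lemma ctsP g z : {for z, continuous g} <-> cts g z.
Proof.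
have H := @cvg_normcP _ _ (nbhs z) _ g (g z).
split=> [/H h e e0|h]; last first.
  by apply/H => e e0; apply/nbhs_normcP; exact: h.
by have /nbhs_normcP := h _ e0.
Qed.

Lemma hasd_cts g z d : hasd g z d -> cts g z.
Proof.
move=> h e e0; have [k k0 hk] := h 1 ltr01.
have D0 : 0 < N d + 1 by rewrite ltr_wpDl ?normc_ge0.
exists (Num.min k (e / (N d + 1))); first by rewrite lt_min k0 divr_gt0.
move=> w; rewrite lt_min ltr_pdivlMr// => /andP[wk we].
have := hk w wk; have := normcD (g w - g z - d * (w - z)) (d * (w - z)).
rewrite subrK normcM; lra.
Qed.

Lemma hasd_ext f g z d (r : R) : 0 < r ->
  (forall w, N (w - z) < r -> f w = g w) -> hasd f z d -> hasd g z d.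
Proof.
move=> r0 fg h e e0; have [k k0 hk] := h e e0.
exists (Num.min k r) => [|w]; first by rewrite lt_min k0 r0.
rewrite lt_min => /andP[wk wr]; rewrite -!fg//; first exact: hk.
by rewrite subrr normc0.
Qed.

Lemma cts_ext f g z (r : R) : 0 < r ->
  (forall w, N (w - z) < r -> f w = g w) -> cts f z -> cts g z.
Proof.
move=> r0 fg h e e0; have [k k0 hk] := h e e0.
exists (Num.min k r) => [|w]; first by rewrite lt_min k0 r0.
rewrite lt_min => /andP[wk wr]; rewrite -!fg//; first exact: hk.
by rewrite subrr normc0.
Qed.

Lemma hasd_eq f z d d' : hasd f z d -> d = d' -> hasd f z d'.
Proof. by move=> ? <-. Qed.

Lemma hasd_cst c z : hasd (fun=> c) z 0.
Proof.
move=> e e0; exists 1 => // w _; rewrite subrr mul0r subrr normc0.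
by rewrite mulr_ge0 ?normc_ge0 ?ltW.
Qed.

Lemma hasd_id z : hasd (fun w => w) z 1.
Proof.
move=> e e0; exists 1 => // w _; rewrite mul1r subrr normc0.
by rewrite mulr_ge0 ?normc_ge0 ?ltW.
Qed.

Lemma hasdD f g z a b : hasd f z a -> hasd g z b ->
  hasd (fun w => f w + g w) z (a + b).
Proof.
move=> hf hg e e0.
have e2 : 0 < e / 2 by rewrite divr_gt0.
have [k1 k10 h1] := hf _ e2; have [k2 k20 h2] := hg _ e2.
exists (Num.min k1 k2) => [|w]; first by rewrite lt_min k10 k20.
rewrite lt_min => /andP[/h1 {}h1 /h2 {}h2].
have -> : f w + g w - (f z + g z) - (a + b) * (w - z) =
  (f w - f z - a * (w - z)) + (g w - g z - b * (w - z)) by ring.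
by apply: (le_trans (normcD _ _)); rewrite [e]splitr mulrDl lerD.
Qed.

Lemma hasdM f g z a b : hasd f z a -> hasd g z b ->
  hasd (fun w => f w * g w) z (a * g z + f z * b).
Proof.
move=> hf hg e e0.
have cg := hasd_cts hg.
(* Both remainders are at most [e' * N (w - z)], and the increment of [g] is at most [e'] and at
   most 1; the three error terms then sum to [e' * (M - 2) * N (w - z)]. *)
pose M := N (f z) + N (g z) + N a + 3.
have [Nf Ng Na] : [/\ 0 <= N (f z), 0 <= N (g z) & 0 <= N a].
  by rewrite !normc_ge0.
have M0 : 0 < M by rewrite /M; lra.
pose e' := e / (2 * M).
have e'0 : 0 < e' by rewrite divr_gt0 ?mulr_gt0.
have e'M : e' * M = e / 2 by rewrite /e'; field; lra.
have [k1 k10 h1] := hf _ e'0; have [k2 k20 h2] := hg _ e'0.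
have [k3 k30 h3] := cg _ e'0; have [k4 k40 h4] := cg _ ltr01.
exists (Num.min (Num.min k1 k2) (Num.min k3 k4)) => [|w].
  by rewrite !lt_min k10 k20 k30 k40.
rewrite !lt_min => /andP[/andP[/h1 {}h1 /h2 {}h2] /andP[/h3 {}h3 /h4 {}h4]].
have -> : f w * g w - f z * g z - (a * g z + f z * b) * (w - z) =
  (f w - f z - a * (w - z)) * (g z + (g w - g z))
  + f z * (g w - g z - b * (w - z)) + a * (w - z) * (g w - g z) by ring.
have gz : N (g z + (g w - g z)) <= N (g z) + 1.
  by apply: (le_trans (normcD _ _)); rewrite lerD2l.
apply: (le_trans (normcD _ _)); rewrite !normcM.
apply: (le_trans (lerD (normcD _ _) (lexx _))); rewrite !normcM.
have Nw := normc_ge0 (w - z).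
apply: (@le_trans _ _ (e' * N (w - z) * (N (g z) + 1)
   + N (f z) * (e' * N (w - z)) + N a * N (w - z) * e')).
  apply: lerD; first apply: lerD.
  - by rewrite ler_pM ?normc_ge0.
  - by rewrite ler_wpM2l.
  - by rewrite ler_wpM2l // mulr_ge0.
have -> : e' * N (w - z) * (N (g z) + 1)
   + N (f z) * (e' * N (w - z)) + N a * N (w - z) * e' =
   (e' * (M - 2)) * N (w - z) by rewrite /M; ring.
rewrite ler_wpM2r//; lra.
Qed.

Lemma hasdN f z a : hasd f z a -> hasd (fun w => - f w) z (- a).
Proof.
move=> /(hasdM (hasd_cst (-1) z)) h.
by apply: (@hasd_eq _ _ (0 * f z + -1 * a)); [apply: hasd_ext h => [|w _]; [exact: ltr01|ring]|ring].
Qed.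

Lemma hasdB f g z a b : hasd f z a -> hasd g z b ->
  hasd (fun w => f w - g w) z (a - b).
Proof. by move=> hf hg; apply: hasdD => //; exact: hasdN. Qed.

Lemma hasdMl c f z a : hasd f z a -> hasd (fun w => c * f w) z (c * a).
Proof.
move=> h; apply: hasd_eq (hasdM (hasd_cst c z) h) _.
by rewrite mul0r add0r.
Qed.

Lemma hasdMr c f z a : hasd f z a -> hasd (fun w => f w * c) z (a * c).
Proof.
move=> h; apply: hasd_eq (hasdM h (hasd_cst c z)) _.
by rewrite mulr0 addr0.
Qed.

Lemma hasd_comp f g z a b : hasd f z a -> hasd g (f z) b ->
  hasd (fun w => g (f w)) z (b * a).
Proof.
move=> hf hg e e0.
have cf := hasd_cts hf.
have [Na Nb] : 0 <= N a /\ 0 <= N b by rewrite !normc_ge0.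
have A0 : 0 < 2 * (N a + 1) by lra.
have B0 : 0 < 2 * (N b + 1) by lra.
pose e1 := e / (2 * (N a + 1)); pose e2 := e / (2 * (N b + 1)).
have e10 : 0 < e1 by rewrite divr_gt0.
have e20 : 0 < e2 by rewrite divr_gt0.
have [k1 k10 h1] := hg _ e10; have [k2 k20 h2] := hf _ e20.
have [k3 k30 h3] := hf _ ltr01.
have k12 : 0 < k1 / 2 by rewrite divr_gt0.
have [k4 k40 h4] := cf _ k12.
exists (Num.min (Num.min k2 k3) k4) => [|w].
  by rewrite !lt_min k20 k30 k40.
rewrite !lt_min => /andP[/andP[/h2 {}h2 /h3 {}h3] /h4 {}h4].
have /h1 {}h1 : N (f w - f z) < k1 by lra.
have Nw := normc_ge0 (w - z).
have fb : N (f w - f z) <= (N a + 1) * N (w - z).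
  have := normcD (f w - f z - a * (w - z)) (a * (w - z)).
  rewrite subrK normcM; lra.
have -> : g (f w) - g (f z) - b * a * (w - z) =
  (g (f w) - g (f z) - b * (f w - f z)) + b * (f w - f z - a * (w - z)) by ring.
apply: (le_trans (normcD _ _)); rewrite normcM.
have E1 : e1 * (N a + 1) = e / 2 by rewrite /e1; field; lra.
have E2 : e2 * (N b + 1) = e / 2 by rewrite /e2; field; lra.
have : e1 * N (f w - f z) <= e / 2 * N (w - z).
  by rewrite -E1 -mulrA ler_wpM2l// ltW.
have : N b * N (f w - f z - a * (w - z)) <= e / 2 * N (w - z).
  rewrite -E2 -mulrA mulrC.
  apply: (@le_trans _ _ (e2 * N (w - z) * N b)); first by rewrite ler_wpM2r.
  rewrite -mulrA ler_wpM2l//; first exact: ltW.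
  by rewrite mulrC ler_wpM2r// lerDl.
lra.
Qed.

Lemma hasd_inv z : z != 0 -> hasd (fun w => w^-1) z (- (z ^+ 2)^-1).
Proof.
move=> z0 e e0; have Nz : 0 < N z by rewrite normc_gt0.
(* The remainder equals (w - z)^2 / (w z^2). The first radius gives |w| >= |z|/2, and the second
   makes the remaining factor |w - z| small against |z|^3/2. *)
exists (Num.min (N z / 2) (e * N z ^+ 3 / 2)) => [|w].
  by rewrite lt_min !divr_gt0// mulr_gt0// exprn_gt0.
rewrite lt_min => /andP[h1 h2].
have Nw : N z / 2 <= N w.
  have := normcD (w - z) (- w).
  by rewrite addrAC subrr add0r !normc_opp; lra.
have Nw0 : 0 < N w by lra.
have w0 : w != 0 by rewrite -normc_gt0.
have -> : w^-1 - z^-1 - - (z ^+ 2)^-1 * (w - z) = (w - z) ^+ 2 / (w * z ^+ 2).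
  by field; rewrite w0 z0.
have -> : N ((w - z) ^+ 2 / (w * z ^+ 2)) = N (w - z) / (N w * N z ^+ 2) * N (w - z).
  by rewrite normcM normcV normcX [N (w * _)]normcM normcX; ring.
rewrite ler_wpM2r ?normc_ge0//.
rewrite ler_pdivrMr; last by rewrite mulr_gt0// exprn_gt0.
apply: (@le_trans _ _ (e * N z ^+ 3 / 2)); first exact: ltW.
have -> : e * N z ^+ 3 / 2 = e * (N z / 2 * N z ^+ 2) by field.
apply: ler_wpM2l; first exact: ltW.
by rewrite ler_wpM2r// exprn_ge0// ltW.
Qed.

Lemma hasdV f z a : f z != 0 -> hasd f z a ->
  hasd (fun w => (f w)^-1) z (- a / f z ^+ 2).
Proof.
move=> f0 hf; apply: hasd_eq (hasd_comp hf (hasd_inv f0)) _.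
by ring.
Qed.

Lemma hasd_div f g z a b : g z != 0 -> hasd f z a -> hasd g z b ->
  hasd (fun w => f w / g w) z ((a * g z - f z * b) / g z ^+ 2).
Proof.
move=> g0 hf hg; apply: hasd_eq (hasdM hf (hasdV g0 hg)) _.
by field.
Qed.

Lemma hasdX f z a n : hasd f z a ->
  hasd (fun w => f w ^+ n.+1) z (n.+1%:R * f z ^+ n * a).
Proof.
move=> hf; elim: n => [|n IH].
  by rewrite expr0 !mul1r; apply: hasd_ext hf => [|w _]; [exact: ltr01|rewrite expr1].
apply: (@hasd_ext (fun w => f w * f w ^+ n.+1) _ _ _ 1) => //.
apply: hasd_eq (hasdM hf IH) _.
by rewrite exprS -[n.+2%:R]natr1; ring.
Qed.

Lemma cts_neq0 g z : cts g z -> g z != 0 ->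
  exists2 k : R, 0 < k & forall w, N (w - z) < k -> g w != 0.
Proof.
move=> h g0; have Ng : 0 < N (g z) / 2 by rewrite divr_gt0 ?normc_gt0.
have [k k0 hk] := h _ Ng; exists k => // w /hk.
have := normcD (g w - g z) (- g w); rewrite addrAC subrr add0r !normc_opp.
by rewrite -(normc_gt0 (g w)); lra.
Qed.

Lemma cts_cst c z : cts (fun=> c) z.
Proof. exact: hasd_cts (hasd_cst c z). Qed.

Lemma ctsD f g z : cts f z -> cts g z -> cts (fun w => f w + g w) z.
Proof.
by move=> /ctsP hf /ctsP hg; apply/ctsP; exact: (@continuousD _ _ _ f g z hf hg).
Qed.

Lemma ctsM f g z : cts f z -> cts g z -> cts (fun w => f w * g w) z.
Proof.
by move=> /ctsP hf /ctsP hg; apply/ctsP; exact: (@continuousM _ _ f g z hf hg).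
Qed.

Lemma cts_comp f g z : cts f z -> cts g (f z) -> cts (fun w => g (f w)) z.
Proof.
move=> hf hg e e0; have [k k0 hk] := hg e e0.
have k20 : 0 < k / 2 by rewrite divr_gt0.
have [k' k'0 hk'] := hf _ k20; exists k' => // w /hk' h.
by apply: hk; lra.
Qed.

End ComplexDerivative.

(** * Curves in the complex plane: mean value inequalities and real primitives *)

Section Curves.
Variable R : realType.
Local Notation C := (R[i]).
Local Notation N := (@normc R).
Local Notation Re := (@complex.Re R).
Local Notation Im := (@complex.Im R).
Implicit Types (phi psi : R -> C) (g : C -> C).

Definition cderiv phi (x : R) (d : C) := forall e : R, 0 < e ->
  exists2 k : R, 0 < k & forall y : R, `|y - x| < k ->
    N (phi y - phi x - (y - x)%:C * d) <= e * `|y - x|.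

Definition ccts phi (x : R) := forall e : R, 0 < e ->
  exists2 k : R, 0 < k & forall y : R, `|y - x| < k -> N (phi y - phi x) <= e.

Lemma is_derive_epsP (f : R -> R) (x d : R) : is_derive x 1 f d <->
  forall e : R, 0 < e -> exists2 k : R, 0 < k & forall y : R, `|y - x| < k ->
    `|f y - f x - (y - x) * d| <= e * `|y - x|.
Proof.
pose q := (fun h : R => h^-1 *: ((f \o shift x) (h *: 1) - f x)).
have qE h : h != 0 -> f (h + x) - f x - h * d = h * (q h - d).
  move=> h0; rewrite /q /= /shift /= [h *: 1]mulr1 mulrBr; congr (_ - _).
  by rewrite [X in h * X]/GRing.scale /= mulVKf.
have dP : is_derive x 1 f d <-> q h @[h --> 0^'] --> d.
  split; first by move=> [h <-].
  by move=> h; apply: DeriveDef; [apply/cvg_ex; exists d | exact/cvg_lim].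
rewrite dP cvgrPdist_le; split => h e e0.
  have := h e e0; rewrite near_withinE => /realnbhsP[k k0 hk].
  exists k => // y yk; have [->|yx] := eqVneq y x.
    by rewrite !subrr mul0r subrr normr0 mulr0.
  have x0 : y - x != 0 by rewrite subr_eq0.
  have := hk (y - x); rewrite subr0 => /(_ yk x0).
  have := qE (y - x) x0; rewrite subrK => ->.
  by rewrite normrM [`|q _ - d|]distrC mulrC ler_pM2r ?normr_gt0.
have [k k0 hk] := h e e0.
rewrite near_withinE; apply/realnbhsP; exists k => // y; rewrite subr0 => yk y0.
have := hk (y + x); rewrite addrK => /(_ yk).
by rewrite qE// normrM [`|q _ - d|]distrC mulrC ler_pM2r ?normr_gt0.
Qed.

Lemma real_ctsP (f : R -> R) (x : R) : {for x, continuous f} <->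
  forall e : R, 0 < e -> exists2 k : R, 0 < k & forall y : R, `|y - x| < k ->
    `|f y - f x| <= e.
Proof.
rewrite /prop_for /continuous_at cvgrPdist_le; split=> h e e0.
  have /realnbhsP[k k0 hk] := h e e0.
  by exists k => // y /hk; rewrite distrC.
have [k k0 hk] := h e e0; apply/realnbhsP; exists k => // y /hk.
by rewrite distrC.
Qed.

Lemma cderiv_ccts phi x d : cderiv phi x d -> ccts phi x.
Proof.
move=> h e e0; have [k k0 hk] := h 1 ltr01.
have D0 : 0 < N d + 1 by rewrite ltr_wpDl ?normc_ge0.
exists (Num.min k (e / (N d + 1))); first by rewrite lt_min k0 divr_gt0.
move=> y; rewrite lt_min ltr_pdivlMr// => /andP[wk we].
have := hk y wk; have := normcD (phi y - phi x - (y - x)%:C * d) ((y - x)%:C * d).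
rewrite subrK normcM normc_real; lra.
Qed.

Lemma Re_mul_real (a : R) (z : C) : Re (a%:C * z) = a * Re z.
Proof. by case: z => u v /=; rewrite mul0r subr0. Qed.

Lemma Im_mul_real (a : R) (z : C) : Im (a%:C * z) = a * Im z.
Proof. by case: z => u v /=; rewrite mul0r addr0. Qed.

(** The constant [c] covers every real linear functional at once: 1 for the real part, [- 'i] for
    the imaginary part, and the conjugate of an increment in the mean value inequality. *)
Lemma cderiv_Re (c : C) phi x d : cderiv phi x d ->
  is_derive x 1 (fun y => Re (c * phi y)) (Re (c * d)).
Proof.
move=> h; apply/is_derive_epsP => e e0.
have M0 : 0 < N c + 1 by rewrite ltr_wpDl ?normc_ge0.
have e'0 : 0 < e / (N c + 1) by rewrite divr_gt0.
have [k k0 hk] := h _ e'0; exists k => // y /hk {}hk.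
have -> : Re (c * phi y) - Re (c * phi x) - (y - x) * Re (c * d) =
  Re (c * (phi y - phi x - (y - x)%:C * d)).
  rewrite -Re_mul_real -!raddfB /=; congr complex.Re; ring.
apply: (le_trans (normc_Re _)); rewrite normcM.
apply: (@le_trans _ _ (N c * (e / (N c + 1) * `|y - x|))).
  by rewrite ler_wpM2l// normc_ge0.
have -> : N c * (e / (N c + 1) * `|y - x|) = N c / (N c + 1) * (e * `|y - x|).
  by field; lra.
rewrite ler_piMl ?mulr_ge0 ?(ltW e0)//.
by rewrite ler_pdivrMr// mul1r lerDl.
Qed.

Lemma ccts_Re (c : C) phi x : ccts phi x ->
  {for x, continuous (fun y => Re (c * phi y))}.
Proof.
move=> h; apply/real_ctsP => e e0.
have M0 : 0 < N c + 1 by rewrite ltr_wpDl ?normc_ge0.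
have e'0 : 0 < e / (N c + 1) by rewrite divr_gt0.
have [k k0 hk] := h _ e'0; exists k => // y /hk {}hk.
rewrite -raddfB /= -mulrBr.
apply: (le_trans (normc_Re _)); rewrite normcM.
apply: (@le_trans _ _ (N c * (e / (N c + 1)))).
  by rewrite ler_wpM2l// normc_ge0.
have -> : N c * (e / (N c + 1)) = N c / (N c + 1) * e by field; lra.
rewrite ler_piMl ?(ltW e0)//.
by rewrite ler_pdivrMr// mul1r lerDl.
Qed.

Lemma curve_MVT_Re phi (d : R -> C) (a b : R) (c : C) : a < b ->
  (forall x, a < x < b -> cderiv phi x (d x)) ->
  (forall x, a <= x <= b -> ccts phi x) ->
  exists2 t, a < t < b & Re (c * (phi b - phi a)) = Re (c * d t) * (b - a).
Proof.
move=> ab hd hc.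
have [||t] := @MVT R (fun y => Re (c * phi y)) (fun y => Re (c * d y)) a b ab.
- by move=> x; rewrite in_itv /= => xab; apply: cderiv_Re; exact: hd.
- apply: continuous_in_subspaceT => x; rewrite inE /= in_itv /= => xab.
  by apply: ccts_Re; exact: hc.
rewrite in_itv /= => tab E; exists t => //.
by rewrite -E -raddfB /= -mulrBr.
Qed.

(* Testing against the conjugate of the increment reduces to the real mean value theorem. *)
Lemma curve_MVT phi (d : R -> C) (a b M : R) : a <= b ->
  (forall x, a < x < b -> cderiv phi x (d x)) ->
  (forall x, a <= x <= b -> ccts phi x) ->
  (forall x, a < x < b -> N (d x) <= M) ->
  N (phi b - phi a) <= M * (b - a).
Proof.
rewrite le_eqVlt => /orP[/eqP -> _ _ _|ab hd hc hM].
  by rewrite !subrr normc0 mulr0.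
have [t tab] := curve_MVT_Re ((phi b - phi a)^*) ab hd hc.
set D := phi b - phi a.
have -> : Re (D^* * D) = N D ^+ 2.
  by case: D => u v /=; rewrite sqr_sqrtr ?addr_ge0 ?sqr_ge0//; ring.
have [->|D0] := eqVneq D 0.
  move=> _; rewrite normc0 mulr_ge0 ?subr_ge0 ?(ltW ab)//.
  by apply: le_trans (hM _ tab); exact: normc_ge0.
move=> E; have ND : 0 < N D by rewrite normc_gt0.
rewrite -(ler_pM2l ND) -expr2 E mulrA ler_wpM2r ?subr_ge0 ?(ltW ab)//.
apply: (le_trans (ler_norm _)); apply: (le_trans (normc_Re _)).
rewrite normcM; have -> : N D^* = N D by case: D {ND D0 E} => u v /=; rewrite sqrrN.
by rewrite ler_wpM2l ?normc_ge0// hM.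
Qed.

Lemma hasd_cderiv g (p q : C) (x : R) d : hasd g (p + x%:C * q) d ->
  cderiv (fun t => g (p + t%:C * q)) x (d * q).
Proof.
move=> h e e0.
have M0 : 0 < N q + 1 by rewrite ltr_wpDl ?normc_ge0.
have e'0 : 0 < e / (N q + 1) by rewrite divr_gt0.
have [k k0 hk] := h _ e'0; exists (k / (N q + 1)); first by rewrite divr_gt0.
move=> y yk.
have E : p + y%:C * q - (p + x%:C * q) = (y - x)%:C * q by rewrite rmorphB; ring.
have := hk (p + y%:C * q); rewrite E normcM normc_real.
have -> : (y - x)%:C * (d * q) = d * ((y - x)%:C * q) by ring.
have lt : `|y - x| * N q <= `|y - x| * (N q + 1) by rewrite ler_wpM2l// lerDl.
move=> /(_ (le_lt_trans lt _)).
rewrite -ltr_pdivlMr// => /(_ yk) H; apply: (le_trans H).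
apply: (@le_trans _ _ (e / (N q + 1) * (`|y - x| * (N q + 1)))).
  by rewrite ler_wpM2l// (ltW e'0).
by rewrite [_ * (N q + 1)]mulrC mulrA divfK// gt_eqF.
Qed.

Lemma cts_ccts g (p q : C) (x : R) : cts g (p + x%:C * q) ->
  ccts (fun t => g (p + t%:C * q)) x.
Proof.
move=> h e e0.
have M0 : 0 < N q + 1 by rewrite ltr_wpDl ?normc_ge0.
have [k k0 hk] := h _ e0; exists (k / (N q + 1)); first by rewrite divr_gt0.
move=> y yk; apply: hk.
have -> : p + y%:C * q - (p + x%:C * q) = (y - x)%:C * q by rewrite rmorphB; ring.
rewrite normcM normc_real.
apply: (@le_lt_trans _ _ (`|y - x| * (N q + 1))); first by rewrite ler_wpM2l// lerDl.
by rewrite -ltr_pdivlMr.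
Qed.

(** The segment from 0 to [u] meets 0 only at its end, where the mean value theorem asks for
    continuity alone. This suits functions whose derivative is known only on a punctured disc. *)
Lemma ray_MVT g (dg : C -> C) (u : C) (M : R) : cts g 0 ->
  (forall z, z != 0 -> N z <= N u -> hasd g z (dg z)) ->
  (forall z, z != 0 -> N z <= N u -> N (dg z) <= M) ->
  N (g u - g 0) <= M * N u.
Proof.
move=> c0 hd hM; have [->|u0] := eqVneq u 0.
  by rewrite subrr normc0 mulr0.
have tu (t : R) : 0 < t <= 1 -> t%:C * u != 0 /\ N (t%:C * u) <= N u.
  move=> /andP[t0 t1]; split.
    by rewrite mulf_eq0 negb_or u0 andbT -normc_gt0 normc_real normr_gt0 gt_eqF.
  by rewrite normcM normc_real ger0_norm ?(ltW t0)// ler_piMl ?normc_ge0.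
have := @curve_MVT (fun t => g (0 + t%:C * u)) (fun t => dg (0 + t%:C * u) * u)
   0 1 (M * N u) ler01.
rewrite subr0 mulr1 rmorph0 rmorph1 mul0r mul1r !add0r; apply.
- move=> x /andP[x0 x1]; apply: hasd_cderiv; rewrite add0r.
  by have [|? ?] := tu x; rewrite ?x0 ?(ltW x1)//; exact: hd.
- move=> x /andP[x0 x1]; apply: cts_ccts; rewrite add0r.
  move: x0; rewrite le_eqVlt => /orP[/eqP <-|x0]; first by rewrite rmorph0 mul0r.
  by have [|? ?] := tu x; rewrite ?x0 ?x1//; apply: hasd_cts; exact: hd.
- move=> x /andP[x0 x1]; rewrite add0r normcM ler_wpM2r ?normc_ge0//.
  by have [|? ?] := tu x; rewrite ?x0 ?(ltW x1)//; exact: hM.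
Qed.

(** The integral from [- n] is a primitive only to the right of [- n]. Normalised to vanish at 0,
    two such integrals agree wherever both are primitives, so they glue to a primitive on the whole
    line. *)
Lemma real_primitive (f : R -> R) : (forall x : R, {for x, continuous f}) ->
  exists F : R -> R, forall x : R, is_derive x 1 F (f x).
Proof.
move=> cf.
pose G (n : nat) (x : R) : R :=
  (\int[lebesgue_measure]_(t in [set` `[- n%:R : R, x]]) (f t))%R.
have dG n (x : R) : - n%:R < x -> is_derive x 1 (G n) (f x).
  move=> nx; have [||h1 h2] := @continuous_FTC1_closed R f (- n%:R) x (x + 1) _ _ nx (cf x).
  - by rewrite ltrDl.
  - apply: continuous_compact_integrable; first exact: segment_compact.
    by apply: continuous_in_subspaceT => y _; exact: cf.
  - by apply: DeriveDef; [exact: h1 | rewrite -derive1E].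
pose H n (x : R) := G n x - G n 0.
have dH n (x : R) : - n%:R < x -> is_derive x 1 (H n) (f x).
  move=> /dG h; apply: is_derive_eq (is_deriveB h (is_derive_cst _ _ _)) _.
  by rewrite subr0.
have HE n m (x : R) : - n.+1%:R < x -> - m.+1%:R < x -> H n.+1 x = H m.+1 x.
  move=> nx mx.
  have E (y : R) : - n.+1%:R < y -> - m.+1%:R < y -> is_derive y 1 (fun t => H n.+1 t - H m.+1 t) 0.
    move=> ny my; apply: is_derive_eq (is_deriveB (dH _ _ ny) (dH _ _ my)) _.
    by rewrite subrr.
  have n0 k : - k.+1%:R < 0 :> R by rewrite oppr_lt0.
  have K (a b : R) : a <= b -> - n.+1%:R < a -> - m.+1%:R < a ->
      H n.+1 b - H m.+1 b = H n.+1 a - H m.+1 a.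
    move=> ab na ma; have [||c _] := @MVT_segment R (fun t => H n.+1 t - H m.+1 t) (fun=> 0) a b ab.
    - move=> y; rewrite in_itv /= => /andP[ay yb].
      by apply: E; [exact: lt_trans ay | exact: lt_trans ay].
    - apply: continuous_in_subspaceT => y; rewrite inE /= in_itv /= => /andP[ay yb].
      apply: differentiable_continuous; apply/derivable1_diffP.
      apply: (@ex_derive _ _ _ _ _ _ 0); apply: E;
      by [exact: lt_le_trans ay | exact: lt_le_trans ay].
    by rewrite mul0r => /eqP; rewrite subr_eq0 => /eqP.
  have H0 k : H k 0 = 0 by rewrite /H subrr.
  apply/eqP; rewrite -subr_eq0; apply/eqP.
  have [x0|x0] := leP x 0.
    by rewrite -(K x 0)// !H0 subrr.
  by rewrite (K 0 x) ?(ltW x0)// !H0 subrr.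
pose F (x : R) := H (Num.bound `|x|).+1 x.
have bnd (x : R) : - (Num.bound `|x|).+1%:R < x.
  rewrite ltrNl; apply: le_lt_trans (ler_norm _) _; rewrite normrN.
  by apply: lt_trans (archi_boundP (normr_ge0 _)) _ => //; rewrite ltr_nat.
exists F => x.
(* The index taken at [x - 1] serves every point within distance 1 of [x], so near [x] the glued
   function agrees with a single [H n]. *)
have nx : - (Num.bound `|x - 1|).+1%:R < x by apply: lt_trans (bnd (x - 1)) _; lra.
apply: near_eq_is_derive (dH _ _ nx).
apply/realnbhsP; exists 1; first exact: ltr01.
move=> y; rewrite ltr_distlC => /andP[h1 h2].
apply: HE; last exact: bnd.
by apply: lt_trans (bnd (x - 1)) _; lra.
Qed.

End Curves.

(** * Integrals along curves and around rectangles *)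

Section CurveIntegral.
Variable R : realType.
Local Notation C := (R[i]).
Local Notation N := (@normc R).
Local Notation Re := (@complex.Re R).
Local Notation Im := (@complex.Im R).
Implicit Types (phi psi Phi : R -> C) (g : C -> C).

Lemma ReE (z : C) : Re z = Re (1 * z). Proof. by rewrite mul1r. Qed.

Lemma ImE (z : C) : Im z = Re (- 'i * z).
Proof. by case: z => u v /=; rewrite oppr0 mul0r mulN1r sub0r opprK. Qed.

Lemma curve_primitive phi : (forall x, ccts phi x) ->
  exists Phi, forall x, cderiv Phi x (phi x).
Proof.
move=> h.
have [F1 h1] := real_primitive (fun x => @ccts_Re _ 1 _ _ (h x)).
have [F2 h2] := real_primitive (fun x => @ccts_Re _ (- 'i) _ _ (h x)).
exists (fun x => F1 x +i* F2 x) => x e e0.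
have e2 : 0 < e / 2 by rewrite divr_gt0.
have /is_derive_epsP/(_ _ e2)[k1 k10 hk1] := h1 x.
have /is_derive_epsP/(_ _ e2)[k2 k20 hk2] := h2 x.
exists (Num.min k1 k2) => [|y]; first by rewrite lt_min k10 k20.
rewrite lt_min => /andP[/hk1 {}hk1 /hk2 {}hk2].
apply: (le_trans (normc_ReIm _)); rewrite [e]splitr mulrDl lerD//.
  apply: le_trans hk1; rewrite -ReE raddfB/= Re_mul_real; exact: lexx.
apply: le_trans hk2; rewrite -ImE raddfB/= Im_mul_real; exact: lexx.
Qed.

Lemma cderivD phi psi x a b : cderiv phi x a -> cderiv psi x b ->
  cderiv (fun t => phi t + psi t) x (a + b).
Proof.
move=> hf hg e e0.
have e2 : 0 < e / 2 by rewrite divr_gt0.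
have [k1 k10 h1] := hf _ e2; have [k2 k20 h2] := hg _ e2.
exists (Num.min k1 k2) => [|w]; first by rewrite lt_min k10 k20.
rewrite lt_min => /andP[/h1 {}h1 /h2 {}h2].
have -> : phi w + psi w - (phi x + psi x) - (w - x)%:C * (a + b) =
  (phi w - phi x - (w - x)%:C * a) + (psi w - psi x - (w - x)%:C * b) by ring.
by apply: (le_trans (normcD _ _)); rewrite [e]splitr mulrDl lerD.
Qed.

Lemma cderivZ c phi x a : cderiv phi x a -> cderiv (fun t => c * phi t) x (c * a).
Proof.
move=> h e e0.
have M0 : 0 < N c + 1 by rewrite ltr_wpDl ?normc_ge0.
have e'0 : 0 < e / (N c + 1) by rewrite divr_gt0.
have [k k0 hk] := h _ e'0; exists k => // y /hk {}hk.
have -> : c * phi y - c * phi x - (y - x)%:C * (c * a) =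
  c * (phi y - phi x - (y - x)%:C * a) by ring.
rewrite normcM.
apply: (@le_trans _ _ (N c * (e / (N c + 1) * `|y - x|))).
  by rewrite ler_wpM2l// normc_ge0.
have -> : N c * (e / (N c + 1) * `|y - x|) = N c / (N c + 1) * (e * `|y - x|).
  by field; lra.
rewrite ler_piMl ?mulr_ge0 ?(ltW e0)//.
by rewrite ler_pdivrMr// mul1r lerDl.
Qed.

Lemma cctsD phi psi x : ccts phi x -> ccts psi x -> ccts (fun t => phi t + psi t) x.
Proof.
move=> hf hg e e0.
have e2 : 0 < e / 2 by rewrite divr_gt0.
have [k1 k10 h1] := hf _ e2; have [k2 k20 h2] := hg _ e2.
exists (Num.min k1 k2) => [|w]; first by rewrite lt_min k10 k20.
rewrite lt_min => /andP[/h1 {}h1 /h2 {}h2].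
have -> : phi w + psi w - (phi x + psi x) = (phi w - phi x) + (psi w - psi x) by ring.
by apply: (le_trans (normcD _ _)); rewrite [e]splitr lerD.
Qed.

Lemma cctsZ c phi x : ccts phi x -> ccts (fun t => c * phi t) x.
Proof.
move=> h e e0.
have M0 : 0 < N c + 1 by rewrite ltr_wpDl ?normc_ge0.
have e'0 : 0 < e / (N c + 1) by rewrite divr_gt0.
have [k k0 hk] := h _ e'0; exists k => // y /hk {}hk.
rewrite -mulrBr normcM.
apply: (@le_trans _ _ (N c * (e / (N c + 1)))).
  by rewrite ler_wpM2l// normc_ge0.
have -> : N c * (e / (N c + 1)) = N c / (N c + 1) * e by field; lra.
rewrite ler_piMl ?(ltW e0)//.
by rewrite ler_pdivrMr// mul1r lerDl.
Qed.

(** A chosen primitive on the whole line; the zero function is the default when none exists, so the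
    rules for the integral assume continuity everywhere or an explicit primitive. *)
Definition prim phi : R -> C := xget (fun=> 0) [set Phi | forall x, cderiv Phi x (phi x)].

(* The integral of a continuous curve is defined through a primitive, so no order between
   the bounds is required and additivity is immediate. *)
Definition cint (a b : R) phi : C := prim phi b - prim phi a.

Lemma primP phi : (forall x, ccts phi x) -> forall x, cderiv (prim phi) x (phi x).
Proof. by move=> /curve_primitive h; exact: (xgetPex (fun=> 0) h). Qed.

Lemma primitive_unique Phi Psi phi (a b : R) : (forall x, cderiv Phi x (phi x)) ->
  (forall x, cderiv Psi x (phi x)) -> Phi b - Phi a = Psi b - Psi a.
Proof.
move=> h1 h2; wlog ab : a b / a <= b => [hw|].
  have [/hw//|/ltW/hw E] := leP a b.
  by rewrite -opprB E opprB.
have h x : cderiv (fun t => Phi t + -1 * Psi t) x 0.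
  have := cderivD (h1 x) (cderivZ (-1) (h2 x)).
  by rewrite mulN1r subrr.
have := @curve_MVT _ _ (fun=> 0) a b 0 ab (fun x _ => h x) (fun x _ => cderiv_ccts (h x)).
rewrite normc0 mul0r => /(_ (fun x _ => lexx _)) H.
have /eq0_normc E : N (Phi b + -1 * Psi b - (Phi a + -1 * Psi a)) = 0.
  by apply/eqP; rewrite eq_le H normc_ge0.
apply/eqP; rewrite -subr_eq0 -E; apply/eqP; ring.
Qed.

Lemma cint_FTC Phi phi a b : (forall x, cderiv Phi x (phi x)) ->
  cint a b phi = Phi b - Phi a.
Proof.
move=> h; have ex : exists Psi, forall x, cderiv Psi x (phi x) by exists Phi.
by apply: primitive_unique h; exact: (xgetPex (fun=> 0) ex).
Qed.

Lemma cint_cat b a c phi : cint a b phi + cint b c phi = cint a c phi.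
Proof. by rewrite /cint; ring. Qed.

Lemma cintD phi psi a b : (forall x, ccts phi x) -> (forall x, ccts psi x) ->
  cint a b (fun t => phi t + psi t) = cint a b phi + cint a b psi.
Proof.
move=> h1 h2; rewrite (@cint_FTC (fun t => prim phi t + prim psi t)).
  by rewrite /cint; ring.
by move=> x; apply: cderivD; exact: primP.
Qed.

Lemma cintZ c phi a b : (forall x, ccts phi x) ->
  cint a b (fun t => c * phi t) = c * cint a b phi.
Proof.
move=> h1; rewrite (@cint_FTC (fun t => c * prim phi t)).
  by rewrite /cint; ring.
by move=> x; apply: cderivZ; exact: primP.
Qed.

Lemma cint_bound phi (a b M : R) : a <= b -> (forall x, ccts phi x) ->
  (forall x, a <= x <= b -> N (phi x) <= M) -> N (cint a b phi) <= M * (b - a).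
Proof.
move=> ab h hM; have H := primP h.
apply: (@curve_MVT _ _ phi) => // x; first by move=> _; exact: cderiv_ccts.
by move=> /andP[h1 h2]; apply: hM; rewrite !ltW.
Qed.

Lemma pt_h (x y : R) : x +i* y = 'i * y%:C + x%:C * 1 :> C.
Proof. by rewrite mulr1 addrC [LHS]complexE. Qed.

Lemma pt_v (x y : R) : x +i* y = x%:C + y%:C * 'i :> C.
Proof. by rewrite [_ * 'i]mulrC [LHS]complexE. Qed.

Lemma hasd_hline g (x y : R) d : hasd g (x +i* y) d ->
  cderiv (fun t => g (t +i* y)) x d.
Proof.
rewrite pt_h => /hasd_cderiv; rewrite mulr1.
by under eq_fun do rewrite -pt_h.
Qed.

Lemma hasd_vline g (x y : R) d : hasd g (x +i* y) d ->
  cderiv (fun t => g (x +i* t)) y (d * 'i).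
Proof. by rewrite pt_v => /hasd_cderiv; under eq_fun do rewrite -pt_v. Qed.

Lemma cts_hline g (x y : R) : cts g (x +i* y) -> ccts (fun t => g (t +i* y)) x.
Proof. by rewrite pt_h => /cts_ccts; under eq_fun do rewrite -pt_h. Qed.

Lemma cts_vline g (x y : R) : cts g (x +i* y) -> ccts (fun t => g (x +i* t)) y.
Proof. by rewrite pt_v => /cts_ccts; under eq_fun do rewrite -pt_v. Qed.

(** The counterclockwise contour integral around the rectangle; the factor ['i] is dz/dt on the
    vertical sides. *)
Definition rint g (x0 x1 y0 y1 : R) : C :=
  cint x0 x1 (fun t => g (t +i* y0)) - cint x0 x1 (fun t => g (t +i* y1))
  + 'i * (cint y0 y1 (fun t => g (x1 +i* t)) - cint y0 y1 (fun t => g (x0 +i* t))).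

(* continuity on the four full lines carrying the sides of the rectangle *)
Definition rcts g (x0 x1 y0 y1 : R) :=
  (forall t, ccts (fun t => g (t +i* y0)) t /\ ccts (fun t => g (t +i* y1)) t) /\
  (forall t, ccts (fun t => g (x0 +i* t)) t /\ ccts (fun t => g (x1 +i* t)) t).

Lemma cts_rcts g x0 x1 y0 y1 : (forall z, cts g z) -> rcts g x0 x1 y0 y1.
Proof.
by move=> h; split=> t; split; by [exact: cts_hline|exact: cts_vline].
Qed.

Lemma rint_xcat m g x0 x1 y0 y1 :
  rint g x0 x1 y0 y1 = rint g x0 m y0 y1 + rint g m x1 y0 y1.
Proof. by rewrite /rint -!(cint_cat m x0 x1); ring. Qed.

Lemma rint_ycat m g x0 x1 y0 y1 :
  rint g x0 x1 y0 y1 = rint g x0 x1 y0 m + rint g x0 x1 m y1.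
Proof. by rewrite /rint -!(cint_cat m y0 y1); ring. Qed.

Lemma rintD f g x0 x1 y0 y1 : rcts f x0 x1 y0 y1 -> rcts g x0 x1 y0 y1 ->
  rint (fun z => f z + g z) x0 x1 y0 y1 = rint f x0 x1 y0 y1 + rint g x0 x1 y0 y1.
Proof.
move=> [f1 f2] [g1 g2]; rewrite /rint !cintD; first by ring.
all: by move=> x; case: (f1 x) (f2 x) (g1 x) (g2 x) => ? ? [? ?] [? ?] [? ?].
Qed.

Lemma rintZ c g x0 x1 y0 y1 : rcts g x0 x1 y0 y1 ->
  rint (fun z => c * g z) x0 x1 y0 y1 = c * rint g x0 x1 y0 y1.
Proof.
move=> [g1 g2]; rewrite /rint !cintZ; first by ring.
all: by move=> x; case: (g1 x) (g2 x) => ? ? [? ?].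
Qed.

Lemma rint_bound g (x0 x1 y0 y1 M : R) : x0 <= x1 -> y0 <= y1 ->
  rcts g x0 x1 y0 y1 ->
  (forall x y, x0 <= x <= x1 -> y0 <= y <= y1 ->
     x = x0 \/ x = x1 \/ y = y0 \/ y = y1 -> N (g (x +i* y)) <= M) ->
  N (rint g x0 x1 y0 y1) <= M * (2 * (x1 - x0) + 2 * (y1 - y0)).
Proof.
move=> hx hy [g1 g2] hM; rewrite /rint.
apply: (le_trans (normcD _ _)); rewrite normcM normc_i mul1r.
apply: (le_trans (lerD (normc_sub _ _) (normc_sub _ _))).
have -> : M * (2 * (x1 - x0) + 2 * (y1 - y0)) =
  M * (x1 - x0) + M * (x1 - x0) + (M * (y1 - y0) + M * (y1 - y0)) by ring.
apply: lerD; apply: lerD; apply: cint_bound => // x.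
all: try by case: (g1 x).
all: try by case: (g2 x).
all: move=> xi; apply: hM; rewrite ?lexx ?hx ?hy//; auto.
Qed.

(** Each side contributes the difference of [G] at its two ends, and around the four corners these
    differences telescope. *)
Lemma rint_prim G g x0 x1 y0 y1 :
  (forall x y, y = y0 \/ y = y1 \/ x = x0 \/ x = x1 -> hasd G (x +i* y) (g (x +i* y))) ->
  rcts g x0 x1 y0 y1 -> rint g x0 x1 y0 y1 = 0.
Proof.
move=> h [g1 g2]; rewrite /rint mulrBr -!cintZ; last 2 first.
- by move=> x; case: (g2 x).
- by move=> x; case: (g2 x).
rewrite (@cint_FTC (fun t => G (t +i* y0))); last first.
  by move=> x; apply: hasd_hline; apply: h; auto.
rewrite (@cint_FTC (fun t => G (t +i* y1))); last first.
  by move=> x; apply: hasd_hline; apply: h; auto.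
rewrite (@cint_FTC (fun t => G (x1 +i* t))); last first.
  by move=> x; rewrite mulrC; apply: hasd_vline; apply: h; auto.
rewrite (@cint_FTC (fun t => G (x0 +i* t))); last first.
  by move=> x; rewrite mulrC; apply: hasd_vline; apply: h; auto.
by ring.
Qed.

End CurveIntegral.

(** * Goursat's lemma by bisection *)

Section Goursat.
Variable R : realType.
Local Notation C := (R[i]).
Local Notation N := (@normc R).
Local Notation Re := (@complex.Re R).
Local Notation Im := (@complex.Im R).
Implicit Types (g : C -> C).

Lemma nested_intervals (a b : nat -> R) :
  (forall n, a n <= a n.+1) -> (forall n, b n.+1 <= b n) -> (forall n, a n <= b n) ->
  exists X, forall n, a n <= X <= b n.
Proof.
move=> ha hb hab.
have na n k : a n <= a (n + k)%N.
  by elim: k => [|k IH]; rewrite ?addn0// addnS (le_trans IH).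
have nb n k : b (n + k)%N <= b n.
  by elim: k => [|k IH]; rewrite ?addn0// addnS (le_trans _ IH).
have hab' n m : a n <= b m.
  by apply: (le_trans (na n m)); apply: (le_trans (hab _)); rewrite addnC.
exists (sup (range a)) => n; apply/andP; split.
  apply: ub_le_sup; last by exists n.
  by exists (b 0%N) => _ [m _ <-].
by apply: ge_sup; [exists (a 0%N); exists 0%N | move=> _ [m _ <-]].
Qed.

Lemma halving_small (s k : R) : 0 <= s -> 0 < k -> exists n, s / 2 ^+ n < k.
Proof.
move=> s0 k0; exists (Num.bound (s / k)).
rewrite ltr_pdivrMr ?exprn_gt0// mulrC -ltr_pdivrMr//.
apply: lt_le_trans (archi_boundP _) _; first by rewrite divr_ge0// ltW.
by rewrite -natrX ler_nat; apply: ltnW; apply: ltn_expl.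
Qed.

(** The affine part of [g] at the point has a primitive and integrates to 0. The remainder is at
    most e/2 * (w + h) on a contour of length 2 (w + h). *)
Lemma goursat_small g (X Y : R) d (e : R) : 0 < e -> (forall z, cts g z) ->
  hasd g (X +i* Y) d -> exists2 k : R, 0 < k &
  forall x y w h, x <= X <= x + w -> y <= Y <= y + h -> w + h < k ->
    N (rint g x (x + w) y (y + h)) <= e * (w + h) ^+ 2.
Proof.
move=> e0 cg hd; have e2 : 0 < e / 2 by rewrite divr_gt0.
have [k k0 hk] := hd _ e2; exists k => // x y w h xX yY whk.
set P := X +i* Y in hd hk *.
pose r z := g z - g P - d * (z - P).
pose A z := g P + d * (z - P).
have hA z : hasd A z d.
  apply: hasd_eq (hasdD (hasd_cst _ z) (hasdMl d (hasdB (hasd_id z) (hasd_cst P z)))) _.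
  by ring.
have cA z : cts A z by exact: hasd_cts (hA z).
have cr z : cts r z.
  apply: (@cts_ext _ (fun z => g z + (-1) * A z) _ _ 1) => //.
    by move=> u _; rewrite /r /A; ring.
  by apply: ctsD => //; apply: ctsM => //; exact: cts_cst.
have gE : g = fun z => A z + r z by apply/funext => z; rewrite /A /r; ring.
have w0 : 0 <= w by lra.
have h0 : 0 <= h by lra.
rewrite gE rintD; [|exact: cts_rcts|exact: cts_rcts].
rewrite (@rint_prim _ (fun z => g P * z + d * (z ^+ 2 / 2 - P * z)) A); first last.
- exact: cts_rcts.
- move=> u v _; set z := u +i* v.
  apply: hasd_eq (hasdD (hasdMl (g P) (hasd_id z)) (hasdMl d (hasdB
    (hasdMr 2^-1 (hasdX 1 (hasd_id z))) (hasdMl P (hasd_id z))))) _.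
  by rewrite /A expr1; field.
rewrite add0r.
have -> : e * (w + h) ^+ 2 = (e / 2 * (w + h)) * (2 * (x + w - x) + 2 * (y + h - y)).
  by field.
apply: rint_bound; rewrite ?lerDl//; first exact: cts_rcts.
move=> u v ux vy _.
have uv : N (u +i* v - P) <= w + h.
  apply: (le_trans (normc_ReIm _)); rewrite /=; apply: lerD.
    by rewrite ler_norml; lra.
  by rewrite ler_norml; lra.
apply: (le_trans (hk _ (le_lt_trans uv whk))).
by rewrite ler_wpM2l// ltW.
Qed.

(** If the estimate fails on a rectangle, it fails on one of its quarters. The nested bad rectangles
    shrink to a point of differentiability, where [goursat_small] contradicts them. *)
Lemma goursat_eps g (x0 y0 w h e : R) : 0 <= w -> 0 <= h -> 0 < e ->
  (forall z, cts g z) ->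
  (forall x y, x0 <= x <= x0 + w -> y0 <= y <= y0 + h -> exists d, hasd g (x +i* y) d) ->
  N (rint g x0 (x0 + w) y0 (y0 + h)) <= e * (w + h) ^+ 2.
Proof.
move=> w0 h0 e0 cg hg; apply: contrapT => bad.
pose wn n := w / 2 ^+ n; pose hn n := h / 2 ^+ n.
have wE n : wn n = wn n.+1 + wn n.+1.
  by rewrite /wn exprS; field; rewrite expf_neq0.
have hE n : hn n = hn n.+1 + hn n.+1.
  by rewrite /hn exprS; field; rewrite expf_neq0.
have wn0 n : 0 <= wn n by rewrite divr_ge0// exprn_ge0.
have hn0 n : 0 <= hn n by rewrite divr_ge0// exprn_ge0.
pose good n (p : R * R) := N (rint g p.1 (p.1 + wn n) p.2 (p.2 + hn n)) <= e * (wn n + hn n) ^+ 2.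
pose next n (p q : R * R) := [/\ p.1 <= q.1, q.1 + wn n.+1 <= p.1 + wn n,
   p.2 <= q.2 & q.2 + hn n.+1 <= p.2 + hn n].
have step (np : nat * (R * R)) : exists q, ~ good np.1 np.2 ->
    ~ good np.1.+1 q /\ next np.1 np.2 q.
  case: np => n [x y] /=.
  have [[q hq]|H] := pselect (exists q, ~ good n.+1 q /\ next n (x, y) q).
    by exists q.
  (* With no bad quarter available, the four quarter estimates add up to the estimate for the whole,
     since halving both sides divides the square of their sum by 4. The dummy witness only makes the
     successor total for [choice]. *)
  exists (x, y) => bd; exfalso; apply: bd.
  have G q : next n (x, y) q -> good n.+1 q.
    by move=> hq; apply: contrapT => nq; apply: H; exists q.
  have W := wE n; have Hh := hE n; have W0 := wn0 n.+1; have Hh0 := hn0 n.+1.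
  have G1 : good n.+1 (x, y) by apply: G; split => /=; lra.
  have G2 : good n.+1 (x + wn n.+1, y) by apply: G; split => /=; lra.
  have G3 : good n.+1 (x, y + hn n.+1) by apply: G; split => /=; lra.
  have G4 : good n.+1 (x + wn n.+1, y + hn n.+1) by apply: G; split => /=; lra.
  move: G1 G2 G3 G4; rewrite /good /= W Hh !addrA.
  set a := wn n.+1; set b := hn n.+1.
  move=> G1 G2 G3 G4.
  rewrite (rint_xcat (x + a)) (rint_ycat (y + b) _ x) (rint_ycat (y + b) _ (x + a)).
  apply: (le_trans (normcD _ _)).
  apply: (le_trans (lerD (normcD _ _) (normcD _ _))).
  apply: (le_trans (lerD (lerD G1 G3) (lerD G2 G4))).
  by rewrite le_eqVlt; apply/orP; left; apply/eqP; ring.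
have [F hF] := choice step.
pose fix s n := if n is m.+1 then F (m, s m) else (x0, y0).
have sbad n : ~ good n (s n).
  elim: n => [|n IH]; last by have [] := hF (n, s n) IH.
  by rewrite /good /= /wn /hn expr0 !divr1.
have snext n : next n (s n) (s n.+1) by have [] := hF (n, s n) (sbad n).
have [X hX] : exists X, forall n, (s n).1 <= X <= (s n).1 + wn n.
  apply: nested_intervals => n; try by case: (snext n).
  by rewrite lerDl.
have [Y hY] : exists Y, forall n, (s n).2 <= Y <= (s n).2 + hn n.
  apply: nested_intervals => n; try by case: (snext n).
  by rewrite lerDl.
have [||d hd] := hg X Y.
- by have := hX 0%N; rewrite /= /wn expr0 divr1.
- by have := hY 0%N; rewrite /= /hn expr0 divr1.
have [k k0 hk] := goursat_small e0 cg hd.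
have [n hn'] := halving_small (addr_ge0 w0 h0) k0.
apply: (sbad n); apply: hk => //.
by rewrite /wn /hn -mulrDl.
Qed.

Lemma goursat g (x0 x1 y0 y1 : R) : x0 <= x1 -> y0 <= y1 ->
  (forall z, cts g z) ->
  (forall x y, x0 <= x <= x1 -> y0 <= y <= y1 -> exists d, hasd g (x +i* y) d) ->
  rint g x0 x1 y0 y1 = 0.
Proof.
move=> hx hy cg hg; apply: eq0_normc; apply/eqP; rewrite eq_le normc_ge0 andbT.
rewrite leNgt; apply/negP => I0.
have Ex : x1 = x0 + (x1 - x0) by ring.
have Ey : y1 = y0 + (y1 - y0) by ring.
set I := N _ in I0.
pose S := (x1 - x0 + (y1 - y0)) ^+ 2 + 1.
have S0 : 0 < S by rewrite /S ltr_wpDl ?sqr_ge0.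
have e0 : 0 < I / 2 / S by rewrite !divr_gt0.
have := @goursat_eps g x0 y0 (x1 - x0) (y1 - y0) (I / 2 / S).
rewrite -Ex -Ey !subr_ge0 => /(_ hx hy e0 cg hg); rewrite -/I.
apply/negP; rewrite -ltNge.
apply: (@lt_trans _ _ (I / 2 / S * S)).
  by rewrite ltr_pM2l// /S ltrDl.
by rewrite divfK ?gt_eqF//; lra.
Qed.

(* A point where g is merely continuous is cut out by a square of vanishing perimeter. *)
Lemma goursat_punctured g (a1 a2 x0 x1 y0 y1 : R) :
  x0 < a1 < x1 -> y0 < a2 < y1 -> (forall z, cts g z) ->
  (forall z, z != a1 +i* a2 -> exists d, hasd g z d) ->
  rint g x0 x1 y0 y1 = 0.
Proof.
move=> /andP[xa ax] /andP[ya ay] cg hg; set a := a1 +i* a2 in hg.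
apply: eq0_normc; apply/eqP; rewrite eq_le normc_ge0 andbT.
rewrite leNgt; apply/negP => I0.
have [k k0 hk] := cg a 1 ltr01.
set I := N _ in I0; pose M := N (g a) + 1.
have M0 : 0 < M by rewrite ltr_wpDl ?normc_ge0.
pose m := Num.min (Num.min (a1 - x0) (x1 - a1)) (Num.min (a2 - y0) (y1 - a2)).
(* Half the side of the removed square: [m] keeps it inside the rectangle, [k / 3] keeps it where
   |g| <= M, and the last bound makes M times the perimeter 8 n at most I/2. *)
pose n := Num.min (Num.min m (k / 3)) (I / (16 * M)).
have n0 : 0 < n by rewrite !lt_min !subr_gt0 xa ax ya ay !divr_gt0 ?mulr_gt0.
have [n1 n2 n3 n4] : [/\ n <= a1 - x0, n <= x1 - a1, n <= a2 - y0 & n <= y1 - a2].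
  by rewrite /n /m !ge_min !lexx !orbT.
have nk : n <= k / 3 by rewrite /n !ge_min !lexx !orbT.
have nI : n <= I / (16 * M) by rewrite /n !ge_min !lexx !orbT.
have G x x' y y' : x <= x' -> y <= y' ->
    (forall u v, x <= u <= x' -> y <= v <= y' -> u = a1 -> v = a2 -> False) -> rint g x x' y y' = 0.
  move=> hx hy hn; apply: goursat => // u v hu hv; apply: hg.
  by apply/eqP => -[ua va]; exact: (hn u v).
have IE : rint g x0 x1 y0 y1 = rint g (a1 - n) (a1 + n) (a2 - n) (a2 + n).
  rewrite (rint_xcat (a1 - n)) (rint_xcat (a1 + n) _ (a1 - n)).
  rewrite (rint_ycat (a2 - n) _ (a1 - n)) (rint_ycat (a2 + n) _ (a1 - n) _ (a2 - n)).
  have G1 : rint g x0 (a1 - n) y0 y1 = 0 by apply: G => *; lra.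
  have G2 : rint g (a1 + n) x1 y0 y1 = 0 by apply: G => *; lra.
  have G3 : rint g (a1 - n) (a1 + n) y0 (a2 - n) = 0 by apply: G => *; lra.
  have G4 : rint g (a1 - n) (a1 + n) (a2 + n) y1 = 0 by apply: G => *; lra.
  by rewrite G1 G2 G3 G4 !add0r !addr0.
have := @rint_bound _ g (a1 - n) (a1 + n) (a2 - n) (a2 + n) M.
rewrite -IE -/I => H.
have {}H : I <= M * (2 * (a1 + n - (a1 - n)) + 2 * (a2 + n - (a2 - n))).
  apply: H; [lra|lra|exact: cts_rcts|].
  move=> x y hx hy _.
  have xy : N (x +i* y - a) < k.
    apply: (le_lt_trans (normc_ReIm _)) => /=.
    have : `|x - a1| <= n by rewrite ler_norml; lra.
    have : `|y - a2| <= n by rewrite ler_norml; lra.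
    lra.
  have := normcD (g (x +i* y) - g a) (g a); rewrite subrK => /le_trans; apply.
  by rewrite /M addrC lerD2l; exact: hk.
have : M * (8 * n) <= I / 2.
  apply: (@le_trans _ _ (M * (8 * (I / (16 * M))))).
    by rewrite ler_pM2l// ler_pM2l.
  by rewrite le_eqVlt; apply/orP; left; apply/eqP; field; rewrite gt_eqF.
have -> : M * (8 * n) = M * (2 * (a1 + n - (a1 - n)) + 2 * (a2 + n - (a2 - n))) by ring.
move: H I0; lra.
Qed.

End Goursat.

(** * Cauchy's formula on a square, and differentiability of the derivative *)

Section Cauchy.
Variable R : realType.
Local Notation C := (R[i]).
Local Notation N := (@normc R).
Local Notation Re := (@complex.Re R).
Local Notation Im := (@complex.Im R).
Implicit Types (f g : C -> C) (a b z : C).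

Lemma curve_bounded (phi : R -> C) (a b : R) : a <= b -> (forall x, ccts phi x) ->
  exists M, forall x, a <= x <= b -> N (phi x) <= M.
Proof.
move=> ab h.
have [|c _ hc] := @EVT_max R (fun x => N (phi x)) a b ab.
  apply: continuous_in_subspaceT => x _; apply/real_ctsP => e e0.
  have [k k0 hk] := h x e e0; exists k => // y /hk; apply: le_trans.
  rewrite ler_norml; have := normcB_ge (phi y) (phi x).
  by have := normcB_ge (phi x) (phi y); rewrite normc_distC; lra.
by exists (N (phi c)) => x xab; apply: hc; rewrite in_itv.
Qed.

(** The four full lines through the sides of the square, not just the sides, because [rcts] asks for
    continuity along whole lines. They stay at distance at least 1 from 0, so a kernel with pole
    [a], |a| < 1/2, is regular on them. *)
Definition onl (x y : R) := y = -1 \/ y = 1 \/ x = -1 \/ x = 1.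

Lemma onl_norm x y : onl x y -> 1 <= N (x +i* y).
Proof.
case=> [->|[->|[->|->]]].
- by have := normc_Im (x +i* -1); rewrite /= normrN1.
- by have := normc_Im (x +i* 1); rewrite /= normr1.
- by have := normc_Re (-1 +i* y); rewrite /= normrN1.
- by have := normc_Re (1 +i* y); rewrite /= normr1.
Qed.

Local Notation sint f := (rint f (-1) 1 (-1) 1).

Lemma onl_rcts f : (forall x y, onl x y -> cts f (x +i* y)) -> rcts f (-1) 1 (-1) 1.
Proof.
move=> h; split=> t; split; [apply: cts_hline|apply: cts_hline|apply: cts_vline|apply: cts_vline];
apply: h; rewrite /onl; auto.
Qed.

Lemma sint_ext f g : (forall x y, onl x y -> f (x +i* y) = g (x +i* y)) ->
  sint f = sint g.
Proof.
move=> h; have hh y : y = -1 \/ y = 1 ->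
    (fun t => f (t +i* y)) = (fun t => g (t +i* y)).
  by move=> hy; apply/funext => t; apply: h; rewrite /onl; tauto.
have hv x : x = -1 \/ x = 1 -> (fun t => f (x +i* t)) = (fun t => g (x +i* t)).
  by move=> hx; apply/funext => t; apply: h; rewrite /onl; tauto.
by rewrite /rint !hh ?hv//; auto.
Qed.

Lemma sint_bound f M : rcts f (-1) 1 (-1) 1 ->
  (forall x y, -1 <= x <= 1 -> -1 <= y <= 1 -> onl x y -> N (f (x +i* y)) <= M) ->
  N (sint f) <= 8 * M.
Proof.
move=> cf hM; have -> : 8 * M = M * (2 * (1 - -1) + 2 * (1 - -1)) by ring.
apply: rint_bound; [lra|lra|by []|].
by move=> x y hx hy hb; apply: hM => //; rewrite /onl; tauto.
Qed.

(** Differentiation under the integral sign: the remainder of the kernel is quadratic in b - a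
    uniformly on the contour, and |g| is bounded there by compactness of the sides. *)
Lemma kernel_hasd g (k : C -> C -> C) k' a (B : R) : (forall z, cts g z) ->
  N a < 2^-1 ->
  (forall b x y, N b < 2^-1 -> onl x y -> cts (k b) (x +i* y)) ->
  (forall x y, onl x y -> cts k' (x +i* y)) ->
  (forall b x y, N b < 2^-1 -> onl x y ->
    N (k b (x +i* y) - k a (x +i* y) - (b - a) * k' (x +i* y)) <= B * N (b - a) ^+ 2) ->
  hasd (fun b => sint (fun z => g z * k b z)) a (sint (fun z => g z * k' z)).
Proof.
move=> cg ha ck ck' hB.
have [M hM] : exists M, forall x y, -1 <= x <= 1 -> -1 <= y <= 1 -> onl x y -> N (g (x +i* y)) <= M.
  have h1 : -1 <= 1 :> R by lra.
  have [M1 m1] := curve_bounded h1 (fun x => cts_hline (cg (x +i* -1))).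
  have [M2 m2] := curve_bounded h1 (fun x => cts_hline (cg (x +i* 1))).
  have [M3 m3] := curve_bounded h1 (fun y => cts_vline (cg (-1 +i* y))).
  have [M4 m4] := curve_bounded h1 (fun y => cts_vline (cg (1 +i* y))).
  exists (Num.max (Num.max M1 M2) (Num.max M3 M4)) => x y hx hy.
  by case=> [->|[->|[->|->]]]; rewrite !le_max ?m1 ?m2 ?m3 ?m4 ?orbT.
have M0 : 0 <= M.
  apply: le_trans (normc_ge0 (g (1 +i* 1))) _.
  by apply: hM; [lra|lra|rewrite /onl; auto].
have B0 : 0 <= `|B| by [].
(* The factor 8 is the perimeter of the square; the summand 1 keeps [D] positive. *)
move=> e e0; pose D := 8 * (M * `|B|) + 1.
have MB : 0 <= M * `|B| by rewrite mulr_ge0.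
have D0 : 0 < D by rewrite /D; lra.
exists (Num.min (2^-1 - N a) (e / D)); first by rewrite lt_min subr_gt0 ha divr_gt0.
move=> b; rewrite lt_min => /andP[b1 b2].
have hb : N b < 2^-1.
  by have := normcD (b - a) a; rewrite subrK; lra.
have cgk c : N c < 2^-1 -> rcts (fun z => g z * k c z) (-1) 1 (-1) 1.
  by move=> hc; apply: onl_rcts => x y xy; apply: ctsM => //; exact: ck.
have cgk' : rcts (fun z => g z * k' z) (-1) 1 (-1) 1.
  by apply: onl_rcts => x y xy; apply: ctsM => //; exact: ck'.
have czk' c : rcts (fun z => c * (g z * k' z)) (-1) 1 (-1) 1.
  apply: onl_rcts => x y xy; apply: ctsM; first exact: cts_cst.
  by apply: ctsM => //; exact: ck'.
have cak : rcts (fun z => -1 * (g z * k a z)) (-1) 1 (-1) 1.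
  apply: onl_rcts => x y xy; apply: ctsM; first exact: cts_cst.
  by apply: ctsM => //; exact: ck.
pose rm z := g z * (k b z - k a z - (b - a) * k' z).
have E : sint (fun z => g z * k b z) - sint (fun z => g z * k a z)
   - sint (fun z => g z * k' z) * (b - a) = sint rm.
  have -> : sint rm = sint (fun z => (g z * k b z + -1 * (g z * k a z)) + (- (b - a)) * (g z * k' z)).
    by apply: sint_ext => x y _; rewrite /rm; ring.
  rewrite rintD//; first rewrite rintD// ?rintZ//; try exact: cgk.
  - by ring.
  - apply: onl_rcts => x y xy; apply: ctsD; first by apply: ctsM => //; exact: ck.
    apply: ctsM; first exact: cts_cst.
    by apply: ctsM => //; exact: ck.
rewrite E.
have rmB : N (sint rm) <= 8 * (M * (`|B| * N (b - a) ^+ 2)).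
  apply: sint_bound.
    apply: onl_rcts => x y xy; rewrite /rm; apply: ctsM => //.
    apply: (@cts_ext _ (fun z => (k b z + -1 * k a z) + (- (b - a)) * k' z) _ _ 1) => //.
      by move=> z _; ring.
    apply: ctsD; first apply: ctsD.
    - exact: ck.
    - by apply: ctsM; [exact: cts_cst|exact: ck].
    - by apply: ctsM; [exact: cts_cst|exact: ck'].
  move=> x y hx hy xy; rewrite /rm normcM ler_pM ?normc_ge0 ?hM//.
  apply: le_trans (hB _ _ _ hb xy) _.
  by rewrite ler_wpM2r ?sqr_ge0// ler_norm.
apply: (le_trans rmB).
have -> : 8 * (M * (`|B| * N (b - a) ^+ 2)) = (8 * (M * `|B|) * N (b - a)) * N (b - a) by ring.
rewrite ler_wpM2r ?normc_ge0//.
apply: (@le_trans _ _ (D * N (b - a))).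
  by rewrite ler_wpM2r ?normc_ge0// /D lerDl.
by rewrite mulrC -ler_pdivlMr// ltW.
Qed.

Definition ker1 a z : C := (z - a)^-1.

Lemma ker1_bound a x y : N a < 2^-1 -> onl x y ->
  x +i* y - a != 0 /\ N (ker1 a (x +i* y)) <= 2.
Proof.
move=> ha /onl_norm h; rewrite /ker1 -normc_gt0 normcV.
have := normcB_ge (x +i* y) a; set D := N (_ - _) => hD.
have D2 : 2^-1 <= D by lra.
have D0 : 0 < D by lra.
by split=> //; rewrite -[2]invrK lef_pV2 ?posrE ?invr_gt0.
Qed.

Lemma ker1_cts a z : z - a != 0 -> cts (ker1 a) z.
Proof.
move=> za; apply: (@hasd_cts _ _ _ (- (1 - 0) / (z - a) ^+ 2)).
by apply: hasdV => //; apply: hasdB; [exact: hasd_id|exact: hasd_cst].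
Qed.

Lemma ker1X_cts a z n : z - a != 0 -> cts (fun w => ker1 a w ^+ n) z.
Proof.
move=> za; elim: n => [|n IH]; first by under eq_fun do rewrite expr0; exact: cts_cst.
by under eq_fun do rewrite exprS; apply: ctsM => //; exact: ker1_cts.
Qed.

(** The Cauchy integral of g(z) / (z - a)^n over the square, without the usual normalisation by 2 pi
    i and factorials. *)
Definition kint n g a := sint (fun z => g z * ker1 a z ^+ n).

Lemma kint1_hasd g a : (forall z, cts g z) -> N a < 2^-1 ->
  hasd (kint 1 g) a (kint 2 g a).
Proof.
move=> cg ha; apply: (@kernel_hasd g _ (fun z => ker1 a z ^+ 2) a 8) => //.
- by move=> b x y hb xy; apply: ker1X_cts; case: (ker1_bound hb xy).
- by move=> x y xy; apply: ker1X_cts; case: (ker1_bound ha xy).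
move=> b x y hb xy; have [a0 a2] := ker1_bound ha xy; have [b0 b2] := ker1_bound hb xy.
have -> : ker1 b (x +i* y) ^+ 1 - ker1 a (x +i* y) ^+ 1 - (b - a) * ker1 a (x +i* y) ^+ 2
  = ker1 a (x +i* y) ^+ 2 * ker1 b (x +i* y) * (b - a) ^+ 2.
  by rewrite /ker1; field; rewrite a0 b0.
rewrite normcM [N ((b - a) ^+ 2)]normcX ler_wpM2r ?exprn_ge0 ?normc_ge0//.
rewrite normcM normcX.
have a20 := normc_ge0 (ker1 a (x +i* y)); have b20 := normc_ge0 (ker1 b (x +i* y)).
have -> : 8 = 2 ^+ 2 * 2 :> R by ring.
by rewrite ler_pM ?exprn_ge0// lerXn2r ?nnegrE.
Qed.

Lemma kint2_hasd g a : (forall z, cts g z) -> N a < 2^-1 ->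
  hasd (kint 2 g) a (sint (fun z => g z * (2 * ker1 a z ^+ 3))).
Proof.
move=> cg ha; apply: (@kernel_hasd g _ (fun z => 2 * ker1 a z ^+ 3) a 48) => //.
- by move=> b x y hb xy; apply: ker1X_cts; case: (ker1_bound hb xy).
- move=> x y xy; apply: ctsM; first exact: cts_cst.
  by apply: ker1X_cts; case: (ker1_bound ha xy).
move=> b x y hb xy; have [a0 a2] := ker1_bound ha xy; have [b0 b2] := ker1_bound hb xy.
(* The coefficient 2 is written as an embedded real so that [normc_real] evaluates its modulus; with
   both kernels at most 2 the bound is 16 + 32 = 48. *)
have -> : ker1 b (x +i* y) ^+ 2 - ker1 a (x +i* y) ^+ 2 - (b - a) * (2 * ker1 a (x +i* y) ^+ 3)
  = (ker1 a (x +i* y) ^+ 2 * ker1 b (x +i* y) ^+ 2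
     + 2%:R%:C * ker1 a (x +i* y) ^+ 3 * ker1 b (x +i* y)) * (b - a) ^+ 2.
  rewrite rmorph_nat.
  by rewrite /ker1; field; rewrite a0 b0.
rewrite normcM [N ((b - a) ^+ 2)]normcX ler_wpM2r ?exprn_ge0 ?normc_ge0//.
apply: (le_trans (normcD _ _)).
have -> : N (ker1 a (x +i* y) ^+ 2 * ker1 b (x +i* y) ^+ 2) =
    N (ker1 a (x +i* y)) ^+ 2 * N (ker1 b (x +i* y)) ^+ 2.
  by rewrite normcM !normcX.
have -> : N (2%:R%:C * ker1 a (x +i* y) ^+ 3 * ker1 b (x +i* y)) =
    2 * N (ker1 a (x +i* y)) ^+ 3 * N (ker1 b (x +i* y)).
  by rewrite 2!normcM normcX normc_real normr_nat.
have a20 := normc_ge0 (ker1 a (x +i* y)); have b20 := normc_ge0 (ker1 b (x +i* y)).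
have -> : 48 = 2 ^+ 2 * 2 ^+ 2 + 2 * 2 ^+ 3 * 2 :> R by ring.
apply: lerD.
  by rewrite ler_pM ?exprn_ge0// lerXn2r ?nnegrE.
rewrite ler_pM ?mulr_ge0 ?exprn_ge0//.
by rewrite ler_pM2l// lerXn2r ?nnegrE.
Qed.

(** The difference quotient of [g] at [a], given the value [dg a] there, is continuous everywhere
    and differentiable off [a], so its integral vanishes. The integral of 1 / (z - a) is kept as it
    stands instead of being evaluated to 2 pi i. *)
Lemma cauchy_formula g dg a : (forall z, hasd g z (dg z)) -> N a < 2^-1 ->
  kint 1 g a = g a * kint 1 (fun=> 1) a.
Proof.
move=> hg ha; pose G z := if z == a then dg a else (g z - g a) / (z - a).
have hG z : z != a -> exists d, hasd G z d.
  move=> za; have za0 : z - a != 0 by rewrite subr_eq0.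
  eexists; apply: (@hasd_ext _ (fun z => (g z - g a) / (z - a)) _ _ _ (N (z - a))).
  - by rewrite normc_gt0.
  - move=> w hw; rewrite /G; case: eqP => // wa.
    by move: hw; rewrite wa normc_distC ltxx.
  - apply: hasd_div => //; apply: hasdB; by [exact: hg|exact: hasd_cst|exact: hasd_id].
have cG z : cts G z.
  have [->|/hG[d]] := eqVneq z a; last exact: hasd_cts.
  move=> e e0; have [k k0 hk] := hg a e e0; exists k => // w wk.
  rewrite /G eqxx; case: eqVneq => [_|wa]; first by rewrite subrr normc0 ltW.
  have wa0 : w - a != 0 by rewrite subr_eq0.
  rewrite -(@ler_pM2r _ (N (w - a))) ?normc_gt0// -normcM mulrBl divfK//.
  exact: hk.
have I0 : sint G = 0.
  case: a ha @G hG cG => a1 a2 ha G hG cG.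
  have := normc_Re (a1 +i* a2); have := normc_Im (a1 +i* a2).
  rewrite /= !ler_norml => /andP[i1 i2] /andP[r1 r2].
  apply: (@goursat_punctured _ _ a1 a2) => //; move: ha => /=; lra.
have : sint G = sint (fun z => g z * ker1 a z ^+ 1 + (- g a) * (1 * ker1 a z ^+ 1)).
  apply: sint_ext => x y xy; have [a0 _] := ker1_bound ha xy.
  by rewrite /G -subr_eq0 (negbTE a0) /ker1; field.
have ck f : (forall z, cts f z) -> rcts (fun z => f z * ker1 a z ^+ 1) (-1) 1 (-1) 1.
  move=> cf; apply: onl_rcts => x y xy; apply: ctsM => //.
  by apply: ker1X_cts; case: (ker1_bound ha xy).
have c1 z : cts (fun=> 1 : C) z by exact: cts_cst.
have -> : sint (fun z => g z * ker1 a z ^+ 1 + (- g a) * (1 * ker1 a z ^+ 1)) =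
    sint (fun z => g z * ker1 a z ^+ 1) + sint (fun z => (- g a) * (1 * ker1 a z ^+ 1)).
  apply: rintD; first by apply: ck => z; exact: hasd_cts (hg z).
  apply: onl_rcts => x y xy; apply: ctsM; first exact: cts_cst.
  by apply: ctsM => //; apply: ker1X_cts; case: (ker1_bound ha xy).
have -> : sint (fun z => (- g a) * (1 * ker1 a z ^+ 1)) =
    (- g a) * sint (fun z => 1 * ker1 a z ^+ 1).
  by apply: rintZ; exact: (ck (fun=> 1)).
rewrite I0.
move=> /esym/eqP; rewrite mulNr subr_eq0 => /eqP; exact.
Qed.

(* Up to the factor 2 pi i this is the winding number of the square around its centre. *)
Lemma kint1_neq0 : kint 1 (fun=> 1) 0 != 0.
Proof.
have h0 : N (0 : C) < 2^-1 by rewrite normc0; lra.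
pose q z := 1 * ker1 0 z ^+ 1.
have cq x y : onl x y -> cts q (x +i* y).
  move=> xy; apply: ctsM; first exact: cts_cst.
  by apply: ker1X_cts; case: (ker1_bound h0 xy).
have [q1 q2] := onl_rcts cq.
(* All four sides are parametrised by the same interval, so the contour integral is one integral of
   a density, which turns out to be i * 4 / (1 + t^2). *)
pose phi t := q (t +i* -1) + -1 * q (t +i* 1) + ('i * q (1 +i* t) + (- 'i) * q (-1 +i* t)).
have E1 t : ccts (fun t => q (t +i* -1) + -1 * q (t +i* 1)) t.
  by case: (q1 t) => ? ?; apply: cctsD => //; exact: cctsZ.
have E2 t : ccts (fun t => 'i * q (1 +i* t) + (- 'i) * q (-1 +i* t)) t.
  by case: (q2 t) => ? ?; apply: cctsD; exact: cctsZ.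
have cphi t : ccts phi t by exact: cctsD.
have -> : kint 1 (fun=> 1) 0 = cint (-1) 1 phi.
  have c1 t := proj1 (q1 t); have c2 t := proj2 (q1 t).
  have c3 t := proj1 (q2 t); have c4 t := proj2 (q2 t).
  rewrite (cintD _ _ E1 E2) (cintD _ _ c1 (fun t => cctsZ (-1) (c2 t))).
  rewrite (cintD _ _ (fun t => cctsZ 'i (c4 t)) (fun t => cctsZ (- 'i) (c3 t))).
  rewrite (cintZ (-1) _ _ c2) (cintZ 'i _ _ c4) (cintZ (- 'i) _ _ c3).
  by rewrite /kint /rint -/q; ring.
have phiE t : phi t = 'i * (4 / (1 + t ^+ 2))%:C.
  have n0 : 1 + t ^+ 2 != 0 by rewrite gt_eqF// ltr_pwDl ?sqr_ge0.
  have nt : (1 + t ^+ 2)%:C != 0 by rewrite -normc_gt0 normc_real normr_gt0.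
  have pt (a b : R) : a +i* b = a%:C + 'i * b%:C :> C by rewrite [LHS]complexE.
  have i2 : 'i * 'i = -1 :> C by rewrite -expr2 sqr_i.
  have qE (a b : R) : a ^+ 2 + b ^+ 2 = 1 + t ^+ 2 -> q (a +i* b) = (a%:C - 'i * b%:C) / (1 + t ^+ 2)%:C.
    move=> ab; rewrite /q /ker1 subr0 mul1r expr1.
    have M : (a +i* b) * (a%:C - 'i * b%:C) = (1 + t ^+ 2)%:C.
      rewrite pt -ab rmorphD !rmorphXn /=.
      have -> : (a%:C + 'i * b%:C) * (a%:C - 'i * b%:C) = a%:C ^+ 2 - ('i * 'i) * b%:C ^+ 2 by ring.
      by rewrite i2; ring.
    have ab0 : a +i* b != 0 by apply: contraNneq nt => ab0; rewrite -M ab0 mul0r.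
    by apply: (mulfI ab0); rewrite mulfV// mulrA M mulfV.
  rewrite /phi !qE; try by ring.
  rewrite fmorph_div /= rmorphN rmorph1 rmorph_nat.
  by move: ((1 + t ^+ 2)%:C) nt => D D0; field.
have h1 : -1 < 1 :> R by lra.
(* Testing with [- 'i] shows that the imaginary part of the integral is twice a value of 4 / (1 +
   t^2), hence positive. *)
have [t _] := @curve_MVT_Re _ (prim phi) phi (-1) 1 (- 'i) h1
  (fun x _ => primP cphi x) (fun x _ => cderiv_ccts (primP cphi x)).
rewrite -ImE phiE => E; apply/eqP => I0.
have : Re (- 'i * ('i * (4 / (1 + t ^+ 2))%:C)) * (1 - -1) > 0.
  have -> : - 'i * ('i * (4 / (1 + t ^+ 2))%:C) = (4 / (1 + t ^+ 2))%:C.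
    by rewrite mulrA mulNr -expr2 sqr_i opprK mul1r.
  apply: mulr_gt0; last by lra.
  by rewrite /= divr_gt0// ltr_pwDl ?sqr_ge0.
by rewrite -E -/(cint _ _ _) I0 /= ltxx.
Qed.

(** Near 0, [g] is a quotient of two Cauchy integrals. Its derivative is again built from Cauchy
    integrals, which can be differentiated once more. The denominator is not shown to be constant,
    so the quotient rule is used, on a disc where continuity keeps it nonzero. *)
Lemma entire_derive0 g dg : (forall z, hasd g z (dg z)) -> exists d, hasd dg 0 d.
Proof.
move=> hg; have cg z := hasd_cts (hg z).
have c1 z : cts (fun=> 1 : C) z by exact: cts_cst.
have h0 : N (0 : C) < 2^-1 by rewrite normc0; lra.
have [k k0 hk] := cts_neq0 (hasd_cts (kint1_hasd c1 h0)) kint1_neq0.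
pose r := Num.min k 2^-1.
have r0 : 0 < r by rewrite lt_min k0 invr_gt0 ltr0n.
pose D a := (kint 2 g a * kint 1 (fun=> 1) a - kint 1 g a * kint 2 (fun=> 1) a)
   / kint 1 (fun=> 1) a ^+ 2.
have gE a : N a < r -> kint 1 (fun=> 1) a != 0 /\ g a = kint 1 g a / kint 1 (fun=> 1) a.
  rewrite lt_min => /andP[ak a2]; have W0 := hk a; rewrite subr0 in W0.
  split; first exact: W0.
  by rewrite (cauchy_formula hg a2) mulfK// W0.
have dgE a : N a < r -> D a = dg a.
  move=> ar; have [W0 _] := gE a ar.
  have a2 : N a < 2^-1 by move: ar; rewrite lt_min => /andP[].
  apply: hasd_unique (hg a).
  apply: (@hasd_ext _ (fun b => kint 1 g b / kint 1 (fun=> 1) b) _ _ _ (r - N a)).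
  - by rewrite subr_gt0.
  - move=> b hb; have br : N b < r by have := normcD (b - a) a; rewrite subrK; lra.
    by case: (gE b br).
  - by apply: hasd_div => //; exact: kint1_hasd.
have W0 := kint1_neq0.
have W2 : kint 1 (fun=> 1) 0 ^+ 2 != 0 :> C by rewrite expf_neq0.
have H := @hasd_div _ (fun a => kint 2 g a * kint 1 (fun=> 1) a - kint 1 g a * kint 2 (fun=> 1) a)
  (fun a => kint 1 (fun=> 1) a ^+ 2) 0 _ _ W2
  (hasdB (hasdM (kint2_hasd cg h0) (kint1_hasd c1 h0))
  (hasdM (kint1_hasd cg h0) (kint2_hasd c1 h0))) (hasdX 1 (kint1_hasd c1 h0)).
eexists; apply: (hasd_ext r0 _ H) => a; rewrite subr0; exact: dgE.
Qed.

(** Translation moves an arbitrary point to the centre of the square. *)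
Theorem entire_derive g : (forall z, derivable g z 1) ->
  forall z, derivable (derive1 g) z 1.
Proof.
move=> hg z; have hd w := derivable_hasd (hg w).
have tr f d w : hasd f (z + w) d -> hasd (fun w => f (z + w)) w d.
  move=> h; apply: hasd_eq (hasd_comp (hasdD (hasd_cst z w) (hasd_id w)) h) _.
  by rewrite add0r mulr1.
have [d hd0] := entire_derive0 (fun w => tr _ _ _ (hd (z + w))).
apply: (@hasd_derivable _ _ _ d).
have -> : derive1 g = fun w => (fun u => derive1 g (z + u)) (w - z).
  by apply/funext => w; congr (derive1 g _); ring.
have hsub : hasd (fun w => w - z) z 1.
  by apply: hasd_eq (hasdB (hasd_id z) (hasd_cst z z)) _; rewrite subr0.
rewrite -(mulr1 d); apply: (@hasd_comp _ _ (fun u => derive1 g (z + u))) => //.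
by rewrite subrr.
Qed.

End Cauchy.

(** * Division of entire functions by powers of z, and uniqueness for differential systems *)

Section Ode.
Variable R : realType.
Local Notation C := (R[i]).
Local Notation N := (@normc R).
Implicit Types (f g h : C -> C) (z u w : C).

(** The quotient takes the value h'(0) at 0, where its derivative is h''(0)/2: the mean value
    inequality bounds the second order Taylor remainder of [h] using only differentiability of h' at
    0. *)
Lemma entire_div_id h : (forall z, derivable h z 1) -> h 0 = 0 ->
  exists2 q : C -> C, (forall z, derivable q z 1) & forall z, h z = z * q z.
Proof.
move=> hh h0; have hh' := entire_derive hh.
have dh z := derivable_hasd (hh z); have dh' z := derivable_hasd (hh' z).
pose h1 := derive1 h 0; pose h2 := derive1 (derive1 h) 0.
pose q z := if z == 0 then h1 else h z / z.
exists q; last first.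
  by move=> z; rewrite /q; case: eqVneq => [->|z0]; rewrite ?h0 ?mul0r// mulrC divfK.
move=> z; have [->|z0] := eqVneq z 0; last first.
  apply: hasd_derivable.
  apply: (@hasd_ext _ (fun z => h z / z) _ _ _ (N z)).
  - by rewrite normc_gt0.
  - move=> w hw; rewrite /q; case: eqVneq => // w0.
    by move: hw; rewrite w0 sub0r normc_opp ltxx.
  - exact: (hasd_div z0 (dh z) (hasd_id z)).
apply: (@hasd_derivable _ _ _ (h2 / 2)) => e e0.
have [k k0 hk] := dh' 0 e e0; exists k => // w wk.
pose kk z := h z - h1 * z - h2 / 2 * z ^+ 2.
have dk u : hasd kk u (derive1 h u - h1 - h2 * u).
  apply: hasd_eq (hasdB (hasdB (dh u) (hasdMl h1 (hasd_id u)))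
    (hasdMl (h2 / 2) (hasdX 1 (hasd_id u)))) _.
  by rewrite expr1; field.
have kk0 : kk 0 = 0 by rewrite /kk h0; ring.
have := @ray_MVT _ kk (fun u => derive1 h u - h1 - h2 * u) w (e * N w) (hasd_cts (dk 0))
   (fun u _ _ => dk u).
rewrite kk0 subr0 => H.
have {}H : N (kk w) <= e * N w * N w.
  apply: H => u u0 uw; have := hk u; rewrite subr0 => /(_ (le_lt_trans uw _)).
  move: wk; rewrite subr0 => -> /(_ isT) /le_trans; apply.
  by rewrite ler_wpM2l// ltW.
rewrite subr0 /q eqxx; case: eqVneq => [->|w0].
  by rewrite subrr mulr0 subr0 normc0 mulr0.
have -> : h w / w - h1 - h2 / 2 * w = kk w / w by rewrite /kk; field.
by rewrite normcM normcV ler_pdivrMr ?normc_gt0.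
Qed.

Lemma cts_bound_eq0 h (K r : R) n : cts h 0 -> 0 < r ->
  (forall u, u != 0 -> N u < r -> N (h u) <= K * N u ^+ n.+1) -> h 0 = 0.
Proof.
move=> ch r0 hK; apply: eq0_normc; apply/eqP; rewrite eq_le normc_ge0 andbT.
rewrite leNgt; apply/negP => H.
have H3 : 0 < N (h 0) / 3 by rewrite divr_gt0.
have [k k0 hk] := ch _ H3.
have K1 : 0 < `|K| + 1 by rewrite ltr_wpDl.
pose t := Num.min (Num.min (k / 2) (r / 2)) (Num.min 1 (N (h 0) / 3 / (`|K| + 1))).
have t0 : 0 < t by rewrite !lt_min ltr01 !divr_gt0.
have [tk tr t1 tK] : [/\ t <= k / 2, t <= r / 2, t <= 1 & t <= N (h 0) / 3 / (`|K| + 1)].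
  by rewrite /t !ge_min !lexx !orbT.
have Nt : N t%:C = t by rewrite normc_real gtr0_norm.
have tn0 : t%:C != 0 by rewrite -normc_gt0 Nt.
have A : N (h t%:C - h 0) <= N (h 0) / 3 by apply: hk; rewrite subr0 Nt; lra.
have B : N (h t%:C) <= K * t ^+ n.+1 by rewrite -{2}Nt; apply: hK; rewrite ?Nt//; lra.
have : K * t ^+ n.+1 <= N (h 0) / 3.
  apply: (@le_trans _ _ ((`|K| + 1) * t)); last by rewrite mulrC -ler_pdivlMr.
  apply: (@le_trans _ _ (`|K| * t ^+ n.+1)).
    by rewrite ler_wpM2r ?exprn_ge0 ?(ltW t0)// ler_norm.
  rewrite ler_pM ?exprn_ge0 ?(ltW t0)//; first by rewrite lerDl.
  by rewrite exprS ler_piMr ?(ltW t0)// exprn_ile1// ltW.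
have := normcB_ge (h 0) (h t%:C); rewrite normc_distC.
lra.
Qed.

(** One step of dividing u out of an O(u^(n+1)) function. Five steps turn the condition sig(u) - u =
    O(u^5) into a factor u^5. *)
Lemma entire_div_id_bound h (K r : R) n : (forall z, derivable h z 1) -> 0 < r ->
  (forall u, u != 0 -> N u < r -> N (h u) <= K * N u ^+ n.+1) ->
  exists q : C -> C, [/\ (forall z, derivable q z 1), (forall z, h z = z * q z) &
    forall u, u != 0 -> N u < r -> N (q u) <= K * N u ^+ n].
Proof.
move=> hh r0 hK.
have h0 := cts_bound_eq0 (hasd_cts (derivable_hasd (hh 0))) r0 hK.
have [q hq qE] := entire_div_id hh h0; exists q; split=> // u u0 ur.
have Nu : 0 < N u by rewrite normc_gt0.
by have := hK u u0 ur; rewrite qE normcM exprS mulrCA ler_pM2l.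
Qed.

(** On a small disc the differences are at most 1. Integrating the Lipschitz bound along rays halves
    this bound, so iteration forces both differences to vanish. *)
Lemma ode_unique (a b c d a' b' c' d' : C -> C) (r K : R) : 0 < r ->
  cts a 0 -> cts b 0 -> cts c 0 -> cts d 0 -> a 0 = c 0 -> b 0 = d 0 ->
  (forall z, z != 0 -> N z < r -> [/\ hasd a z (a' z), hasd b z (b' z),
     hasd c z (c' z) & hasd d z (d' z)]) ->
  (forall z, z != 0 -> N z < r ->
     N (a' z - c' z) <= K * (N (a z - c z) + N (b z - d z)) /\
     N (b' z - d' z) <= K * (N (a z - c z) + N (b z - d z))) ->
  exists2 r' : R, 0 < r' & forall z, N z < r' -> a z = c z /\ b z = d z.
Proof.
move=> r0 ca cb cc cd ac bd hd hK.
have ctsB f g : cts f 0 -> cts g 0 -> cts (fun z => f z - g z) 0.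
  move=> cf cg; apply: (@cts_ext _ (fun z => f z + -1 * g z) _ _ 1) => //.
    by move=> w _; rewrite mulN1r.
  by apply: ctsD => //; apply: ctsM => //; exact: cts_cst.
pose X z := a z - c z; pose Y z := b z - d z.
have X0 : X 0 = 0 by rewrite /X ac subrr.
have Y0 : Y 0 = 0 by rewrite /Y bd subrr.
have cX : cts X 0 by exact: ctsB.
have cY : cts Y 0 by exact: ctsB.
have [k1 k10 h1] := cX 1 ltr01; have [k2 k20 h2] := cY 1 ltr01.
have K1 : 0 < 4 * (`|K| + 1) by rewrite mulr_gt0// ltr_wpDl.
(* The last radius makes |K| * 2 * 2^-n * |z| at most 2^-(n+1), which is the halving; [k1] and [k2]
   start the induction. *)
pose p := Num.min (Num.min k1 k2) (Num.min r (4 * (`|K| + 1))^-1).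
have p0 : 0 < p by rewrite !lt_min k10 k20 r0 invr_gt0.
have [pk1 pk2 pr pK] : [/\ p <= k1, p <= k2, p <= r & p <= (4 * (`|K| + 1))^-1].
  by rewrite /p !ge_min !lexx !orbT.
have main n z : N z < p -> N (X z) <= (2 ^+ n)^-1 /\ N (Y z) <= (2 ^+ n)^-1.
  elim: n z => [|n IH] z zp.
    rewrite expr0 invr1; have := h1 z; have := h2 z.
    by rewrite X0 Y0 !subr0 => B A; split; [apply: A|apply: B]; exact: lt_le_trans zp _.
  pose e : R := (2 ^+ n)^-1; have e0 : 0 < e by rewrite invr_gt0 exprn_gt0.
  have Kb w : w != 0 -> N w <= N z ->
      N (a' w - c' w) <= `|K| * (2 * e) /\ N (b' w - d' w) <= `|K| * (2 * e).
    move=> w0 wz; have wp := le_lt_trans wz zp.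
    have [A B] := hK w w0 (lt_le_trans wp pr); have [XA YB] := IH w wp.
    have S : K * (N (a w - c w) + N (b w - d w)) <= `|K| * (2 * e).
      apply: (@le_trans _ _ (`|K| * (N (X w) + N (Y w)))).
        by rewrite ler_wpM2r ?addr_ge0 ?normc_ge0// ler_norm.
      by rewrite ler_wpM2l// /e; lra.
    by split; [exact: le_trans S|exact: le_trans S].
  have fin : `|K| * (2 * e) * N z <= (2 ^+ n.+1)^-1.
    apply: (@le_trans _ _ ((`|K| + 1) * (2 * e) * (4 * (`|K| + 1))^-1)).
      apply: ler_pM; rewrite ?mulr_ge0 ?normc_ge0 ?(ltW e0)//.
        by rewrite ler_wpM2r ?lerDl// mulr_ge0// ltW.
      exact: le_trans (ltW zp) pK.
    rewrite le_eqVlt; apply/orP; left; apply/eqP; rewrite /e exprS; field.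
    by rewrite expf_neq0//= gt_eqF// ltr_wpDl.
  have RM f f' : cts f 0 -> f 0 = 0 ->
      (forall w, w != 0 -> N w < r -> hasd f w (f' w)) ->
      (forall w, w != 0 -> N w <= N z -> N (f' w) <= `|K| * (2 * e)) ->
      N (f z) <= (2 ^+ n.+1)^-1.
    move=> cf f0 hf hb; apply: le_trans fin.
    rewrite -[f z]subr0 -f0; apply: (@ray_MVT _ f f') => // w w0 wz.
    by apply: hf => //; apply: le_lt_trans wz (lt_le_trans zp pr).
  split.
    apply: (RM X (fun w => a' w - c' w)) => // w w0 wz; last by case: (Kb w w0 wz).
    by have [? ? ? ?] := hd w w0 wz; exact: hasdB.
  apply: (RM Y (fun w => b' w - d' w)) => // w w0 wz; last by case: (Kb w w0 wz).
  by have [? ? ? ?] := hd w w0 wz; exact: hasdB.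
exists p => // z zp.
have Z (x : C) : (forall n, N x <= (2 ^+ n)^-1) -> x = 0.
  move=> hx; apply: eq0_normc; apply/eqP; rewrite eq_le normc_ge0 andbT.
  rewrite leNgt; apply/negP => Nx; have [n] := halving_small ler01 Nx.
  by rewrite div1r ltNge hx.
by split; apply/eqP; rewrite -subr_eq0; apply/eqP; apply: Z => n; case: (main n z zp).
Qed.

(** The general quadratic polynomial in two variables. Both systems of the proof have this form: the
    one for the Tate coordinates and y'' = 6 y^2 - g2/2 written as a first order system. *)
Definition quad (c0 c1 c2 c3 c4 c5 t s : C) : C :=
  c0 + c1 * t + c2 * s + c3 * t ^+ 2 + c4 * t * s + c5 * s ^+ 2.

Lemma quad_lipschitz c0 c1 c2 c3 c4 c5 (B : R) : 0 <= B -> exists K : R,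
  forall t s t' s' : C, N t <= B -> N s <= B -> N t' <= B -> N s' <= B ->
  N (quad c0 c1 c2 c3 c4 c5 t s - quad c0 c1 c2 c3 c4 c5 t' s') <=
  K * (N (t - t') + N (s - s')).
Proof.
move=> B0.
exists (N c1 + N c2 + 2 * B * N c3 + 2 * B * N c4 + 2 * B * N c5).
move=> t s t' s' ht hs ht' hs'.
have -> : quad c0 c1 c2 c3 c4 c5 t s - quad c0 c1 c2 c3 c4 c5 t' s' =
  (c1 + c3 * (t + t') + c4 * s) * (t - t') + (c2 + c4 * t' + c5 * (s + s')) * (s - s').
  by rewrite /quad; ring.
apply: (le_trans (normcD _ _)); rewrite [leRHS]mulrDr; apply: lerD; rewrite normcM ler_wpM2r ?normc_ge0//.
  apply: (le_trans (normcD _ _)); apply: (le_trans (lerD (normcD _ _) (lexx _))).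
  rewrite 2!normcM.
  have A : N c3 * N (t + t') <= N c3 * (2 * B).
    by rewrite ler_wpM2l ?normc_ge0// (le_trans (normcD _ _))//; lra.
  have D : N c4 * N s <= N c4 * B by rewrite ler_wpM2l ?normc_ge0.
  have E : 0 <= B * N c4 by rewrite mulr_ge0 ?normc_ge0.
  have F : 0 <= B * N c5 by rewrite mulr_ge0 ?normc_ge0.
  have G := normc_ge0 c2.
  lra.
apply: (le_trans (normcD _ _)); apply: (le_trans (lerD (normcD _ _) (lexx _))).
rewrite 2!normcM.
have A : N c5 * N (s + s') <= N c5 * (2 * B).
  by rewrite ler_wpM2l ?normc_ge0// (le_trans (normcD _ _))//; lra.
have D : N c4 * N t' <= N c4 * B by rewrite ler_wpM2l ?normc_ge0.
have E : 0 <= B * N c4 by rewrite mulr_ge0 ?normc_ge0.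
have F : 0 <= B * N c3 by rewrite mulr_ge0 ?normc_ge0.
have G := normc_ge0 c1.
lra.
Qed.

(** Quadratic right-hand sides have a Lipschitz constant on bounded sets, so continuity at 0 is
    first used to bound all four functions by [B]. *)
Lemma quad_ode_unique (p0 p1 p2 p3 p4 p5 q0 q1 q2 q3 q4 q5 : C)
    (a b c d : C -> C) (r : R) : 0 < r ->
  cts a 0 -> cts b 0 -> cts c 0 -> cts d 0 -> a 0 = c 0 -> b 0 = d 0 ->
  (forall z, z != 0 -> N z < r ->
    [/\ hasd a z (quad p0 p1 p2 p3 p4 p5 (a z) (b z)),
        hasd b z (quad q0 q1 q2 q3 q4 q5 (a z) (b z)),
        hasd c z (quad p0 p1 p2 p3 p4 p5 (c z) (d z)) &
        hasd d z (quad q0 q1 q2 q3 q4 q5 (c z) (d z))]) ->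
  exists2 r' : R, 0 < r' & forall z, N z < r' -> a z = c z /\ b z = d z.
Proof.
move=> r0 ca cb cc cd ac bd hd.
pose B := N (a 0) + N (b 0) + 1.
have [A0 B0] : 0 <= N (a 0) /\ 0 <= N (b 0) by rewrite !normc_ge0.
have B00 : 0 <= B by rewrite /B; lra.
have bnd f : cts f 0 -> N (f 0) <= N (a 0) + N (b 0) ->
    exists2 k : R, 0 < k & forall z, N z < k -> N (f z) <= B.
  move=> cf f0; have [k k0 hk] := cf 1 ltr01; exists k => // z zk.
  have := hk z; rewrite subr0 => /(_ zk) h.
  by have := normcD (f z - f 0) (f 0); rewrite subrK /B; lra.
have [ka ka0 ha] := bnd a ca ltac:(lra); have [kb kb0 hb] := bnd b cb ltac:(lra).
have [kc kc0 hc] : exists2 k : R, 0 < k & forall z, N z < k -> N (c z) <= B.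
  by apply: bnd => //; rewrite -ac; lra.
have [kd kd0 hdd] : exists2 k : R, 0 < k & forall z, N z < k -> N (d z) <= B.
  by apply: bnd => //; rewrite -bd; lra.
have [K1 hK1] := quad_lipschitz p0 p1 p2 p3 p4 p5 B00.
have [K2 hK2] := quad_lipschitz q0 q1 q2 q3 q4 q5 B00.
pose r' := Num.min r (Num.min (Num.min ka kb) (Num.min kc kd)).
have r'0 : 0 < r' by rewrite !lt_min r0 ka0 kb0 kc0 kd0.
apply: (@ode_unique a b c d _ _ _ _ r' (Num.max K1 K2) r'0 ca cb cc cd ac bd).
  by move=> z z0; rewrite lt_min => /andP[zr _]; exact: hd.
move=> z z0; rewrite !lt_min => /andP[zr /andP[/andP[/ha za /hb zb] /andP[/hc zc /hdd zd]]].
split.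
  apply: (le_trans (hK1 _ _ _ _ za zb zc zd)).
  by rewrite ler_wpM2r ?addr_ge0 ?normc_ge0// le_max lexx.
apply: (le_trans (hK2 _ _ _ _ za zb zc zd)).
by rewrite ler_wpM2r ?addr_ge0 ?normc_ge0// le_max lexx orbT.
Qed.

End Ode.

(** * The complex exponential and branches of the logarithm *)

Section Exp.
Variable R : realType.
Local Notation C := (R[i]).
Local Notation N := (@normc R).
Local Notation Re := (@complex.Re R).
Local Notation Im := (@complex.Im R).
Implicit Types (f g h L : C -> C) (z u w : C).

(** A form of the exponential whose addition law and derivative follow from the real functions. It
    is identified with the series [expC] only on a disc around 0, which is enough for a statement
    near 0. *)
Definition cexp z : C := (expR (Re z) * cos (Im z)) +i* (expR (Re z) * sin (Im z)).

Lemma cexpD z w : cexp (z + w) = cexp z * cexp w.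
Proof.
case: z w => [a b] [c d]; rewrite /cexp /= expRD cosD sinD.
by apply/eqP; rewrite eq_complex /=; apply/andP; split; apply/eqP; ring.
Qed.

Lemma cexp0 : cexp 0 = 1.
Proof. by rewrite /cexp /= expR0 cos0 sin0 mulr1 mulr0. Qed.

Lemma cexp_neq0 z : cexp z != 0.
Proof.
apply/eqP => z0; have := cexpD z (- z); rewrite z0 mul0r subrr cexp0.
by move/eqP; rewrite oner_eq0.
Qed.

Lemma cexpN z : cexp (- z) = (cexp z)^-1.
Proof.
by apply: (mulfI (cexp_neq0 z)); rewrite mulfV ?cexp_neq0// -cexpD subrr cexp0.
Qed.

Lemma cexp_norm z : N (cexp z) = expR (Re z).
Proof.
rewrite /cexp /= !exprMn -mulrDr cos2Dsin2 mulr1 sqrtr_sqr.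
by rewrite ger0_norm// expR_ge0.
Qed.

Lemma cexp_hasd0 : hasd cexp 0 1.
Proof.
(* The real part of the remainder contributes 3 * e1 and the imaginary part 4 * e1. *)
move=> e e0; pose e1 := Num.min 1 (e / 7).
have e10 : 0 < e1 by rewrite lt_min ltr01 divr_gt0.
have e1e : e1 <= e / 7 by rewrite /e1 ge_min lexx orbT.
have e11 : e1 <= 1 by rewrite /e1 ge_min lexx.
have d1 : is_derive (0 : R) 1 (@expR R) 1.
  by apply: is_derive_eq (is_derive_expR 0) _; rewrite expR0.
have d2 : is_derive (0 : R) 1 (@cos R) 0.
  by apply: is_derive_eq (is_derive_cos 0) _; rewrite sin0 oppr0.
have d3 : is_derive (0 : R) 1 (@sin R) 1.
  by apply: is_derive_eq (is_derive_sin 0) _; rewrite cos0.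
have /is_derive_epsP/(_ _ e10)[k1 k10 h1] := d1.
have /is_derive_epsP/(_ _ e10)[k2 k20 h2] := d2.
have /is_derive_epsP/(_ _ e10)[k3 k30 h3] := d3.
exists (Num.min (Num.min k1 k2) (Num.min k3 (e1 / 2))).
  by rewrite !lt_min k10 k20 k30 divr_gt0.
move=> w; rewrite subr0 cexp0 mul1r !lt_min.
move=> /andP[/andP[w1 w2] /andP[w3 w4]].
have Na := normc_Re w; have Nb := normc_Im w.
have := h1 (Re w); have := h2 (Im w); have := h3 (Im w).
rewrite !subr0 sin0 cos0 expR0 subr0 mulr0 subr0 !mulr1.
move=> /(_ (le_lt_trans Nb w3)) C3 /(_ (le_lt_trans Nb w2)) C2 /(_ (le_lt_trans Na w1)) C1.
apply: (le_trans (normc_ReIm _)).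
have -> : Re (cexp w - 1 - w) = expR (Re w) * (cos (Im w) - 1) + (expR (Re w) - 1 - Re w).
  by case: w {w1 w2 w3 w4 Na Nb C1 C2 C3} => a b /=; ring.
have -> : Im (cexp w - 1 - w) = expR (Re w) * (sin (Im w) - Im w) + (expR (Re w) - 1) * Im w.
  by case: w {w1 w2 w3 w4 Na Nb C1 C2 C3} => a b /=; ring.
have A0 : 0 <= `|Re w| by []. have B0 : 0 <= `|Im w| by [].
have E1 : `|expR (Re w) - 1| <= 2 * `|Re w|.
  have := ler_normD (expR (Re w) - 1 - Re w) (Re w); rewrite subrK => /le_trans; apply.
  suff : e1 * `|Re w| <= 1 * `|Re w| by lra.
  by rewrite ler_wpM2r.
have E2 : expR (Re w) <= 2 by have := ler_norm (expR (Re w) - 1); lra.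
have E0 := expR_ge0 (Re w).
have T1 : `|expR (Re w) * (cos (Im w) - 1) + (expR (Re w) - 1 - Re w)| <= 3 * e1 * N w.
  apply: (le_trans (ler_normD _ _)); rewrite normrM (ger0_norm E0).
  have : expR (Re w) * `|cos (Im w) - 1| <= 2 * (e1 * N w).
    rewrite ler_pM//; apply: (le_trans C2); rewrite ler_wpM2l//; exact: ltW.
  have : e1 * `|Re w| <= e1 * N w by rewrite ler_wpM2l//; exact: ltW.
  lra.
have P0 : 0 <= e1 * N w by rewrite mulr_ge0 ?normc_ge0//; exact: ltW.
have T2 : `|expR (Re w) * (sin (Im w) - Im w) + (expR (Re w) - 1) * Im w| <= 4 * e1 * N w.
  apply: (le_trans (ler_normD _ _)); rewrite !normrM (ger0_norm E0).
  have : expR (Re w) * `|sin (Im w) - Im w| <= 2 * (e1 * N w).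
    rewrite ler_pM//; apply: (le_trans C3); rewrite ler_wpM2l//; exact: ltW.
  have : `|expR (Re w) - 1| * `|Im w| <= e1 * N w.
    by rewrite ler_pM//; lra.
  lra.
have : e1 * N w <= e / 7 * N w by rewrite ler_wpM2r ?normc_ge0.
lra.
Qed.

Lemma cexp_hasd z : hasd cexp z (cexp z).
Proof.
have E w : cexp z * cexp (w - z) = cexp w by rewrite -cexpD addrC subrK.
apply: (@hasd_ext _ (fun w => cexp z * cexp (w - z)) _ _ _ 1) => //.
have h0 : hasd cexp (z - z) 1 by rewrite subrr; exact: cexp_hasd0.
apply: hasd_eq (hasdMl (cexp z) (hasd_comp (hasdB (hasd_id z) (hasd_cst z z)) h0)) _.
by rewrite subr0 !mulr1.
Qed.

Let S n z := series (fun n => z ^+ n / n`!%:R) n : C.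

Lemma exp_series_hasd n z : hasd (S n.+1) z (S n z).
Proof.
have SE m w : S m.+1 w = S m w + w ^+ m / m`!%:R.
  by rewrite /S /series /= big_nat_recr.
elim: n => [|n IH].
  apply: (@hasd_ext _ (fun=> 1) _ _ _ 1) => //.
    by move=> w _; rewrite SE /S /series /= big_geq// add0r expr0 fact0 divr1.
  have -> : S 0 z = 0 by rewrite /S /series /= big_geq.
  exact: hasd_cst.
apply: (@hasd_ext _ (fun w => S n.+1 w + w ^+ n.+1 / (n.+1)`!%:R) _ _ _ 1) => //.
apply: hasd_eq (hasdD IH (hasdMr _ (hasdX n (hasd_id z)))) _.
rewrite SE mulr1 factS natrM invfM; congr (_ + _).
have n0 : n.+1%:R != 0 :> C by rewrite pnatr_eq0.
have f0 : n`!%:R != 0 :> C by rewrite pnatr_eq0 -lt0n fact_gt0.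
by move: (n.+1%:R : C) (n`!%:R : C) n0 f0 => x y x0 y0; field; rewrite x0 y0.
Qed.

(** The derivative of a remainder is the previous remainder, so the mean value inequality gains a
    factor |z| at each step. The factorial is lost, but the decay is geometric for |z| <= 1/2. *)
Lemma exp_series_rem n z : N z <= 1 -> N (cexp z - S n z) <= expR 1 * N z ^+ n.
Proof.
elim: n z => [|n IH] z z1.
  rewrite /S /series /= big_geq// subr0 expr0 mulr1 cexp_norm ler_expR.
  exact: le_trans (ler_norm _) (le_trans (normc_Re _) z1).
have d w : hasd (fun w => cexp w - S n.+1 w) w (cexp w - S n w).
  by apply: hasdB; [exact: cexp_hasd|exact: exp_series_hasd].
have S0 : S n.+1 0 = 1.
  rewrite /S /series /= big_nat_recl// expr0 fact0 divr1 big1 ?addr0// => i _.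
  by rewrite expr0n mul0r.
have := @ray_MVT _ (fun w => cexp w - S n.+1 w) (fun w => cexp w - S n w) z
  (expR 1 * N z ^+ n) (hasd_cts (d 0)) (fun w _ _ => d w).
rewrite cexp0 S0 subrr subr0 exprSr mulrA; apply => w w0 wz.
apply: le_trans (IH w (le_trans wz z1)) _.
by rewrite ler_wpM2l ?expR_ge0// lerXn2r ?nnegrE ?normc_ge0.
Qed.

Lemma expCE z : N z <= 2^-1 -> expC z = cexp z.
Proof.
move=> z2; apply/cvg_lim => //.
apply/(@cvg_normcP _ _ \oo _ (fun n => S n z)) => e e0.
have s0 : 0 <= expR 1 :> R by exact: expR_ge0.
have [n hn] := halving_small s0 e0.
exists n => // m /= nm; rewrite normc_distC.
have z1 : N z <= 1 by lra.
apply: le_trans (exp_series_rem m z1) _; apply: le_trans (ltW hn).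
rewrite ler_wpM2l//; apply: (@le_trans _ _ (2^-1 ^+ m)).
  by rewrite lerXn2r ?nnegrE ?normc_ge0 ?invr_ge0.
by rewrite exprVn lef_pV2 ?posrE ?exprn_gt0// ler_eXn2l// ltr1n.
Qed.

(** Continuity makes k = L w - L u small, so k is close to cexp k - 1 = g w / g u - 1, and the
    derivative of the latter is known. *)
Lemma log_branch_hasd g L u d (r : R) : 0 < r -> cts L u ->
  (forall w, N (w - u) < r -> cexp (L w) = g w) -> hasd g u d ->
  hasd L u (d / g u).
Proof.
move=> r0 cL Lg hg e e0.
have gu : g u = cexp (L u) by rewrite Lg// subrr normc0.
have g0 : g u != 0 by rewrite gu cexp_neq0.
pose c := d / g u; pose M := N c + 1.
have Nc := normc_ge0 c; have M0 : 0 < M by rewrite /M; lra.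
(* The value 1/2 gives |k| <= 2 |D|; the other bound absorbs the factor 2 * M in |k| <= 2 * M * |w -
   u|. *)
pose e1 := Num.min 2^-1 (e / (4 * M)).
have e10 : 0 < e1 by rewrite lt_min invr_gt0 ltr0n divr_gt0// mulr_gt0.
have e12 : e1 <= 2^-1 by rewrite /e1 ge_min lexx.
have e1M : e1 <= e / (4 * M) by rewrite /e1 ge_min lexx orbT.
have heta : hasd (fun w => g w / g u) u c by exact: hasdMr.
pose e2 := Num.min 1 (e / 2).
have e20 : 0 < e2 by rewrite lt_min ltr01 divr_gt0.
have e21 : e2 <= 1 by rewrite /e2 ge_min lexx.
have e22 : e2 <= e / 2 by rewrite /e2 ge_min lexx orbT.
have [k1 k10 h1] := cexp_hasd0 e10.
have k120 : 0 < k1 / 2 by rewrite divr_gt0.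
have [k2 k20 h2] := cL _ k120.
have [k3 k30 h3] := heta _ e20.
exists (Num.min r (Num.min k2 k3)); first by rewrite !lt_min r0 k20 k30.
move=> w; rewrite !lt_min => /andP[wr /andP[wk2 wk3]].
have := h2 w wk2; have := h3 w wk3; rewrite divff// -/c.
set k := L w - L u; set D := g w / g u - 1 => D1 kk.
have DE : D = cexp k - 1.
  by rewrite /D /k cexpD cexpN -gu Lg.
have kk1 : N (k - 0) < k1 by rewrite subr0; lra.
have := h1 k kk1; rewrite subr0 cexp0 mul1r -DE => Dk.
have Nk := normc_ge0 k.
have e1k : e1 * N k <= 2^-1 * N k by rewrite ler_wpM2r.
have kD : N k <= 2 * N D.
  have := normcB_ge k D; rewrite normc_distC; lra.
have Nw := normc_ge0 (w - u).
have DM : N D <= M * N (w - u).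
  have := normcD (D - c * (w - u)) (c * (w - u)); rewrite subrK normcM /M.
  have : e2 * N (w - u) <= 1 * N (w - u) by rewrite ler_wpM2r.
  lra.
have -> : k - c * (w - u) = - (D - k) + (D - c * (w - u)) by ring.
apply: (le_trans (normcD _ _)); rewrite normc_opp.
have : e1 * N k <= e / 2 * N (w - u).
  apply: (@le_trans _ _ (e / (4 * M) * (2 * (M * N (w - u))))).
    apply: ler_pM => //; first exact: ltW.
    lra.
  rewrite le_eqVlt; apply/orP; left; apply/eqP; field.
  by rewrite gt_eqF.
have : e2 * N (w - u) <= e / 2 * N (w - u) by rewrite ler_wpM2r.
lra.
Qed.

End Exp.

(* A package of facts about zeta, wp and wp' in which these functions are opaque: unfolding
   their definitions as limits makes conversion intractable. *)
Record weierstrass_functions (R : realType) (g2 g3 : R[i]) (sig zeta p p' : R[i] -> R[i]) : Prop :=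
  WeierstrassFunctions {
  wf_zeta : forall z, sig z != 0 -> hasd zeta z (- p z);
  wf_p : forall z, sig z != 0 -> hasd p z (p' z);
  wf_p' : forall z, sig z != 0 -> p' z != 0 -> hasd p' z (6 * p z ^+ 2 - g2 / 2);
  wf_p'_cts : forall z, sig z != 0 -> cts p' z;
  wf_ode : forall z, sig z != 0 -> p' z ^+ 2 = 4 * p z ^+ 3 - g2 * p z - g3;
  wf_sigN : forall z, sig (- z) = - sig z;
  wf_zetaN : forall z, zeta (- z) = - zeta z;
  wf_pN : forall z, sig z != 0 -> p (- z) = p z;
  wf_p'N : forall z, sig z != 0 -> p' (- z) = - p' z;
  wf_near : forall z, sig z != 0 ->
    exists2 k : R, 0 < k & forall w, normc (w - z) < k -> sig w != 0;
  wf_at0 : exists n n1 n2 : R[i] -> R[i], [/\ cts n 0, cts n1 0, cts n2 0 &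
    exists2 r : R, 0 < r & forall u, u != 0 -> normc u < r ->
    [/\ sig u != 0, zeta u = u^-1 + u ^+ 3 * n u, p u = (u ^+ 2)^-1 - u ^+ 2 * n1 u &
        p' u = - 2 / u ^+ 3 - u * n2 u]] }.

(** * Regularity, parity and expansions at 0 of the Weierstrass functions *)

Section Sigma.
Variable R : realType.
Local Notation C := (R[i]).
Local Notation N := (@normc R).
Implicit Types (f g h A : C -> C) (z u w : C).

Definition entire h := forall z, derivable h z 1.

Lemma entire_hasd h : entire h -> forall z, hasd h z (derive1 h z).
Proof. by move=> eh z; exact: derivable_hasd. Qed.

Lemma entire_cst c : entire (fun=> c).
Proof. by move=> z; exact: hasd_derivable (hasd_cst c z). Qed.

Lemma entire_id : entire (fun z => z).
Proof. by move=> z; exact: hasd_derivable (hasd_id z). Qed.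

Lemma entireD f g : entire f -> entire g -> entire (fun z => f z + g z).
Proof.
by move=> ef eg z; exact: hasd_derivable (hasdD (entire_hasd ef z) (entire_hasd eg z)).
Qed.

Lemma entireB f g : entire f -> entire g -> entire (fun z => f z - g z).
Proof.
by move=> ef eg z; exact: hasd_derivable (hasdB (entire_hasd ef z) (entire_hasd eg z)).
Qed.

Lemma entireM f g : entire f -> entire g -> entire (fun z => f z * g z).
Proof.
by move=> ef eg z; exact: hasd_derivable (hasdM (entire_hasd ef z) (entire_hasd eg z)).
Qed.

Lemma entireX f n : entire f -> entire (fun z => f z ^+ n).
Proof.
move=> ef; case: n => [|n] z.
  by under eq_fun do rewrite expr0; exact: hasd_derivable (hasd_cst 1 z).
exact: hasd_derivable (hasdX n (entire_hasd ef z)).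
Qed.

Lemma entire_cts h z : entire h -> cts h z.
Proof. by move=> /entire_hasd eh; exact: hasd_cts (eh z). Qed.

(** A class closed under differentiation: zeta, p and p' belong to it for h = sig, and thereby have
    derivatives of all orders off the zeros of sig. *)
Definition quot_form h f := exists A n, entire A /\ forall z, h z != 0 -> f z = A z / h z ^+ n.+1.

Lemma quot_form_derive h f : entire h -> quot_form h f ->
  (forall z, h z != 0 -> hasd f z (derive1 f z)) /\ quot_form h (derive1 f).
Proof.
move=> eh [A [n [eA fE]]].
pose A1 z := derive1 A z * h z ^+ n.+1 - A z * (n.+1%:R * h z ^+ n * derive1 h z).
have hf z : h z != 0 -> hasd f z (A1 z / (h z ^+ n.+1) ^+ 2).
  move=> hz; have hzn : h z ^+ n.+1 != 0 by rewrite expf_neq0.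
  have [k k0 hk] := cts_neq0 (entire_cts z eh) hz.
  apply: (@hasd_ext _ (fun w => A w / h w ^+ n.+1) _ _ _ k k0).
    by move=> w wk; rewrite fE// hk.
  exact: (@hasd_div _ A (fun w => h w ^+ n.+1) z _ _ hzn (entire_hasd eA z)
    (hasdX n (entire_hasd eh z))).
split=> [z hz|]; first by rewrite (hasd_derive1 (hf z hz)); exact: hf.
(* The successor of this index is twice n + 1, the exponent in the squared denominator of the
   quotient rule. *)
exists A1, (n.+1 * 2).-1; split; last first.
  by move=> z hz; rewrite (hasd_derive1 (hf z hz)) -exprM prednK// muln_gt0.
have e1 : entire (fun z => derive1 A z * h z ^+ n.+1).
  exact (entireM (entire_derive eA) (@entireX _ n.+1 eh)).
have e2 : entire (fun z => n.+1%:R * h z ^+ n).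
  exact (entireM (@entire_cst n.+1%:R) (@entireX _ n eh)).
have e3 : entire (fun z => A z * (n.+1%:R * h z ^+ n * derive1 h z)).
  exact (entireM eA (entireM e2 (entire_derive eh))).
exact (entireB e1 e3).
Qed.

Lemma quot_form_opp h f : quot_form h f -> quot_form h (fun z => - f z).
Proof.
move=> [A [n [eA fE]]]; exists (fun z => - A z), n; split; last first.
  by move=> z hz; rewrite fE// mulNr.
move=> z; exact: hasd_derivable (hasdN (entire_hasd eA z)).
Qed.

Lemma derive1_parity f z d (c : C) : (forall w, f w = c * f (- w)) -> hasd f z d ->
  hasd f (- z) (- c * d).
Proof.
move=> fE; rewrite -{1}(opprK z) => h.
apply: (@hasd_ext _ (fun w => c * f (- w)) _ _ _ 1) => //.
apply: hasd_eq (hasdMl c (hasd_comp (hasdN (hasd_id (- z))) h)) _.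
by ring.
Qed.

Variables (g2 g3 : C) (sig : C -> C).
Hypothesis hs : is_weierstrass_sigma g2 g3 sig.
Local Notation p := (wp sig).
Local Notation p' := (wp' sig).
Local Notation zeta := (wzeta sig).

Lemma sig_entire : entire sig. Proof. by case: hs. Qed.

Lemma sigN z : sig (- z) = - sig z. Proof. by case: hs. Qed.

Lemma sigN_neq0 z : sig z != 0 -> sig (- z) != 0.
Proof. by rewrite sigN oppr_eq0. Qed.

Lemma wzeta_quot : quot_form sig zeta.
Proof.
exists (derive1 sig), 0%N; split; first exact: entire_derive sig_entire.
by move=> z _; rewrite expr1.
Qed.

Lemma wp_quot : quot_form sig p.
Proof.
have [_ h] := quot_form_derive sig_entire wzeta_quot.
exact: quot_form_opp h.
Qed.

Lemma wp'_quot : quot_form sig p'.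
Proof. by have [] := quot_form_derive sig_entire wp_quot. Qed.

Lemma wzeta_hasd z : sig z != 0 -> hasd zeta z (- p z).
Proof.
have [h _] := quot_form_derive sig_entire wzeta_quot => /h.
by rewrite /wp opprK.
Qed.

Lemma wp_hasd z : sig z != 0 -> hasd p z (p' z).
Proof. by have [h _] := quot_form_derive sig_entire wp_quot; exact: h. Qed.

Lemma sig_neq0_near z : sig z != 0 ->
  exists2 k : R, 0 < k & forall w, N (w - z) < k -> sig w != 0.
Proof. by apply: cts_neq0; exact: entire_cts sig_entire. Qed.

(** Differentiating the Weierstrass equation gives 2 p' (p'' - 6 p^2 + g2/2) = 0, from which p' is
    cancelled. *)
Lemma wp'_hasd z : sig z != 0 -> p' z != 0 -> hasd p' z (6 * p z ^+ 2 - g2 / 2).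
Proof.
move=> sz pz.
have [h _] := quot_form_derive sig_entire wp'_quot.
have hp' := h z sz; have hp := wp_hasd sz.
have [k k0 hk] := sig_neq0_near sz.
have H := hasdB (hasdX 1 hp') (hasdB (hasdB (hasdMl 4 (hasdX 2 hp)) (hasdMl g2 hp)) (hasd_cst g3 z)).
have H0 := hasd_cst 0 z.
have : hasd (fun w => p' w ^+ 2 - (4 * p w ^+ 3 - g2 * p w - g3)) z 0.
  apply: hasd_ext k0 _ H0 => w /hk sw.
  by case: hs => _ _ _ -> //; rewrite subrr.
move=> /(hasd_unique H) E.
apply: hasd_eq hp' _; set d := derive1 _ _ in E *.
have : 2 * p' z * (d - (6 * p z ^+ 2 - g2 / 2)) = 0.
  by rewrite -[RHS]E; field.
by move/eqP; rewrite !mulf_eq0 pnatr_eq0 (negbTE pz) /= subr_eq0 => /eqP.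
Qed.

Lemma derive1_sigN z : derive1 sig (- z) = derive1 sig z.
Proof.
have h : forall w, sig w = -1 * sig (- w) by move=> w; rewrite sigN mulrNN mul1r.
rewrite (hasd_derive1 (derive1_parity h (entire_hasd sig_entire z))).
by rewrite opprK mul1r.
Qed.

Lemma wzetaN z : zeta (- z) = - zeta z.
Proof. by rewrite /wzeta derive1_sigN sigN invrN mulrN. Qed.

Lemma wpN z : sig z != 0 -> p (- z) = p z.
Proof.
move=> sz; have h : forall w, zeta w = -1 * zeta (- w).
  by move=> w; rewrite wzetaN mulrNN mul1r.
rewrite {1}/wp (hasd_derive1 (derive1_parity h (wzeta_hasd sz))).
by rewrite opprK mul1r opprK.
Qed.

Lemma wp'N z : sig z != 0 -> p' (- z) = - p' z.
Proof.
move=> sz; have [k k0 hk] := sig_neq0_near sz.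
have szN := sigN_neq0 sz.
have h : hasd p (- z) (- p' z).
  apply: (@hasd_ext _ (fun w => p (- w)) _ _ _ k k0).
    move=> w wk; apply: wpN; rewrite -oppr_eq0 -sigN; apply: hk.
    by rewrite -normc_opp opprD opprK.
  have hz : hasd p (- - z) (p' z) by rewrite opprK; exact: wp_hasd.
  by apply: hasd_eq (hasd_comp (hasdN (hasd_id (- z))) hz) _; ring.
by rewrite /wp' (hasd_derive1 h).
Qed.

Lemma sig_expansion : exists2 m : C -> C, entire m & forall u, sig u = u + u ^+ 5 * m u.
Proof.
have [_ _ [K [r [r0 hK]]] _] := hs.
have [k k0 rk] := pos_complexE r0.
pose h0 z := sig z - z.
have e0 : entire h0 by exact (entireB sig_entire entire_id).
(* An inequality in [R[i]] compares real parts, so the complex constant [K] enters through its real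
   part. *)
have hb u : u != 0 -> N u < k -> N (h0 u) <= complex.Re K * N u ^+ 5.
  move=> u0 uk; have := hK u; rewrite rk normr_ltc => /(_ uk).
  have -> : `|u| ^+ 5 = (N u ^+ 5)%:C by rewrite normcE_norm -rmorphXn.
  rewrite normcE_norm lecE => /andP[_] /=.
  by case: K {hK} => a b /=; rewrite mulr0 subr0.
have [h1 [e1 E1 b1]] := entire_div_id_bound e0 k0 hb.
have [h2 [e2 E2 b2]] := entire_div_id_bound e1 k0 b1.
have [h3 [e3 E3 b3]] := entire_div_id_bound e2 k0 b2.
have [h4 [e4 E4 b4]] := entire_div_id_bound e3 k0 b3.
have [h5 [e5 E5 b5]] := entire_div_id_bound e4 k0 b4.
exists h5 => // u; have : h0 u = u ^+ 5 * h5 u by rewrite E1 E2 E3 E4 E5; ring.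
by rewrite /h0 => <-; ring.
Qed.

(** Write sig = u k with k = 1 + u^4 m. Then zeta = 1/u + k'/k and k'/k = u^3 n0 with n0 = (4 m + u
    m') / k; the expansions of p and p' follow by differentiation. Taking [quot_form] over [k]
    instead of sig makes n0 and its derivatives regular at 0. *)
Lemma weierstrass_at0 : exists n n1 n2 : C -> C, [/\ cts n 0, cts n1 0, cts n2 0 &
  exists2 r : R, 0 < r & forall u, u != 0 -> N u < r ->
    [/\ sig u != 0, zeta u = u^-1 + u ^+ 3 * n u, p u = (u ^+ 2)^-1 - u ^+ 2 * n1 u &
        p' u = - 2 / u ^+ 3 - u * n2 u]].
Proof.
have [m em sE] := sig_expansion.
pose k z := 1 + z ^+ 4 * m z.
have ek : entire k.
  exact (entireD (@entire_cst 1) (entireM (@entireX _ 4 entire_id) em)).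
have k0 : k 0 != 0 by rewrite /k expr0n mul0r addr0 oner_eq0.
have [r r0 kr] := cts_neq0 (entire_cts 0 ek) k0.
pose n0 z := (4 * m z + z * derive1 m z) / k z.
have q0 : quot_form k n0.
  exists (fun z => 4 * m z + z * derive1 m z), 0%N; split; last by move=> z _; rewrite expr1.
  exact (entireD (entireM (@entire_cst 4) em) (entireM entire_id (entire_derive em))).
have [d0 q1] := quot_form_derive ek q0; have [d1 q2] := quot_form_derive ek q1.
have [d2 q3] := quot_form_derive ek q2.
pose n0' := derive1 n0; pose n0'' := derive1 n0'.
pose n1 z := 3 * n0 z + z * n0' z.
pose n2 z := 6 * n0 z + 6 * z * n0' z + z ^+ 2 * n0'' z.
exists n0, n1, n2; split.
- exact: hasd_cts (d0 0 k0).
- exact: hasd_cts (hasdD (hasdMl 3 (d0 0 k0)) (hasdM (hasd_id 0) (d1 0 k0))).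
- exact: hasd_cts (hasdD (hasdD (hasdMl 6 (d0 0 k0)) (hasdM (hasdMl 6 (hasd_id 0)) (d1 0 k0)))
    (hasdM (hasdX 1 (hasd_id 0)) (d2 0 k0))).
exists r => // u u0 ur.
have near w : N (w - u) < Num.min (N u) (r - N u) -> w != 0 /\ k w != 0.
  rewrite lt_min => /andP[w1 w2]; split.
    by apply: contraTneq w1 => ->; rewrite sub0r normc_opp ltxx.
  by apply: kr; rewrite subr0; have := normcD (w - u) u; rewrite subrK; lra.
have rad : 0 < Num.min (N u) (r - N u) by rewrite lt_min normc_gt0 u0 subr_gt0.
have kk w : sig w = w * k w by rewrite sE /k; ring.
have snz w : w != 0 -> k w != 0 -> sig w != 0 by move=> w0 kw; rewrite kk mulf_neq0.
have ku : k u != 0 by apply: kr; rewrite subr0.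
have dsig w : derive1 sig w = 1 + 5 * w ^+ 4 * m w + w ^+ 5 * derive1 m w.
  apply: hasd_derive1; apply: (@hasd_ext _ (fun u => u + u ^+ 5 * m u) _ _ _ 1) => //.
  apply: hasd_eq (hasdD (hasd_id w) (hasdM (hasdX 4 (hasd_id w)) (entire_hasd em w))) _.
  by ring.
have zE w : w != 0 -> k w != 0 -> zeta w = w^-1 + w ^+ 3 * n0 w.
  by move=> w0 kw; rewrite /wzeta dsig kk /n0 /k; field; rewrite w0 /= kw.
have pE w : w != 0 -> k w != 0 -> p w = (w ^+ 2)^-1 - w ^+ 2 * n1 w.
  move=> w0 kw; have [r1 r10 h1] := cts_neq0 (hasd_cts (hasd_id w)) w0.
  have [r2 r20 h2] := cts_neq0 (entire_cts w ek) kw.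
  have r12 : 0 < Num.min r1 r2 by rewrite lt_min r10 r20.
  have : hasd zeta w (- (w ^+ 2)^-1 + (3 * w ^+ 2 * n0 w + w ^+ 3 * n0' w)).
    apply: (@hasd_ext _ (fun w => w^-1 + w ^+ 3 * n0 w) _ _ _ _ r12).
      by move=> z; rewrite lt_min => /andP[/h1 z1 /h2 z2]; rewrite zE.
    apply: hasd_eq (hasdD (hasd_inv w0) (hasdM (hasdX 2 (hasd_id w)) (d0 w kw))) _.
    by rewrite mulr1.
  by move=> /hasd_derive1; rewrite /wp => ->; rewrite /n1; ring.
split; [exact: snz|exact: zE|exact: pE|].
apply: hasd_derive1.
apply: (@hasd_ext _ (fun w => (w ^+ 2)^-1 - w ^+ 2 * n1 w) _ _ _ _ rad).
  by move=> w /near[w0 kw]; rewrite pE.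
have u2 : u ^+ 2 != 0 by rewrite expf_neq0.
apply: hasd_eq (hasdB (@hasdV _ (fun w => w ^+ 2) u _ u2 (hasdX 1 (hasd_id u))) (hasdM (hasdX 1 (hasd_id u))
  (hasdD (hasdMl 3 (d0 u ku)) (hasdM (hasd_id u) (d1 u ku))))) _.
rewrite -/n0' -/n0'' /n2 expr1; field; exact: u0.
Qed.

Lemma weierstrass_functionsP : weierstrass_functions g2 g3 sig zeta p p'.
Proof.
have [dp' _] := quot_form_derive sig_entire wp'_quot.
constructor.
- exact wzeta_hasd.
- exact wp_hasd.
- exact wp'_hasd.
- by move=> z sz; exact (hasd_cts (dp' z sz)).
- by case: hs.
- exact sigN.
- exact wzetaN.
- exact wpN.
- exact wp'N.
- exact sig_neq0_near.
- exact weierstrass_at0.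
Qed.

End Sigma.

(** * Continuity of composite expressions *)

Section Addition.
Variable R : realType.
Local Notation C := (R[i]).
Local Notation N := (@normc R).
Implicit Types (f g : C -> C) (z u w : C).

Lemma ctsN f z : cts f z -> cts (fun w => - f w) z.
Proof.
move=> h; apply: (@cts_ext _ (fun w => -1 * f w) _ _ 1) => //.
  by move=> w _; rewrite mulN1r.
exact: ctsM (cts_cst _ _) h.
Qed.

Lemma cts_id z : cts (fun w => w) z.
Proof. exact: hasd_cts (hasd_id z). Qed.

Lemma ctsX f z n : cts f z -> cts (fun w => f w ^+ n) z.
Proof.
move=> h; elim: n => [|n IH]; first by under eq_fun do rewrite expr0; exact: cts_cst.
by under eq_fun do rewrite exprS; exact: ctsM h IH.
Qed.

Lemma ctsV f z : f z != 0 -> cts f z -> cts (fun w => (f w)^-1) z.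
Proof. by move=> f0 h; exact: cts_comp h (hasd_cts (hasd_inv f0)). Qed.

End Addition.

Ltac cts_tac :=
  lazymatch goal with
  | |- cts (fun _ => ?c) _ => exact (cts_cst c _)
  | |- cts (fun x => x) _ => exact (cts_id _)
  | |- cts (fun x => @?f x + @?g x) _ => apply (@ctsD _ f g); cts_tac
  | |- cts (fun x => - @?f x) _ => apply (@ctsN _ f); cts_tac
  | |- cts (fun x => @?f x * @?g x) _ => apply (@ctsM _ f g); cts_tac
  | |- cts (fun x => (@?f x) ^-1) _ => apply (@ctsV _ f); [| cts_tac]
  | |- cts (fun x => @?f x ^+ ?n) _ => apply (@ctsX _ f _ n); cts_tac
  | |- _ => first [assumption | idtac]
  end.

(** * The addition formula for zeta *)

Section AdditionFormula.
Variable R : realType.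
Local Notation C := (R[i]).
Local Notation N := (@normc R).

(** Here P = p(u), D = p'(u), and the hypothesis is the difference of the Weierstrass equations at u
    and v. The conclusion is A' = P - Q for the slope A = (D + c) / (2 (P - e)) and Q = A^2 - P - e;
    solving the hypothesis for g2 reduces it to a rational identity. *)
Lemma addition_slope_derivative (P D e c g2 : C) : P - e != 0 ->
  D ^+ 2 - c ^+ 2 = (P - e) * (4 * (P ^+ 2 + P * e + e ^+ 2) - g2) ->
  ((6 * P ^+ 2 - g2 / 2) * (2 * (P - e)) - (D + c) * (2 * D)) / (2 * (P - e)) ^+ 2
  = P - (((D + c) / (2 * (P - e))) ^+ 2 - P - e).
Proof.
move=> Pe h.
have -> : g2 = 4 * (P ^+ 2 + P * e + e ^+ 2) - (D ^+ 2 - c ^+ 2) / (P - e).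
  by rewrite h; field.
by field.
Qed.

(** The left-hand side is the derivative of Q' = 2 A (P - Q) - D, so this is Q'' = 6 Q^2 - g2/2. *)
Lemma addition_second_derivative (P D e c g2 A Q : C) : P - e != 0 ->
  D ^+ 2 - c ^+ 2 = (P - e) * (4 * (P ^+ 2 + P * e + e ^+ 2) - g2) ->
  A = (D + c) / (2 * (P - e)) -> Q = A ^+ 2 - P - e ->
  2 * ((P - Q) * (P - Q) + A * (D - (2 * (A * (P - Q)) - D))) - (6 * P ^+ 2 - g2 / 2)
  = 6 * Q ^+ 2 - g2 / 2.
Proof.
move=> Pe h -> ->.
have -> : g2 = 4 * (P ^+ 2 + P * e + e ^+ 2) - (D ^+ 2 - c ^+ 2) / (P - e).
  by rewrite h; field.
by field.
Qed.

Variables (g2 g3 : C) (sig zeta p p' : C -> C).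
Hypothesis hs : weierstrass_functions g2 g3 sig zeta p p'.

(** With A the right-hand side, A' = p - Q where Q = A^2 - p - e. Once Q(u) is identified with p(u -
    v), both sides have the same derivative, and their difference, continued to 0, vanishes
    there. *)
Lemma wzeta_addition (v : C) : sig v != 0 -> p' v != 0 ->
  exists2 r : R, 0 < r & forall u, u != 0 -> N u < r ->
    [/\ sig u != 0, sig (u - v) != 0, p u - p v != 0 &
        zeta (u - v) - zeta u + zeta v = (p' u + p' v) / (2 * (p u - p v))].
Proof.
move=> sv pv; set e := p v; set c := p' v.
have [n [n1 [n2 [cn cn1 cn2 [r1 r10 h1]]]]] := wf_at0 hs.
(* [E] and [F] are the numerators in p - e = E / u^2 and p' = F / u^3. *)
pose E u := 1 - e * u ^+ 2 - u ^+ 4 * n1 u.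
pose F u := - 2 - u ^+ 4 * n2 u.
have cE : cts E 0 by rewrite /E; cts_tac.
have cF : cts F 0 by rewrite /F; cts_tac.
have E0 : E 0 != 0 by rewrite /E !expr0n /= mulr0 mul0r !subr0 oner_eq0.
have F0 : F 0 != 0 by rewrite /F !expr0n /= mul0r subr0 oppr_eq0 pnatr_eq0.
have [r2 r20 h2] := cts_neq0 cE E0; have [r3 r30 h3] := cts_neq0 cF F0.
have sNv : sig (- v) != 0 by rewrite (wf_sigN hs) oppr_eq0.
have [r4 r40 h4] := wf_near hs sNv.
have pNv : p' (- v) != 0 by rewrite (wf_p'N hs sv) oppr_eq0.
have [r5 r50 h5] := cts_neq0 (wf_p'_cts hs sNv) pNv.
pose r := Num.min r1 (Num.min (Num.min r2 r3) (Num.min r4 r5)).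
have r0 : 0 < r by rewrite !lt_min r10 r20 r30 r40 r50.
have hu u : N u < r -> [/\ N u < r1, E u != 0, F u != 0, sig (u - v) != 0 & p' (u - v) != 0].
  rewrite !lt_min => /andP[? /andP[/andP[? ?] /andP[? ?]]].
  by split=> //; [apply: h2|apply: h3|apply: h4|apply: h5]; rewrite ?subr0 ?opprK ?subrK.
have pE u : u != 0 -> N u < r -> [/\ sig u != 0, p u - e = E u / u ^+ 2,
    p' u = F u / u ^+ 3, p u - e != 0 & p' u != 0].
  move=> u0 /hu[ur Eu Fu _ _]; have [su _ pu p'u] := h1 u u0 ur.
  have pe : p u - e = E u / u ^+ 2 by rewrite pu /E; field.
  have pe' : p' u = F u / u ^+ 3 by rewrite p'u /F; field.
  by split=> //; rewrite ?pe ?pe' mulf_neq0// invr_neq0// expf_neq0.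
pose A u := (p' u + c) / (2 * (p u - e)).
pose Qf u := A u ^+ 2 - p u - e.
pose Rf u := 2 * (A u * (p u - Qf u)) - p' u.
have ode z : sig z != 0 -> p' z ^+ 2 = 4 * p z ^+ 3 - g2 * p z - g3.
  exact: wf_ode hs z.
have rel u : u != 0 -> N u < r -> p' u ^+ 2 - c ^+ 2 =
    (p u - e) * (4 * (p u ^+ 2 + p u * e + e ^+ 2) - g2).
  by move=> u0 ur; have [su _ _ _ _] := pE u u0 ur; rewrite /c !ode// -/e; ring.
have dA u : u != 0 -> N u < r -> hasd A u (p u - Qf u).
  move=> u0 ur; have [su _ _ pe p'0] := pE u u0 ur.
  have den : 2 * (p u - e) != 0 by rewrite mulf_neq0// pnatr_eq0.
  have H := @hasd_div _ (fun w => p' w + c) (fun w => 2 * (p w - e)) u _ _ den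
    (hasdD (wf_p' hs su p'0) (hasd_cst c u)) (hasdMl 2 (hasdB (wf_p hs su) (hasd_cst e u))).
  apply: hasd_eq H _; rewrite addr0 subr0.
  exact: addition_slope_derivative pe (rel u u0 ur).
have dQ u : u != 0 -> N u < r -> hasd Qf u (Rf u).
  move=> u0 ur; have [su _ _ _ _] := pE u u0 ur.
  apply: hasd_eq (hasdB (hasdB (hasdX 1 (dA u u0 ur)) (wf_p hs su)) (hasd_cst e u)) _.
  by rewrite /Rf; ring.
have dR u : u != 0 -> N u < r -> hasd Rf u (6 * Qf u ^+ 2 - g2 / 2).
  move=> u0 ur; have [su _ _ pe p'0] := pE u u0 ur.
  apply: hasd_eq (hasdB (hasdMl 2 (hasdM (dA u u0 ur) (hasdB (wf_p hs su) (dQ u u0 ur))))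
    (wf_p' hs su p'0)) _.
  exact: (addition_second_derivative pe (rel u u0 ur) (erefl (A u)) (erefl (Qf u))).
(* [be] is chosen so that A = - 1/u + u * be, and [ga] is (be + e) / u with the division carried
   out. With them the poles of [Qf] and [Rf] cancel, giving [Qr] and [Rr], continuous at 0 with
   values e and - c. *)
pose be u := (- e - u ^+ 2 * n1 u + (c * u - u ^+ 2 * n2 u) / 2) / E u.
pose ga u := (c / 2 - u * (n1 u + n2 u / 2 + e ^+ 2) - e * u ^+ 3 * n1 u) / E u.
pose Qr u := - 2 * be u - e + u ^+ 2 * (be u ^+ 2 + n1 u).
pose Rr u := - 2 * ga u + 2 * u * (be u ^+ 2 + n1 u)
  + u * (2 * n1 u + n2 u - 2 * be u * Qr u) - 2 * u ^+ 3 * be u * n1 u.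
have cbe : cts be 0 by rewrite /be; cts_tac.
have cga : cts ga 0 by rewrite /ga; cts_tac.
have cQr : cts Qr 0 by rewrite /Qr; cts_tac.
have cRr : cts Rr 0 by rewrite /Rr; cts_tac.
have E1 : E 0 = 1 by rewrite /E; ring.
have be0 : be 0 = - e by rewrite /be E1; field.
have ga0 : ga 0 = c / 2 by rewrite /ga E1; field.
have Q0 : Qr 0 = e by rewrite /Qr be0; ring.
have R0 : Rr 0 = - c by rewrite /Rr ga0; field.
have AE u : u != 0 -> N u < r -> A u = - u^-1 + u * be u.
  move=> u0 ur; have [ur1 Eu Fu _ _] := hu u ur; have [_ pe p'u _ _] := pE u u0 ur.
  rewrite /A pe p'u /be /F; move: Eu; rewrite /E => Eu; field.
  by rewrite u0 Eu.
have pu u : u != 0 -> N u < r -> p u = (u ^+ 2)^-1 - u ^+ 2 * n1 u /\ p' u = - 2 / u ^+ 3 - u * n2 u.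
  by move=> u0 /hu[ur _ _ _ _]; have [] := h1 u u0 ur.
have QE u : u != 0 -> N u < r -> Qf u = Qr u.
  move=> u0 ur; have [pE1 pE2] := pu u u0 ur.
  by rewrite /Qf AE// pE1 /Qr; move: (be u) => b; field.
have gaE u : u != 0 -> N u < r -> ga u = (be u + e) / u.
  move=> u0 ur; have [ur1 Eu Fu _ _] := hu u ur.
  by rewrite /ga /be; move: Eu; rewrite /E => Eu; field; rewrite u0 Eu.
have RE u : u != 0 -> N u < r -> Rf u = Rr u.
  move=> u0 ur; have [pE1 pE2] := pu u u0 ur.
  rewrite /Rf QE// AE// pE1 pE2 /Rr gaE// /Qr; move: (be u) => b; by field.
have near u : u != 0 -> N u < r -> exists2 k : R, 0 < k & forall w, N (w - u) < k -> w != 0 /\ N w < r.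
  move=> u0 ur; exists (Num.min (N u) (r - N u)); first by rewrite lt_min normc_gt0 u0 subr_gt0.
  move=> w; rewrite lt_min => /andP[w1 w2]; split.
    by apply: contraTneq w1 => ->; rewrite sub0r normc_opp ltxx.
  by have := normcD (w - u) u; rewrite subrK; lra.
have sh f d u : hasd f (u - v) d -> hasd (fun w => f (w - v)) u d.
  move=> h; apply: hasd_eq (hasd_comp (hasdB (hasd_id u) (hasd_cst v u)) h) _.
  by rewrite subr0 mulr1.
have dpv u : N u < r -> hasd (fun w => p (w - v)) u (p' (u - v)).
  by move=> /hu[_ _ _ su _]; apply: sh; exact: (wf_p hs su).
have dp'v u : N u < r -> hasd (fun w => p' (w - v)) u (6 * p (u - v) ^+ 2 - g2 / 2).
  by move=> /hu[_ _ _ su pu']; apply: sh; exact: (wf_p' hs su pu').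
have N0r : N 0 < r by rewrite normc0.
have [r' r'0 hr'] : exists2 r' : R, 0 < r' & forall z, N z < r' -> Qr z = p (z - v) /\ Rr z = p' (z - v).
  apply: (@quad_ode_unique _ 0 0 1 0 0 0 (- (g2 / 2)) 0 0 6 0 0 Qr Rr
    (fun z => p (z - v)) (fun z => p' (z - v)) r r0 cQr cRr).
  - exact: hasd_cts (dpv 0 N0r).
  - exact: hasd_cts (dp'v 0 N0r).
  - by rewrite Q0 sub0r (wf_pN hs sv).
  - by rewrite R0 sub0r (wf_p'N hs sv).
  move=> u u0 ur; have [k k0 hk] := near u u0 ur; split.
  - apply: (hasd_ext k0 _ (hasd_eq (dQ u u0 ur) _)); last by rewrite /quad RE//; ring.
    by move=> w /hk[w0 wr]; exact: QE.
  - apply: (hasd_ext k0 _ (hasd_eq (dR u u0 ur) _)); last by rewrite /quad QE//; ring.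
    by move=> w /hk[w0 wr]; exact: RE.
  - by apply: hasd_eq (dpv u ur) _; rewrite /quad; ring.
  - by apply: hasd_eq (dp'v u ur) _; rewrite /quad; ring.
pose r'' := Num.min r r'.
have r''0 : 0 < r'' by rewrite lt_min r0 r'0.
exists r'' => // u u0; rewrite lt_min => /andP[ur ur'].
have [su _ _ pe _] := pE u u0 ur; have [ur1 _ _ suv _] := hu u ur.
split=> //.
have dz w : N w < r -> hasd (fun w => zeta (w - v)) w (- p (w - v)).
  by move=> /hu[_ _ _ sw _]; apply: sh; exact: (wf_zeta hs sw).
(* This is A(u) + zeta(u) - zeta(v) - zeta(u - v) after the poles - 1/u and 1/u have cancelled. *)
pose Z u := u * be u + u ^+ 3 * n u - zeta v - zeta (u - v).
have cz : cts (fun w => zeta (w - v)) 0 by exact: hasd_cts (dz 0 N0r).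
have cZ : cts Z 0 by rewrite /Z; cts_tac.
have Z0 : Z 0 = 0 by rewrite /Z sub0r (wf_zetaN hs); ring.
have ZE w : w != 0 -> N w < r -> A w + zeta w - zeta v - zeta (w - v) = Z w.
  move=> w0 wr; have [wr1 _ _ _ _] := hu w wr; have [_ -> _ _] := h1 w w0 wr1.
  by rewrite /Z AE//; ring.
have dZ w : w != 0 -> N w <= N u -> hasd Z w 0.
  move=> w0 wu; have wr := le_lt_trans wu ur; have wr' := le_lt_trans wu ur'.
  have [k k0 hk] := near w w0 wr; have [sw _ _ _ _] := pE w w0 wr.
  apply: (hasd_ext k0 _ (hasd_eq (hasdB (hasdB (hasdD (dA w w0 wr) (wf_zeta hs sw))
    (hasd_cst (zeta v) w)) (dz w wr)) _)).
    by move=> t /hk[t0 tr]; exact: ZE.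
  by have [<- _] := hr' w wr'; rewrite QE//; ring.
have := @ray_MVT _ Z (fun=> 0) u 0 cZ dZ.
rewrite mul0r Z0 subr0 normc0 => /(_ (fun _ _ _ => lexx _)) H.
have Zu : Z u = 0 by apply: eq0_normc; apply/eqP; rewrite eq_le H normc_ge0.
have := ZE u u0 ur; rewrite Zu -/e -/c -/(A u) => E'.
by apply/eqP; rewrite -subr_eq0 -oppr_eq0 -E'; apply/eqP; ring.
Qed.

End AdditionFormula.

(** * The exponential of the elliptic formal group law in terms of p and p' *)

Section FormalGroup.
Variable R : realType.
Local Notation C := (R[i]).
Local Notation N := (@normc R).
Variables (mu1 mu2 mu3 mu4 mu6 : C).

(* The invariant differential is dt / fgl_omega(t, s); fgl_omega and fgl_eta are the
   velocities of t and s along a one-parameter subgroup. *)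
Definition fgl_omega (t s : C) := quad 1 (- mu1) (- 2 * mu3) (- mu2) (- 2 * mu4) (- 3 * mu6) t s.
Definition fgl_eta (t s : C) := quad 0 0 mu1 3 (2 * mu2) mu4 t s.

(** The chord construction at second point O: [l1], [n1], [A1], [B1], [t31], [m1] are the
    derivatives there of the slope, the intercept, both coefficients, the third root and the
    denominator of the negation. Eliminating mu1 through [k] leaves a rational identity. *)
Lemma fgl_slope_derivative (t s a k : C) : t != 0 -> s != 0 -> k != 0 ->
  k = 1 - mu1 * t - mu3 * s ->
  let l := s / t in let l1 := s / t ^+ 2 in let n1 := - (s / t) in
  let A := s * k / t ^+ 3 in let A1 := a * l1 in
  let B := s * (1 - k) / t ^+ 2 in let B1 := (mu1 + 2 * mu3 * l) * l1 + a * n1 in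
  let t3 := - t / k in let t31 := - ((B1 * A - B * A1) / A ^+ 2) - 1 in
  let m := - k^-1 in let m1 := mu1 * t31 + mu3 * (l1 * t3 + l * t31 + n1) in
  (t31 * m - t3 * m1) / m ^+ 2 = 1 - mu1 * t - 2 * mu3 * s - t ^+ 2 * a.
Proof.
move=> t0 s0 k0 kE /=.
have -> : mu1 = (1 - k - mu3 * s) / t by rewrite kE; field.
by field; rewrite t0 s0 k0.
Qed.

Variables (s f : C -> C).
Hypothesis hs : is_tate_s mu1 mu2 mu3 mu4 mu6 s.
Hypothesis hf : is_fgl_exp mu1 mu2 mu3 mu4 mu6 s f.

(** [fgl_eta] and 1 - [fgl_omega] are the partial derivatives of the cubic in t and s, so implicit
    differentiation gives omega * s' = eta. *)
Lemma tate_rhs_hasd t d : hasd s t d ->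
  hasd (fun t => tate_rhs mu1 mu2 mu3 mu4 mu6 t (s t)) t
    (fgl_eta t (s t) + (1 - fgl_omega t (s t)) * d).
Proof.
move=> h; have i := hasd_id t.
apply: hasd_eq (hasdD (hasdD (hasdD (hasdD (hasdD (hasdX 2 i)
  (hasdM (hasdMl mu1 i) h)) (hasdM (hasdMl mu2 (hasdX 1 i)) h))
  (hasdMl mu3 (hasdX 1 h))) (hasdM (hasdMl mu4 i) (hasdX 1 h)))
  (hasdMl mu6 (hasdX 2 h))) _.
by rewrite /fgl_eta /fgl_omega /quad; ring.
Qed.

Lemma tate_s_hasd : exists2 r : R, 0 < r & forall t, N t < r ->
  s t = tate_rhs mu1 mu2 mu3 mu4 mu6 t (s t) /\
  exists2 d, hasd s t d & fgl_omega t (s t) * d = fgl_eta t (s t).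
Proof.
have [_ [_ [/pos_complexE[r r0 ->] h]]] := hs.
exists r => // t tr; have := h t; rewrite normr_ltc => /(_ tr)[ds sE].
split=> //; exists (derive1 s t); first exact: derivable_hasd.
have d1 := derivable_hasd ds.
have : hasd s t (fgl_eta t (s t) + (1 - fgl_omega t (s t)) * derive1 s t).
  have rt : 0 < r - N t by rewrite subr_gt0.
  apply: (hasd_ext rt _ (tate_rhs_hasd d1)) => w wt.
  have wr : N w < r by have := normcD (w - t) t; rewrite subrK; lra.
  by have := h w; rewrite normr_ltc => /(_ wr)[_ <-].
move=> /(hasd_unique d1) E.
have : fgl_eta t (s t) + (1 - fgl_omega t (s t)) * derive1 s t - derive1 s t = 0.
  by rewrite -E subrr.
move: (derive1 s t) => d /eqP; rewrite -oppr_eq0 => /eqP E'.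
apply/eqP; rewrite -subr_eq0 -E'; apply/eqP; ring.
Qed.

Lemma tate_s0 : s 0 = 0. Proof. by case: hs. Qed.

Lemma tate_s_hasd0 : hasd s 0 0.
Proof.
have [r r0 /(_ 0)] := tate_s_hasd; rewrite normc0 => /(_ r0)[_ [d hd]].
rewrite tate_s0 /fgl_omega /fgl_eta /quad => E.
apply: hasd_eq hd _; apply/eqP; rewrite -subr_eq0; apply/eqP.
transitivity ((1 + - mu1 * 0 + - 2 * mu3 * 0 + - mu2 * 0 ^+ 2 + - 2 * mu4 * 0 * 0 +
  - 3 * mu6 * 0 ^+ 2) * d); first by ring.
by rewrite E; ring.
Qed.

Lemma fgl_exp_hasd0 : hasd f 0 1.
Proof.
have [_ f1 [_ [/pos_complexE[r r0 ->] [h _]]]] := hf.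
rewrite -f1; apply: derivable_hasd; apply: h.
by rewrite normr_ltc normc0.
Qed.

Lemma fgl_exp0 : f 0 = 0. Proof. by case: hf. Qed.

(** When the second point is O, the chord has slope s(t)/t and intercept 0 and meets the cubic again
    at the negative of the first point; the derivative is then the quotient rule along the
    construction. *)
Lemma fgl_mu_hasd0 t : t != 0 -> s t != 0 -> 1 - mu1 * t - mu3 * s t != 0 ->
  s t = tate_rhs mu1 mu2 mu3 mu4 mu6 t (s t) ->
  hasd (fgl_mu mu1 mu2 mu3 mu4 mu6 s t) 0 (fgl_omega t (s t)).
Proof.
set S := s t; set k := 1 - _ - _ => t0 S0 k0 cubic.
have nt0 : 0 - t != 0 by rewrite sub0r oppr_eq0.
pose lam w := (s w - S) / (w - t).
pose nu w := S - lam w * t.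
pose A w := 1 + mu2 * lam w + mu4 * lam w ^+ 2 + mu6 * lam w ^+ 3.
pose B w := mu1 * lam w + mu2 * nu w + mu3 * lam w ^+ 2 + 2 * mu4 * lam w * nu w
           + 3 * mu6 * lam w ^+ 2 * nu w.
pose t3 w := - (B w / A w) - t - w.
pose s3 w := lam w * t3 w + nu w.
pose m w := mu1 * t3 w + mu3 * s3 w - 1.
(* Within this radius [w] differs from [t], so only the chord case of the law occurs, never the
   tangent. *)
apply: (@hasd_ext _ (fun w => t3 w / m w) _ _ _ (N t)); first by rewrite normc_gt0.
  move=> w; rewrite subr0 => wt; rewrite /fgl_mu ifN//.
  by apply: contraTneq wt => <-; rewrite ltxx.
pose a := mu2 + 2 * mu4 * (S / t) + 3 * mu6 * (S / t) ^+ 2.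
have lam0 : lam 0 = S / t by rewrite /lam tate_s0; field.
have nu0 : nu 0 = 0 by rewrite /nu lam0; field.
(* The cubic itself turns the polynomial in S/t into this product, which shows that [A 0] is
   nonzero. *)
have A0 : A 0 = S * k / t ^+ 3.
  have -> : S * k = t ^+ 3 + mu2 * t ^+ 2 * S + mu4 * t * S ^+ 2 + mu6 * S ^+ 3.
    rewrite /k; transitivity (S - mu1 * t * S - mu3 * S ^+ 2); first by ring.
    by rewrite {1}cubic /tate_rhs; ring.
  by rewrite /A lam0; field.
have A00 : A 0 != 0 by rewrite A0 mulf_neq0 ?invr_neq0 ?expf_neq0 ?mulf_neq0.
have B0 : B 0 = S * (1 - k) / t ^+ 2 by rewrite /B lam0 nu0 /k; field.
have t30 : t3 0 = - t / k.
  by rewrite /t3 A0 B0; field; rewrite t0 S0 k0.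
have s30 : s3 0 = - S / k by rewrite /s3 t30 nu0 lam0; field; rewrite t0 k0.
have m0 : m 0 = - k^-1.
  rewrite /m t30 s30; have -> : mu1 = (1 - k - mu3 * S) / t by rewrite /k; field.
  by field; rewrite t0 k0.
have m00 : m 0 != 0 by rewrite m0 oppr_eq0 invr_eq0.
have dlam : hasd lam 0 (S / t ^+ 2).
  apply: hasd_eq (@hasd_div _ (fun w => s w - S) (fun w => w - t) 0 _ _ nt0
    (hasdB tate_s_hasd0 (hasd_cst S 0)) (hasdB (hasd_id 0) (hasd_cst t 0))) _.
  by rewrite tate_s0; field.
have dnu : hasd nu 0 (- (S / t)).
  by apply: hasd_eq (hasdB (hasd_cst S 0) (hasdMr t dlam)) _; field.
have dA : hasd A 0 (a * (S / t ^+ 2)).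
  apply: hasd_eq (hasdD (hasdD (hasdD (hasd_cst 1 0) (hasdMl mu2 dlam))
    (hasdMl mu4 (hasdX 1 dlam))) (hasdMl mu6 (hasdX 2 dlam))) _.
  by rewrite lam0 /a; ring.
have dB : hasd B 0 ((mu1 + 2 * mu3 * (S / t)) * (S / t ^+ 2) + a * (- (S / t))).
  apply: hasd_eq (hasdD (hasdD (hasdD (hasdD (hasdMl mu1 dlam) (hasdMl mu2 dnu))
    (hasdMl mu3 (hasdX 1 dlam))) (hasdM (hasdMl (2 * mu4) dlam) dnu))
    (hasdM (hasdMl (3 * mu6) (hasdX 1 dlam)) dnu)) _.
  by rewrite lam0 nu0 /a; ring.
have dt3 := hasdB (hasdB (hasdN (hasd_div A00 dB dA)) (hasd_cst t 0)) (hasd_id 0).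
have ds3 := hasdD (hasdM dlam dt3) dnu.
have dm := hasdB (hasdD (hasdMl mu1 dt3) (hasdMl mu3 ds3)) (hasd_cst 1 0).
apply: hasd_eq (@hasd_div _ t3 m 0 _ _ m00 dt3 dm) _.
rewrite -/(t3 0) m0 t30 lam0 A0 B0 !subr0.
rewrite (@fgl_slope_derivative t S a k)//.
by rewrite /fgl_omega /quad /a; field.
Qed.

Lemma fgl_exp_ode : exists2 r : R, 0 < r & forall u, u != 0 -> N u < r ->
  hasd f u (fgl_omega (f u) (s (f u))) /\
  hasd (fun w => s (f w)) u (fgl_eta (f u) (s (f u))).
Proof.
have [rs rs0 hrs] := tate_s_hasd.
have [_ _ [_ [/pos_complexE[rf rf0 ->] [df fadd]]]] := hf.
have cf := hasd_cts fgl_exp_hasd0.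
have rs2 : 0 < rs / 2 by rewrite divr_gt0.
have [k1 k10 h1] := cf _ rs2.
have e2 : 0 < 2^-1 :> R by rewrite invr_gt0 ltr0n.
(* Since f'(0) = 1, tolerance 1/2 gives |f(u) - u| <= |u|/2, so f(u) is nonzero for small nonzero
   u. *)
have [k2 k20 h2] := fgl_exp_hasd0 e2.
have csf : cts (fun w => s (f w)) 0.
  by apply: cts_comp cf _; rewrite fgl_exp0; exact: hasd_cts tate_s_hasd0.
pose ka u := 1 - mu1 * f u - mu3 * s (f u).
have cka : cts ka 0 by rewrite /ka; cts_tac.
have ka0 : ka 0 != 0.
  by rewrite /ka fgl_exp0 tate_s0 !mulr0 !subr0 oner_eq0.
have [k3 k30 h3] := cts_neq0 cka ka0.
pose r := Num.min (Num.min k1 k2) (Num.min k3 rf).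
have r0 : 0 < r by rewrite !lt_min k10 k20 k30 rf0.
exists r => // u u0; rewrite !lt_min => /andP[/andP[uk1 uk2] /andP[uk3 urf]].
have fr : N (f u) < rs.
  have := h1 u; rewrite subr0 => /(_ uk1); rewrite fgl_exp0 subr0.
  by move=> H; apply: le_lt_trans H _; rewrite ltr_pdivrMr// mulr2n mulrDr mulr1 ltrDl.
have f0 : f u != 0.
  have := h2 u; rewrite subr0 => /(_ uk2); rewrite fgl_exp0 subr0 mul1r => H.
  have Nu : 0 < N u by rewrite normc_gt0.
  by rewrite -normc_gt0; have := normcB_ge u (f u); rewrite normc_distC; lra.
have kau : ka u != 0 by apply: h3; rewrite subr0.
have [cubic [d ds dE]] := hrs _ fr.
have s0 : s (f u) != 0.
  apply/eqP => s0; move: cubic; rewrite /tate_rhs s0 => E.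
  have : f u ^+ 3 = 0 by rewrite [RHS]E; ring.
  by move/eqP; rewrite expf_eq0 /= (negbTE f0).
have dG := fgl_mu_hasd0 f0 s0 kau cubic.
have dfu : hasd f u (fgl_omega (f u) (s (f u))).
  have Hc : hasd (fun h => fgl_mu mu1 mu2 mu3 mu4 mu6 s (f u) (f h)) 0 (fgl_omega (f u) (s (f u))).
    have dG' : hasd (fgl_mu mu1 mu2 mu3 mu4 mu6 s (f u)) (f 0) (fgl_omega (f u) (s (f u))).
      by rewrite fgl_exp0.
    by apply: hasd_eq (hasd_comp fgl_exp_hasd0 dG') _; rewrite mulr1.
  have Hf : hasd (fun h => f (u + h)) 0 (fgl_omega (f u) (s (f u))).
    apply: (hasd_ext rf0 _ Hc) => h; rewrite subr0 => hr.
    by rewrite fadd ?normr_ltc.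
  have Hf' : hasd (fun h => f (u + h)) (u - u) (fgl_omega (f u) (s (f u))) by rewrite subrr.
  apply: (@hasd_ext _ (fun w => f (u + (w - u))) _ _ _ 1 ltr01).
    by move=> w _; rewrite addrC subrK.
  apply: hasd_eq (hasd_comp (hasdB (hasd_id u) (hasd_cst u u)) Hf') _.
  by rewrite subr0 mulr1.
split=> //; rewrite -dE mulrC.
exact: (hasd_comp dfu ds).
Qed.

Variables (sig zeta p p' : C -> C) (v : C).
Let b := 4 * mu2 + mu1 ^+ 2.
Let g2 := b ^+ 2 / 12 - 2 * (mu1 * mu3 + 2 * mu4).
Let g3 := (mu1 * mu3 + 2 * mu4) * b / 6 - b ^+ 3 / 216 - 4 * mu6 - mu3 ^+ 2.
Hypothesis hw : weierstrass_functions g2 g3 sig zeta p p'.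

(** On the cubic x = P - e and y = Dl/2, hence t = - x/y = - 2 (P - e) / Dl and s = - 1/y = - 2 /
    Dl. The left-hand side is the quotient rule for t; mu6 is eliminated through the Weierstrass
    equation. *)
Lemma wp_tate_ode1 (P D : C) : let e := b / 12 in let Dl := D - mu1 * (P - e) - mu3 in
  Dl != 0 -> D ^+ 2 = 4 * P ^+ 3 - g2 * P - g3 ->
  (- 2 * D * Dl - (- 2 * (P - e)) * (6 * P ^+ 2 - g2 / 2 - mu1 * D)) / Dl ^+ 2 =
  fgl_omega (- 2 * (P - e) / Dl) (- 2 / Dl).
Proof.
move=> e Dl Dl0 ode.
have -> : fgl_omega (- 2 * (P - e) / Dl) (- 2 / Dl) =
  (Dl ^+ 2 + 2 * mu1 * (P - e) * Dl + 4 * mu3 * Dl - 4 * mu2 * (P - e) ^+ 2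
   - 8 * mu4 * (P - e) - 12 * mu6) / Dl ^+ 2.
  by rewrite /fgl_omega /quad; field.
congr (_ / _).
have mu6E : mu6 = (D ^+ 2 - (4 * P ^+ 3 - g2 * P - ((mu1 * mu3 + 2 * mu4) * b / 6
    - b ^+ 3 / 216 - mu3 ^+ 2))) / 4.
  by rewrite ode /g3; field.
by rewrite mu6E /Dl /e /g2 /b; field.
Qed.

Lemma wp_tate_ode2 (P D : C) : let e := b / 12 in let Dl := D - mu1 * (P - e) - mu3 in
  Dl != 0 ->
  (- (- 2)) * (6 * P ^+ 2 - g2 / 2 - mu1 * D) / Dl ^+ 2 =
  fgl_eta (- 2 * (P - e) / Dl) (- 2 / Dl).
Proof.
move=> e Dl Dl0.
have -> : fgl_eta (- 2 * (P - e) / Dl) (- 2 / Dl) =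
  (- 2 * mu1 * Dl + 12 * (P - e) ^+ 2 + 8 * mu2 * (P - e) + 4 * mu4) / Dl ^+ 2.
  by rewrite /fgl_eta /quad; field.
by congr (_ / _); rewrite /Dl /e /g2 /b; field.
Qed.

Lemma fgl_exp_wp : exists2 r : R, 0 < r & forall u, u != 0 -> N u < r ->
  [/\ f u != 0, p u - b / 12 != 0 &
      (f u)^-1 = mu1 / 2 - (p' u - mu3) / (2 * (p u - b / 12))].
Proof.
pose e := b / 12.
have [n [n1 [n2 [_ cn1 cn2 [r1 r10 h1]]]]] := wf_at0 hw.
pose E u := 1 - e * u ^+ 2 - u ^+ 4 * n1 u.
pose F u := - 2 - u ^+ 4 * n2 u.
pose D u := - 2 - u ^+ 4 * n2 u - mu1 * u * E u - mu3 * u ^+ 3.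
have cE : cts E 0 by rewrite /E; cts_tac.
have cF : cts F 0 by rewrite /F; cts_tac.
have cD : cts D 0 by rewrite /D; cts_tac.
have E0 : E 0 != 0 by rewrite /E !expr0n /= mulr0 mul0r !subr0 oner_eq0.
have F0 : F 0 != 0 by rewrite /F !expr0n /= mul0r subr0 oppr_eq0 pnatr_eq0.
have D0 : D 0 != 0.
  by rewrite /D !expr0n /= !mulr0 !mul0r !subr0 oppr_eq0 pnatr_eq0.
have [r2 r20 h2] := cts_neq0 cE E0; have [r3 r30 h3] := cts_neq0 cF F0.
have [r4 r40 h4] := cts_neq0 cD D0.
have [r5 r50 h5] := fgl_exp_ode.
pose r := Num.min r1 (Num.min (Num.min r2 r3) (Num.min r4 r5)).
have r0 : 0 < r by rewrite !lt_min r10 r20 r30 r40 r50.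
have hu u : N u < r -> [/\ N u < r1, E u != 0, F u != 0, D u != 0 & N u < r5].
  rewrite !lt_min => /andP[? /andP[/andP[? ?] /andP[? ?]]].
  by split=> //; [apply: h2|apply: h3|apply: h4]; rewrite ?subr0.
pose Dl u := p' u - mu1 * (p u - e) - mu3.
have pE u : u != 0 -> N u < r -> [/\ sig u != 0, p u - e = E u / u ^+ 2,
    p' u = F u / u ^+ 3, p' u != 0 & Dl u = D u / u ^+ 3].
  move=> u0 /hu[ur Eu Fu Du _]; have [su _ pu p'u] := h1 u u0 ur.
  have pe : p u - e = E u / u ^+ 2 by rewrite pu /E; field.
  have pe' : p' u = F u / u ^+ 3 by rewrite p'u /F; field.
  split=> //; first by rewrite pe' mulf_neq0// invr_neq0// expf_neq0.
  by rewrite /Dl pe pe' /F /D; field.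
have Dl0 u : u != 0 -> N u < r -> Dl u != 0.
  move=> u0 ur; have [_ _ _ _ ->] := pE u u0 ur; have [_ _ _ Du _] := hu u ur.
  by rewrite mulf_neq0// invr_neq0// expf_neq0.
(* The Tate coordinates of the parametrised curve with numerator and denominator multiplied by u^3;
   they are continuous at 0 and vanish there, like f and s(f). *)
pose T u := - 2 * u * E u / D u; pose S u := - 2 * u ^+ 3 / D u.
have TE u : u != 0 -> N u < r -> - 2 * (p u - e) / Dl u = T u /\ - 2 / Dl u = S u.
  move=> u0 ur; have [_ -> _ _ ->] := pE u u0 ur; have [_ _ _ Du _] := hu u ur.
  by rewrite /T /S; move: (D u) (E u) Du => x y x0; split; field; rewrite u0 x0.
have cT : cts T 0 by rewrite /T; cts_tac.
have cS : cts S 0 by rewrite /S; cts_tac.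
have near u : u != 0 -> N u < r -> exists2 k : R, 0 < k & forall w, N (w - u) < k -> w != 0 /\ N w < r.
  move=> u0 ur; exists (Num.min (N u) (r - N u)); first by rewrite lt_min normc_gt0 u0 subr_gt0.
  move=> w; rewrite lt_min => /andP[w1 w2]; split.
    by apply: contraTneq w1 => ->; rewrite sub0r normc_opp ltxx.
  by have := normcD (w - u) u; rewrite subrK; lra.
have [r' r'0 hr'] : exists2 r' : R, 0 < r' & forall z, N z < r' -> f z = T z /\ s (f z) = S z.
  apply: (@quad_ode_unique _ 1 (- mu1) (- 2 * mu3) (- mu2) (- 2 * mu4) (- 3 * mu6)
    0 0 mu1 3 (2 * mu2) mu4 f (fun z => s (f z)) T S r r0).
  - exact: hasd_cts fgl_exp_hasd0.
  - apply: cts_comp (hasd_cts fgl_exp_hasd0) _.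
    by rewrite fgl_exp0; exact: hasd_cts tate_s_hasd0.
  - exact: cT.
  - exact: cS.
  - by rewrite fgl_exp0 /T mulr0 !mul0r.
  - by rewrite fgl_exp0 tate_s0 /S expr0n mulr0 mul0r.
  move=> u u0 ur; have [_ _ _ _ ur5] := hu u ur; have [df dsf] := h5 u u0 ur5.
  have [k k0 hk] := near u u0 ur; have [su _ _ p'0 _] := pE u u0 ur.
  have dp := wf_p hw su; have dp' := wf_p' hw su p'0; have ode := wf_ode hw su.
  have dDl := hasdB (hasdB dp' (hasdMl mu1 (hasdB dp (hasd_cst e u)))) (hasd_cst mu3 u).
  have [TEu SEu] := TE u u0 ur.
  split=> //.
  - have H := @hasd_div _ (fun w => - 2 * (p w - e)) Dl u _ _ (Dl0 u u0 ur)
      (hasdMl (- 2) (hasdB dp (hasd_cst e u))) dDl.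
    apply: (hasd_ext k0 _ (hasd_eq H _)) => [w /hk[w0 wr]|]; first by case: (TE w w0 wr).
    rewrite !subr0 -TEu -SEu; exact: (wp_tate_ode1 (Dl0 u u0 ur) ode).
  - have H := @hasd_div _ (fun=> - 2) Dl u _ _ (Dl0 u u0 ur) (hasd_cst (- 2) u) dDl.
    apply: (hasd_ext k0 _ (hasd_eq H _)) => [w /hk[w0 wr]|]; first by case: (TE w w0 wr).
    rewrite !subr0 mul0r sub0r -mulNr -TEu -SEu; exact: (wp_tate_ode2 (Dl0 u u0 ur)).
exists (Num.min r r') => [|u u0]; first by rewrite lt_min r0 r'0.
rewrite lt_min => /andP[ur ur']; have [fE _] := hr' u ur'.
have [TEu _] := TE u u0 ur; have [_ pe _ _ _] := pE u u0 ur.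
have [_ Eu _ _ _] := hu u ur; have Dlu := Dl0 u u0 ur.
have pe0 : p u - e != 0 by rewrite pe mulf_neq0// invr_neq0// expf_neq0.
rewrite fE -TEu; split=> //.
  by rewrite mulf_neq0 ?invr_neq0// mulf_neq0// oppr_eq0 pnatr_eq0.
by rewrite -/e /Dl; field; rewrite pe0 Dlu.
Qed.

End FormalGroup.

(** * Logarithmic derivatives of Phi and the formula for Psi *)

Section Krichever.
Variable R : realType.
Local Notation C := (R[i]).
Local Notation N := (@normc R).

(** Used with bound 1/2 on the arguments of the exponentials, the range in which [expCE] replaces
    [expC] by [cexp]. *)
Lemma small_near (r : R) (g : C -> C) (b : R) : 0 < r -> 0 < b -> cts g 0 -> g 0 = 0 ->
  exists2 k : R, 0 < k & k <= r /\ forall u, N u < k -> N (g u) <= b.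
Proof.
move=> r0 b0 cg g0; have [k k0 hk] := cg b b0.
exists (Num.min r k); first by rewrite lt_min r0 k0.
split; first by rewrite ge_min lexx.
by move=> u; rewrite lt_min => /andP[_ uk]; have := hk u; rewrite g0 !subr0; exact.
Qed.

(** Serves both v and - v, with [z] the value of zeta there, so that the logarithmic derivative is
    the left-hand side of the addition formula. [K] records the simple pole at 0 with residue 1. *)
Lemma sigma_quotient_hasd (sig zeta m : C -> C) (v z : C) :
  (forall u, sig u != 0 -> hasd sig u (zeta u * sig u)) ->
  (forall u, sig (- u) = - sig u) -> (forall u, zeta (- u) = - zeta u) ->
  (forall u, sig u = u + u ^+ 5 * m u) -> cts m 0 -> sig v != 0 ->
  let Phi u := sig (v - u) / (sig u * sig v) * cexp (z * u) in
  exists2 K : C -> C, cts K 0 /\ K 0 = 1 &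
  exists2 r : R, 0 < r & forall u, u != 0 -> N u < r ->
    [/\ Phi u != 0, K u = u * Phi u &
        hasd Phi u ((zeta (u - v) - zeta u + z) * Phi u)].
Proof.
move=> dsig sN zN sE cm sv Phi.
pose k u := 1 + u ^+ 4 * m u.
have kk u : sig u = u * k u by rewrite sE /k; ring.
have ck : cts k 0 by rewrite /k; cts_tac.
have k1 : k 0 = 1 by rewrite /k; ring.
have k0 : k 0 != 0 by rewrite k1 oner_eq0.
have csv : cts (fun u => sig (v - u)) 0.
  have sv0 : sig (v - 0) != 0 by rewrite subr0.
  exact: hasd_cts (hasd_comp (hasdB (hasd_cst v 0) (hasd_id 0)) (dsig _ sv0)).
have ce : cts (fun u => cexp (z * u)) 0.
  exact: hasd_cts (hasd_comp (hasdMl z (hasd_id 0)) (cexp_hasd (z * 0))).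
pose K u := sig (v - u) / (k u * sig v) * cexp (z * u).
have cK : cts K 0.
  by rewrite /K; cts_tac; rewrite mulf_neq0.
exists K; first by split=> //; rewrite /K k1 subr0 mul1r mulr0 cexp0 divff// mulr1.
have [r1 r10 h1] := cts_neq0 ck k0.
have sv0 : sig (v - 0) != 0 by rewrite subr0.
have [r2 r20 h2] := cts_neq0 csv sv0.
exists (Num.min r1 r2); first by rewrite lt_min r10 r20.
move=> u u0; rewrite lt_min => /andP[ur1 ur2].
have ku : k u != 0 by apply: h1; rewrite subr0.
have svu : sig (v - u) != 0 by apply: h2; rewrite subr0.
have su : sig u != 0 by rewrite kk mulf_neq0.
have e0 := cexp_neq0 (z * u).
have ssv : sig u * sig v != 0 by rewrite mulf_neq0.
split.
- by rewrite /Phi mulf_neq0// mulf_neq0// invr_neq0.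
- by rewrite /Phi /K (kk u); field; rewrite sv ku u0.
apply: hasd_eq (hasdM (@hasd_div _ (fun u => sig (v - u)) (fun u => sig u * sig v) u _ _ ssv
  (hasd_comp (hasdB (hasd_cst v u) (hasd_id u)) (dsig _ svu)) (hasdMr (sig v) (dsig u su)))
  (hasd_comp (hasdMl z (hasd_id u)) (cexp_hasd (z * u)))) _.
have -> : zeta (v - u) = - zeta (u - v) by rewrite -zN opprB.
rewrite /Phi; move: (zeta (u - v)) (zeta u) (sig (v - u)) (cexp _) => a b c d.
by field; rewrite su sv.
Qed.

(** The product of Psi and the claimed inverse has logarithmic derivative 0, because p' - mu3 is the
    combination of p' + c and p' - c with coefficients (1 + alpha)/2 and (1 - alpha)/2, alpha = -
    mu3 / c. *)
Lemma log_derivative_integration (f Psi L Phi1 Phi2 p p' K : C -> C)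
    (mu1 mu3 e c l : C) (r : R) : 0 < r -> c != 0 ->
  cts K 0 -> K 0 = 1 -> cts L 0 -> L 0 = 0 ->
  (fun u => Psi u - u^-1) x @[x --> (0 : C)^'] --> l ->
  (forall u, u != 0 -> N u < r ->
    [/\ p u - e != 0, (f u)^-1 = mu1 / 2 - (p' u - mu3) / (2 * (p u - e)) &
        hasd Psi u (- (Psi u / f u))]) ->
  (forall u, u != 0 -> N u < r ->
    [/\ Phi1 u != 0, Phi2 u != 0, K u = u * Phi1 u,
        hasd Phi1 u ((p' u + c) / (2 * (p u - e)) * Phi1 u) &
        hasd Phi2 u ((p' u - c) / (2 * (p u - e)) * Phi2 u)]) ->
  (forall u, u != 0 -> N u < r -> cts L u /\ cexp (L u) = Phi1 u / Phi2 u) ->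
  forall u, u != 0 -> N u < r ->
  (Psi u)^-1 = (Phi1 u)^-1 * cexp (mu1 / 2 * u) * cexp ((1 - - mu3 / c) / 2 * L u).
Proof.
move=> r0 c0 cK K0 cL L0 limPsi hf hPhi hL u u0 ur.
pose be := (1 - - mu3 / c) / 2.
(* Since Psi - 1/u has a finite limit, u * Psi tends to 1, so [J] is continuous at 0. *)
pose J u := if u == 0 then 1 else u * Psi u.
have cJ : cts J 0.
  move=> d d0; have M0 : 0 < N l + 1 by rewrite ltr_wpDl ?normc_ge0.
  have /(@cvg_normcP _ _ (0 : C)^' _ _ l)/(_ 1 ltr01)/dnbhs_normcP[k k0 hk] := limPsi.
  exists (Num.min k (d / (N l + 1))); first by rewrite lt_min k0 divr_gt0.
  move=> w; rewrite subr0 lt_min => /andP[wk wd].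
  rewrite /J eqxx; case: eqVneq => [_|w0]; first by rewrite subrr normc0 ltW.
  have -> : w * Psi w - 1 = w * (Psi w - w^-1) by field.
  have := hk w w0; rewrite subr0 => /(_ wk) H.
  have {}H : N (Psi w - w^-1) <= N l + 1.
    by have := normcD (Psi w - w^-1 - l) l; rewrite subrK; lra.
  rewrite normcM; move: wd; rewrite ltr_pdivlMr// => /ltW; apply: le_trans.
  by rewrite ler_wpM2l ?normc_ge0.
have ce (a : C) (g : C -> C) : cts g 0 -> cts (fun w => cexp (a * g w)) 0.
  move=> cg; apply: (@cts_comp _ (fun w => a * g w) (@cexp R)); first by cts_tac.
  exact: hasd_cts (cexp_hasd _).
have ce1 := ce (mu1 / 2) _ (cts_id 0); have ce2 := ce be _ cL.
(* The form of [G] below that extends to 0: J / K is Psi / Phi1 with numerator and denominator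
   multiplied by w. *)
pose H w := J w / K w * cexp (mu1 / 2 * w) * cexp (be * L w).
have K00 : K 0 != 0 by rewrite K0 oner_eq0.
have cH : cts H 0 by rewrite /H; cts_tac.
have H0 : H 0 = 1 by rewrite /H /J eqxx K0 L0 !mulr0 cexp0 divr1 !mulr1.
pose G w := Psi w * (Phi1 w)^-1 * cexp (mu1 / 2 * w) * cexp (be * L w).
have GH w : w != 0 -> N w < r -> G w = H w.
  move=> w0 wr; have [P1 _ KE _ _] := hPhi w w0 wr.
  by rewrite /G /H /J (negbTE w0) KE; field; rewrite w0 P1.
have near w : w != 0 -> N w < r -> exists2 k : R, 0 < k & forall t, N (t - w) < k -> t != 0 /\ N t < r.
  move=> w0 wr; exists (Num.min (N w) (r - N w)); first by rewrite lt_min normc_gt0 w0 subr_gt0.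
  move=> t; rewrite lt_min => /andP[w1 w2]; split.
    by apply: contraTneq w1 => ->; rewrite sub0r normc_opp ltxx.
  by have := normcD (t - w) w; rewrite subrK; lra.
have dH w : w != 0 -> N w < r -> hasd H w 0.
  move=> w0 wr; have [k k0 hk] := near w w0 wr.
  have [pe fE dPsi] := hf w w0 wr; have [P1 P2 _ dP1 dP2] := hPhi w w0 wr.
  have [cLw Lw] := hL w w0 wr.
  have Lk t : N (t - w) < k -> cexp (L t) = Phi1 t / Phi2 t.
    by move=> /hk[t0 tr]; case: (hL t t0 tr).
  have dL := log_branch_hasd k0 cLw Lk (hasd_div P2 dP1 dP2).
  have dG := hasdM (hasdM (hasdM dPsi (hasdV P1 dP1))
    (hasd_comp (hasdMl (mu1 / 2) (hasd_id w)) (cexp_hasd (mu1 / 2 * w))))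
    (hasd_comp (hasdMl be dL) (cexp_hasd (be * L w))).
  apply: (hasd_ext k0 _ (hasd_eq dG _)); first by move=> t /hk[t0 tr]; exact: GH.
  rewrite fE /be; move: (cexp _) (cexp _) (Psi w) => x y z.
  by field; rewrite c0 P1 P2 pe.
have := @ray_MVT _ H (fun=> 0) u 0 cH.
rewrite H0 normc0 mul0r => /(_ _ (fun _ _ _ => lexx _)) HH.
have Hu : H u = 1.
  apply/eqP; rewrite -subr_eq0; apply/eqP; apply: eq0_normc.
  apply/eqP; rewrite eq_le normc_ge0 andbT; apply: HH => w w0 wu.
  exact: dH w0 (le_lt_trans wu ur).
have : Psi u * ((Phi1 u)^-1 * cexp (mu1 / 2 * u) * cexp (be * L u)) = 1.
  by transitivity (G u); [rewrite /G; ring|rewrite GH].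
move=> E; have P0 : Psi u != 0.
  by apply/eqP => P0; move: E; rewrite P0 mul0r => /esym/eqP; rewrite oner_eq0.
by apply: (mulfI P0); rewrite mulfV// -E.
Qed.

Lemma sigma_hasd_wzeta (g2 g3 : C) (sig : C -> C) : is_weierstrass_sigma g2 g3 sig ->
  forall u, sig u != 0 -> hasd sig u (wzeta sig u * sig u).
Proof.
move=> hs u su; apply: hasd_eq (entire_hasd (sig_entire hs) u) _.
by rewrite /wzeta divfK.
Qed.

Lemma krichever_exponential (mu1 mu2 mu3 mu4 mu6 v w : C)
    (sig zeta p p' m s f Psi L : C -> C) :
  let b := 4 * mu2 + mu1 ^+ 2 in
  let g2 := b ^+ 2 / 12 - 2 * (mu1 * mu3 + 2 * mu4) in
  let g3 := (mu1 * mu3 + 2 * mu4) * b / 6 - b ^+ 3 / 216 - 4 * mu6 - mu3 ^+ 2 in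
  weierstrass_functions g2 g3 sig zeta p p' ->
  (forall u, sig u != 0 -> hasd sig u (zeta u * sig u)) ->
  (forall u, sig u = u + u ^+ 5 * m u) -> cts m 0 ->
  sig v != 0 -> p v = b / 12 -> p' w = - mu3 -> p' v != 0 ->
  is_tate_s mu1 mu2 mu3 mu4 mu6 s -> is_fgl_exp mu1 mu2 mu3 mu4 mu6 s f ->
  is_Psi_solution f Psi ->
  let Phi u v := sig (v - u) / (sig u * sig v) * expC (zeta v * u) in
  is_branch_log (fun u => Phi u v / Phi u (- v)) L ->
  exists r : C, 0 < r /\ forall u : C, 0 < `|u| < r ->
    (Psi u)^-1 = (Phi u v)^-1 * expC (mu1 / 2 * u)
                 * expC ((1 - p' w / p' v) / 2 * L u).
Proof.
move=> b g2 g3 hw dsig sE cm sv pv p'w p'v hts hfe hPsi Phi hL.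
have sNv : sig (- v) != 0 by rewrite (wf_sigN hw) oppr_eq0.
have p'Nv : p' (- v) != 0 by rewrite (wf_p'N hw sv) oppr_eq0.
have [r1 r10 h1] := fgl_exp_wp hts hfe hw.
have [r2 r20 h2] := wzeta_addition hw sv p'v.
have [r3 r30 h3] := wzeta_addition hw sNv p'Nv.
have [K [cK K0] [r4 r40 h4]] := sigma_quotient_hasd (zeta v) dsig (wf_sigN hw) (wf_zetaN hw) sE cm sv.
have [K2 _ [r5 r50 h5]] := sigma_quotient_hasd (zeta (- v)) dsig (wf_sigN hw) (wf_zetaN hw) sE cm sNv.
have [_ [/pos_complexE[r6 r60 ->] [h6 [l hl]]]] := hPsi.
have [L0 [_ [/pos_complexE[r7 r70 ->] h7]]] := hL.
have cL u : N u < r7 -> cts L u.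
  by move=> ur; apply/ctsP; have := h7 u; rewrite normr_ltc => /(_ ur)[].
have cL0 : cts L 0 by apply: cL; rewrite normc0.
pose be := (1 - - mu3 / p' v) / 2.
have half : 0 < 2^-1 :> R by rewrite invr_gt0 ltr0n.
have lin (a : C) : cts (fun u => a * u) 0 by cts_tac; exact: cts_id.
have cb : cts (fun u => be * L u) 0 by cts_tac.
have [q1 q10 [_ k1]] := small_near ltr01 half (lin (zeta v)) (mulr0 _).
have [q2 q20 [_ k2]] := small_near ltr01 half (lin (zeta (- v))) (mulr0 _).
have [q3 q30 [_ k3]] := small_near ltr01 half (lin (mu1 / 2)) (mulr0 _).
have [q4 q40 [_ k4]] := small_near ltr01 half cL0 L0.
have beL0 : be * L 0 = 0 by rewrite L0 mulr0.
have [q5 q50 [_ k5]] := small_near ltr01 half cb beL0.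
pose r := Num.min (Num.min (Num.min (Num.min r1 r2) (Num.min r3 r4)) (Num.min (Num.min r5 r6) (Num.min r7 q1)))
  (Num.min (Num.min q2 q3) (Num.min q4 q5)).
have r0 : 0 < r.
  by rewrite !lt_min r10 r20 r30 r40 r50 r60 r70 q10 q20 q30 q40 q50.
have hr u : N u < r -> [/\ [/\ N u < r1, N u < r2, N u < r3 & N u < r4],
    [/\ N u < r5, N u < r6, N u < r7 & N u < q1] & [/\ N u < q2, N u < q3, N u < q4 & N u < q5]].
  rewrite !lt_min.
  move=> /andP[/andP[/andP[/andP[? ?] /andP[? ?]] /andP[/andP[? ?] /andP[? ?]]]].
  by move=> /andP[/andP[? ?] /andP[? ?]]; split; split.
pose Phi1 u := sig (v - u) / (sig u * sig v) * cexp (zeta v * u).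
pose Phi2 u := sig (- v - u) / (sig u * sig (- v)) * cexp (zeta (- v) * u).
have E1 u : N u < r -> Phi u v = Phi1 u.
  by move=> /hr[_ [_ _ _ uq] _]; rewrite /Phi /Phi1 expCE// k1.
have E2 u : N u < r -> Phi u (- v) = Phi2 u.
  by move=> /hr[_ _ [uq _ _ _]]; rewrite /Phi /Phi2 expCE// k2.
have pNv : p (- v) = p v by exact: wf_pN hw _ sv.
have main := @log_derivative_integration f Psi L Phi1 Phi2 p p' K mu1 mu3 (b / 12) (p' v) l r r0 p'v
  cK K0 cL0 L0 hl.
exists r%:C; split; first by rewrite ltcR.
move=> u /andP[]; rewrite normr_gt0 normr_ltc => u0 ur.
have [[_ _ _ _] [_ _ _ _] [_ uq3 _ uq5]] := hr u ur.
rewrite E1// p'w (expCE (k3 u uq3)) (expCE (k5 u uq5)).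
apply: main => // {u0 ur uq3 uq5}u.
- move=> u0 /hr[[ur1 _ _ _] [_ ur6 _ _] _]; have [f0 pe fE] := h1 u u0 ur1.
  have := h6 u; rewrite normr_gt0 u0 normr_ltc ur6 => /(_ isT)[dP PE].
  split=> //; apply: hasd_eq (derivable_hasd dP) _.
  by apply/eqP; rewrite -subr_eq0 opprK PE.
- move=> u0 ur; have [[_ ur2 ur3 ur4] [ur5 _ _ _] _] := hr u ur.
  have [_ _ pe A] := h2 u u0 ur2; have [_ _ _ B] := h3 u u0 ur3.
  have [P1 KE d1] := h4 u u0 ur4; have [P2 _ d2] := h5 u u0 ur5.
  split=> //.
    by apply: hasd_eq d1 _; rewrite A pv.
  by apply: hasd_eq d2 _; rewrite B pNv pv (wf_p'N hw sv).
- move=> u0 ur; have [_ [_ _ ur7 _] [_ _ uq4 _]] := hr u ur.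
  split; first exact: cL.
  have := h7 u; rewrite normr_ltc => /(_ ur7)[_ /(_ u0)].
  by rewrite E1// E2// (expCE (k4 u uq4)).
Qed.

End Krichever.

Theorem mainTheorem17 (R : realType) (mu1 mu2 mu3 mu4 mu6 : R[i])
  (sig : R[i] -> R[i]) (v w : R[i]) (s f Psi L : R[i] -> R[i]) :
  let b := 4 * mu2 + mu1 ^+ 2 in
  let g2 := b ^+ 2 / 12 - 2 * (mu1 * mu3 + 2 * mu4) in
  let g3 := (mu1 * mu3 + 2 * mu4) * b / 6 - b ^+ 3 / 216 - 4 * mu6 - mu3 ^+ 2 in
  g2 ^+ 3 - 27 * g3 ^+ 2 != 0 ->
  is_weierstrass_sigma g2 g3 sig ->
  sig v != 0 -> sig w != 0 ->
  wp sig v = b / 12 ->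
  wp' sig w = - mu3 ->
  wp' sig v != 0 ->
  is_tate_s mu1 mu2 mu3 mu4 mu6 s ->
  is_fgl_exp mu1 mu2 mu3 mu4 mu6 s f ->
  is_Psi_solution f Psi ->
  is_branch_log (fun u => PhiW sig u v / PhiW sig u (- v)) L ->
  let alpha := wp' sig w / wp' sig v in
  exists r : R[i], 0 < r /\ forall u : R[i], 0 < `|u| < r ->
    (Psi u)^-1 = (PhiW sig u v)^-1 * expC (mu1 / 2 * u)
                 * expC ((1 - alpha) / 2 * L u).
Proof.
move=> b g2 g3 _ hs sv _ pv p'w p'v hts hfe hPsi hL alpha.
have hw := weierstrass_functionsP hs.
have dsig := sigma_hasd_wzeta hs.
have [m em sE] := sig_expansion hs.
exact (krichever_exponential hw dsig sE (entire_cts 0 em) sv pv p'w p'v hts hfe hPsi hL).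
Qed.
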